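(* Let $\mathcal{F}=\{f_n\}_{n\ge1}$ and $\mathcal{G}=\{g_n\}_{n\ge1}$ be frames for closed subspaces $\mathcal{S}$ and $\mathcal{T}$ of $\mathcal{H}$, respectively. If $\mathcal{J}$ is a proper operator ideal, then the following statements are equivalent: (i) $\mathcal{F}$ and $\mathcal{G}$ are $\mathcal{J}$-equivalent; (ii) the synthesis operator $T_{\mathcal{F}-\mathcal{G}}=T_{\mathcal F}-T_{\mathcal G}$ of the sequence $\mathcal{F}-\mathcal{G}=\{f_n-g_n\}_{n\ge1}$ belongs to $\mathcal{J}$, and $N(T_{\mathcal F})=N(T_{\mathcal G})$; (iii) $\mathcal{F}$ and $\mathcal{G}$ are weakly similar and $T_{\mathcal{F}-\mathcal{G}}=T_{\mathcal F}-T_{\mathcal G}\in\mathcal{J}$; (iv) the canonical duals $\mathcal{F}^\#$ and $\mathcal{G}^\#$ are $\mathcal{J}$-equivalent. In this case, $P_{\mathcal S}-P_{\mathcal T}\in\mathcal{J}$ and $[P_{\mathcal S}:P_{\mathcal T}]=0$. Moreover, if $\mathcal{J}$ is in addition arithmetic mean closed, then the conditions above are also equivalent to: (v) the associated Parseval frames $\tilde{\mathcal F}$ and $\tilde{\mathcal G}$ are $\mathcal{J}$-equivalent and $S_{\mathcal F}-S_{\mathcal G}\in\mathcal{J}$.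
   Context: $\mathcal{H}$ is a separable infinite-dimensional complex Hilbert space, $\mathcal{B}(\mathcal{H})$ the bounded operators on it; $R$, $N$ denote range and nullspace, $P_{\mathcal S}$ the orthogonal projection onto the closed subspace $\mathcal{S}$, $|T|=(T^*T)^{1/2}$, and $T^\dagger$ the Moore–Penrose inverse of a closed range operator $T$. An operator ideal is a two-sided ideal $\mathcal{J}$ of $\mathcal{B}(\mathcal{H})$; it is proper if $\{0\}\ne\mathcal{J}\ne\mathcal{B}(\mathcal{H})$. $\mathcal{G}\ell_{\mathcal J}=\{G\in\mathcal{B}(\mathcal{H}): G\text{ invertible},\ G-I\in\mathcal{J}\}$. Frames: a sequence $\mathcal{F}=\{f_n\}_{n\ge1}$ in a closed subspace $\mathcal{S}$ is a frame for $\mathcal{S}$ if there are $0<\alpha\le\beta$ with $\alpha\|f\|^2\le\sum_n|\langle f,f_n\rangle|^2\le\beta\|f\|^2$ for all $f\in\mathcal{S}$ (Bessel sequence if only the upper bound holds for some $\beta \geq 0$). Fix an orthonormal basis $\{e_n\}_{n\ge1}$ of $\mathcal{H}$ (identifying $\ell^2(\mathbb{N})$ with $\mathcal{H}$). The synthesis operator of a Bessel sequence $\mathcal{F}$ is the bounded operator $T_{\mathcal F}\in\mathcal{B}(\mathcal{H})$ with $T_{\mathcal F}e_n=f_n$; its frame operator is $S_{\mathcal F}=T_{\mathcal F}T_{\mathcal F}^*$. For a frame $\mathcal{F}$ for $\mathcal{S}$, $T_{\mathcal F}$ and $S_{\mathcal F}$ have closed range $\mathcal{S}$. The canonical dual of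 $\mathcal{F}$ is $\mathcal{F}^\#=\{S_{\mathcal F}^\dagger f_n\}_{n\ge1}$ and its associated Parseval frame is $\tilde{\mathcal F}=\{|T_{\mathcal F}^*|^\dagger f_n\}_{n\ge1}$; both are frames for $\mathcal{S}$. Two frames $\mathcal{F},\mathcal{G}$ for closed subspaces are $\mathcal{J}$-equivalent if there is $G\in\mathcal{G}\ell_{\mathcal J}$ with $Gg_n=f_n$ for all $n\ge1$. Frames $\mathcal{F}$ for $\mathcal{S}$ and $\mathcal{G}$ for $\mathcal{T}$ are weakly similar if there is a bounded invertible linear map $L:\mathcal{S}\to\mathcal{T}$ with $Lf_n=g_n$ for all $n\ge1$. A pair $(P,Q)$ of orthogonal projections is a Fredholm pair if $QP|_{R(P)}:R(P)\to R(Q)$ is Fredholm, and then $[P:Q]$ is its index: $[P:Q]=\dim(N(Q)\cap R(P))-\dim(R(Q)\cap N(P))$. Writing $[P:Q]=0$ includes that $(P,Q)$ is a Fredholm pair. For a compact operator $A$, $\{s_n(A)\}_{n\ge1}$ is the sequence of singular values in non-increasing order with multiplicity; for compact $A,B$, $s(B)\prec_w s(A)$ means $\sum_{i=1}^n s_i(B)\le\sum_{i=1}^n s_i(A)$ for every $n\ge1$. $\mathcal{J}$ is arithmetic mean closed if $A\in\mathcal{J}$ and $s(B)\prec_w s(A)$ imply $B\in\mathcal{J}$ (for compact $A,B$). *)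

(* Defs.v *)
From HB Require Import structures.
From mathcomp Require Import all_boot all_order all_algebra.
From mathcomp Require Import sesquilinear complex.
From mathcomp Require Import all_classical all_reals all_analysis.

Set Implicit Arguments.
Unset Strict Implicit.
Unset Printing Implicit Defensive.

Import Order.TTheory GRing.Theory Num.Theory.
Import numFieldNormedType.Exports.

Local Open Scope classical_set_scope.
Local Open Scope complex_scope.
Local Open Scope ring_scope.

(* The inner product is linear in its first argument and conjugate-linear in
   its second one. *)
HB.mixin Record CompleteNormedModule_isHilbert (R : realType) H
    & CompleteNormedModule R[i] H := {
  inner : {dot H for (Num.conj : R[i] -> R[i])};
  normr_inner : forall x : H, `|x| ^+ 2 = inner x x
}.

#[short(type="hilbertType")]
HB.structure Definition Hilbert (R : realType) :=
  {H of CompleteNormedModule R[i] H & CompleteNormedModule_isHilbert R H}.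

(* The norm of MathComp-Analysis takes its values in R[i]; nrm is the same
   number as an element of R. *)
Definition nrm (R : realType) (V : normedZmodType R[i]) (x : V) : R :=
  complex.Re `|x|.

Section Hilbert.
Variables (R : realType) (H : hilbertType R).
Implicit Types (A B P Q : H -> H) (S T V W : set H) (F G : nat -> H).

Definition orthonormal_basis (e : nat -> H) :=
  (forall m n, inner (e m) (e n) = (m == n)%:R) /\
  (forall x, series (fun n => inner x (e n) *: e n) @ \oo --> x).

Definition closed_subspace S :=
  [/\ S 0, forall (a : R[i]) x y, S x -> S y -> S (a *: x + y) & closed S].

Definition has_dim V (n : nat) := exists b : 'I_n -> H,
  (forall i, V (b i)) /\
  (forall x, V x -> exists! c : 'rV[R[i]]_n, x = \sum_i c 0 i *: b i).

Definition finite_dim V := exists n, has_dim V n.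

(* Meaningful only when V is a finite-dimensional subspace. *)
Definition dim V : nat := get [set n | has_dim V n].

Definition nullspace A : set H := [set x | A x = 0].

(* A represents an operator defined on V; its values outside V are ignored. *)
Definition bounded_linear_on V A :=
  (forall (a : R[i]) x y, V x -> V y -> A (a *: x + y) = a *: A x + A y) /\
  (exists M : R, forall x, V x -> nrm (A x) <= M * nrm x).

Definition bounded_op A := bounded_linear_on setT A.

Definition invertible A :=
  bounded_op A /\ exists B, [/\ bounded_op B, cancel A B & cancel B A].

Definition compact_op A :=
  bounded_op A /\ precompact (A @` [set x | `|x| <= 1]).

Definition is_adjoint A B := bounded_op B /\
  forall x y, inner (A x) y = inner x (B y).

Definition adjoint A : H -> H := get [set B | is_adjoint A B].

(* The order of R[i] makes this say that inner (A x) x is a nonnegative real,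
   which on a complex space entails self-adjointness. *)
Definition positive_op A :=
  bounded_op A /\ forall x, 0 <= inner (A x) x.

Definition sqrt_op A : H -> H := get [set B | positive_op B /\ B \o B = A].

Definition abs_op A : H -> H := sqrt_op (adjoint A \o A).

Definition is_pinv A B :=
  [/\ bounded_op B, A \o B \o A = A, B \o A \o B = B,
      adjoint (A \o B) = A \o B & adjoint (B \o A) = B \o A].

Definition pinv A : H -> H := get [set B | is_pinv A B].

Definition orth_projection P :=
  [/\ bounded_op P, P \o P = P & adjoint P = P].

Definition orthoproj S : H -> H := get [set P | orth_projection P /\ range P = S].

Definition fredholm_between A V W :=
  [/\ finite_dim (V `&` nullspace A), closed (A @` V) &
      exists k (w : 'I_k -> H), (forall i, W (w i)) /\
        forall y, W y -> exists2 x, V x &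
          exists c : 'I_k -> R[i], y = A x + \sum_i c i *: w i].

Definition fredholm_pair P Q :=
  [/\ orth_projection P, orth_projection Q &
      fredholm_between (Q \o P) (range P) (range Q)].

Definition pair_index P Q : int :=
  (dim (nullspace Q `&` range P))%:Z - (dim (range Q `&` nullspace P))%:Z.

Definition operator_ideal (J : set (H -> H)) :=
  [/\ J `<=` bounded_op, J (cst 0),
      forall A B, J A -> J B -> J (A \+ B),
      forall A B, bounded_op A -> J B -> J (A \o B) &
      forall A B, J A -> bounded_op B -> J (A \o B)].

Definition proper_operator_ideal (J : set (H -> H)) :=
  [/\ operator_ideal J, J <> [set cst 0] & J <> bounded_op].

(* s lists the nonzero eigenvalues of |A| in non-increasing order, each one
   repeated according to its multiplicity, followed by zeros if there are
   finitely many of them. *)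
Definition is_singular_values A (s : nat -> R) :=
  [/\ forall n, 0 <= s n, nonincreasing_seq s &
      forall l : R, 0 < l -> exists2 k,
        has_dim [set x | abs_op A x = l%:C *: x] k &
        ([set n | s n = l] #= `I_k)%card].

Definition singular_values A : nat -> R := get [set s | is_singular_values A s].

Definition weakly_submajorized (t s : nat -> R) :=
  forall n, \sum_(i < n) t i <= \sum_(i < n) s i.

Definition am_closed (J : set (H -> H)) := forall A B,
  compact_op A -> compact_op B -> J A ->
  weakly_submajorized (singular_values B) (singular_values A) -> J B.

Definition is_frame S F :=
  (forall n, S (F n)) /\
  exists alpha beta : R, [/\ 0 < alpha, alpha <= beta & forall f, S f ->
    ((alpha * nrm f ^+ 2)%:E <=
       \sum_(0 <= n <oo) (nrm (inner f (F n)) ^+ 2)%:E <=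
     (beta * nrm f ^+ 2)%:E)%E].

Definition synthesis (e F : nat -> H) : H -> H :=
  get [set A | bounded_op A /\ forall n, A (e n) = F n].

Definition frame_op (e F : nat -> H) : H -> H :=
  synthesis e F \o adjoint (synthesis e F).

Definition canonical_dual (e F : nat -> H) : nat -> H :=
  fun n => pinv (frame_op e F) (F n).

Definition parseval_frame (e F : nat -> H) : nat -> H :=
  fun n => pinv (abs_op (adjoint (synthesis e F))) (F n).

Definition GLJ (J : set (H -> H)) : set (H -> H) :=
  [set A | invertible A /\ J (A \- id)].

Definition J_equivalent (J : set (H -> H)) F G :=
  exists2 A, GLJ J A & forall n, A (G n) = F n.

Definition weakly_similar S T F G := exists L K : H -> H,
  [/\ bounded_linear_on S L /\ bounded_linear_on T K,
      set_fun S T L /\ set_fun T S K,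
      {in S, cancel L K} /\ {in T, cancel K L} &
      forall n, L (F n) = G n].

End Hilbert.

(* Main.v *)
(** The equivalences reduce to one statement on the synthesis operators [f] and
    [g], which have closed range: [W * g = f] for an invertible [W] in
    [1 + J] if and only if [f - g] lies in [J] and [f], [g] have the same
    kernel. For the converse direction let [E] be the projection onto the
    orthogonal complement of the kernel, [C] and [D] the inverses of
    [f^* f + 1 - E] and [g^* g + 1 - E], and [P = f C f^*], [Q = g D g^*] the
    projections onto the ranges. The operator
    [W0 = f D g^* + (1 - P) (1 - Q)] lies in [1 + J], and the elements of the
    proper ideal [J] are compact. So [W0] has index zero, which is the
    statement on [[P : Q]], and a finite-rank correction that does not affect
    [W0 g = f] makes it invertible.

    The canonical duals and the Parseval frames have synthesis operators [f C]
    and [f K] with [K = sqrt C]. Passing from [C - D] in [J] to the difference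
    [X] of the square roots uses that [J] is arithmetic mean closed: [X] solves
    a Sylvester equation [2 X = D' + Y X + X Y'] with strict contractions [Y],
    [Y'], so each of its Ky Fan norms is at most a fixed multiple of that of
    [D'], which belongs to [J]. *)
Require Import Defs.
From HB Require Import structures.
From mathcomp Require Import all_boot all_order all_algebra.
From mathcomp Require Import sesquilinear complex ring lra finmap.
From mathcomp Require Import all_classical all_reals all_analysis.
Import Defs.
Set Implicit Arguments.
Unset Strict Implicit.
Unset Printing Implicit Defensive.
Import Order.TTheory GRing.Theory Num.Theory.
Import numFieldNormedType.Exports.
Local Open Scope classical_set_scope.
Local Open Scope complex_scope.
Local Open Scope ring_scope.

(** * Inner products *)

(** An ideal is stable under sums, products and differences of inverses, but not under limits, and
    nothing else is known about [J]. So whatever is compared between the two frames is built by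
    finitely many ring operations. Adding [1 - E] to [f^⋆ f] serves this: it replaces a
    Moore-Penrose inverse by an ordinary one, so that [A' - B' = - A' (A - B) B'] applies, and
    [1 - E] cancels from the difference because equal kernels give equal [E]. Adjoints fit in as
    well, since [A^⋆ = L A K^⋆] for suitable bounded [K] and [L].

    Square roots are genuine limits and break this pattern; there the ideal is tested through Ky Fan
    norms, which are seminorms and can absorb the unknown on both sides of an inequality.

    Compactness of the elements of [J] comes from properness: a non-compact element could be
    compressed to an invertible operator. Index zero then comes from the Fredholm alternative for
    [1 + K], itself reduced to square matrices by splitting [K] into a small and a finite-rank
    part. *)

Section nrm.
Variables (R : realType) (V : normedZmodType R[i]).
Implicit Types x y : V.

Lemma nrmE x : `|x| = (nrm x)%:C.
Proof. by rewrite /nrm RRe_real ?normr_real. Qed.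

Lemma nrm_ge0 x : 0 <= nrm x.
Proof. by rewrite -ler0c -nrmE normr_ge0. Qed.

Lemma nrm0 : nrm (0 : V) = 0.
Proof. by rewrite /nrm normr0. Qed.

Lemma nrmN x : nrm (- x) = nrm x.
Proof. by rewrite /nrm normrN. Qed.

Lemma nrmC x y : nrm (x - y) = nrm (y - x).
Proof. by rewrite -nrmN opprB. Qed.

Lemma nrm_eq0 x : nrm x = 0 -> x = 0.
Proof. by move=> h; apply/normr0_eq0; rewrite nrmE h. Qed.

Lemma nrmD x y : nrm (x + y) <= nrm x + nrm y.
Proof. by rewrite -lecR rmorphD /= -!nrmE ler_normD. Qed.

Lemma nrmB x y : nrm (x - y) <= nrm x + nrm y.
Proof. by rewrite -(nrmN y) nrmD. Qed.

End nrm.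

Section nrmc.
Variable R : realType.
Implicit Types a b : R[i].

Lemma nrmM a b : nrm (a * b) = nrm a * nrm b.
Proof. by apply: complexI; rewrite rmorphM /= -!nrmE normrM. Qed.

Lemma nrm_real (r : R) : nrm (r%:C) = `|r|.
Proof. by rewrite /nrm normc_def /= expr0n /= addr0 sqrtr_sqr. Qed.

Lemma nrm_conj a : nrm (a^*)%R = nrm a.
Proof. by rewrite /nrm norm_conjC. Qed.

Lemma nrmJ a : a * (a^*)%R = (nrm a ^+ 2)%:C.
Proof. by rewrite -normCK nrmE rmorphXn. Qed.

Lemma Re_le_nrm a : complex.Re a <= nrm a.
Proof.
by apply: le_trans (ler_norm _) _; rewrite -lecR -nrmE normc_ge_Re.
Qed.

Lemma conjR (r : R) : ((r%:C)^*)%R = r%:C :> R[i].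
Proof. exact: conjc_real. Qed.

Lemma ReD a b : complex.Re (a + b) = complex.Re a + complex.Re b.
Proof. by case: a b => [a1 a2] [b1 b2]. Qed.

Lemma ReN a : complex.Re (- a) = - complex.Re a.
Proof. by case: a. Qed.

Lemma ReB a b : complex.Re (a - b) = complex.Re a - complex.Re b.
Proof. by rewrite ReD ReN. Qed.

Lemma ReZ (r : R) a : complex.Re (r%:C * a) = r * complex.Re a.
Proof. by case: a => a1 a2 /=; rewrite mul0r subr0. Qed.

Lemma Re_conj a : complex.Re (a^*)%R = complex.Re a.
Proof. by case: a. Qed.

Lemma Re_iM a : complex.Re ('i%C * a) = - complex.Im a.
Proof. by rewrite mulrC ReiNIm. Qed.

Lemma Re_sum I (r : seq I) (P : pred I) (F : I -> R[i]) :
  complex.Re (\sum_(i <- r | P i) F i) = \sum_(i <- r | P i) complex.Re (F i).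
Proof. by elim/big_ind2 : _ => // a b c d <- <-; rewrite ReD. Qed.

End nrmc.

Section inner.
Variables (R : realType) (H : hilbertType R).
Implicit Types (x y z : H) (a : R[i]).

Lemma innerC x y : inner y x = ((inner x y)^*)%R.
Proof. by rewrite (@hermC _ false (Num.conj : {rmorphism R[i] -> R[i]})) expr0 mul1r. Qed.

Lemma innerDl x y z : inner (x + y) z = inner x z + inner y z.
Proof. exact: linearDl. Qed.
Lemma innerDr x y z : inner z (x + y) = inner z x + inner z y.
Proof. exact: linearDr. Qed.
Lemma innerBl x y z : inner (x - y) z = inner x z - inner y z.
Proof. exact: linearBl. Qed.
Lemma innerBr x y z : inner z (x - y) = inner z x - inner z y.
Proof. exact: linearBr. Qed.
Lemma innerNl x z : inner (- x) z = - inner x z.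
Proof. exact: linearNl. Qed.
Lemma innerNr x z : inner z (- x) = - inner z x.
Proof. exact: linearNr. Qed.
Lemma inner0l z : inner 0 z = 0.
Proof. exact: linear0l. Qed.
Lemma inner0r z : inner z 0 = 0.
Proof. exact: linear0r. Qed.
Lemma innerZl a x z : inner (a *: x) z = a * inner x z.
Proof. exact: linearZl_LR. Qed.
Lemma innerZr a x z : inner z (a *: x) = (a^*)%R * inner z x.
Proof. exact: linearZr_LR. Qed.
Lemma inner_suml I (r : seq I) (P : pred I) (F : I -> H) z :
  inner (\sum_(i <- r | P i) F i) z = \sum_(i <- r | P i) inner (F i) z.
Proof. exact: linear_sumlz. Qed.
Lemma inner_sumr I (r : seq I) (P : pred I) (F : I -> H) z :
  inner z (\sum_(i <- r | P i) F i) = \sum_(i <- r | P i) inner z (F i).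
Proof. exact: linear_sumr. Qed.

Lemma inner_eq0C x y : inner x y = 0 -> inner y x = 0.
Proof. by move=> h; rewrite innerC h rmorph0. Qed.

Lemma innerxx x : inner x x = (nrm x ^+ 2)%:C.
Proof. by rewrite -normr_inner nrmE rmorphXn. Qed.

Lemma nrmZ a x : nrm (a *: x) = nrm a * nrm x.
Proof. by apply: complexI; rewrite rmorphM /= -!nrmE normrZ. Qed.

Lemma nrm2E x : nrm x ^+ 2 = complex.Re (inner x x).
Proof. by rewrite innerxx. Qed.

Lemma Re_innerC x y : complex.Re (inner y x) = complex.Re (inner x y).
Proof. by rewrite innerC Re_conj. Qed.

Lemma nrmD2 x y :
  nrm (x + y) ^+ 2 = nrm x ^+ 2 + nrm y ^+ 2 + 2 * complex.Re (inner x y).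
Proof. by rewrite !nrm2E innerDl !innerDr !ReD (Re_innerC x y); ring. Qed.

Lemma nrmB2 x y :
  nrm (x - y) ^+ 2 = nrm x ^+ 2 + nrm y ^+ 2 - 2 * complex.Re (inner x y).
Proof. by rewrite nrmD2 nrmN innerNr ReN mulrN. Qed.

Lemma pythagoras x y : inner x y = 0 ->
  nrm (x + y) ^+ 2 = nrm x ^+ 2 + nrm y ^+ 2.
Proof. by move=> h; rewrite nrmD2 h /= mulr0 addr0. Qed.

Lemma inner_ext x y : (forall z, inner z x = inner z y) -> x = y.
Proof.
move=> h; apply/eqP; rewrite -subr_eq0; apply/eqP/nrm_eq0/eqP.
by rewrite -sqrf_eq0 nrm2E innerBr h subrr.
Qed.

Lemma innerxx_eq0 x : inner x x = 0 -> x = 0.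
Proof.
by move=> h; apply/nrm_eq0/eqP; rewrite -sqrf_eq0 nrm2E h.
Qed.

(** Expand the square of [nrm y ^+ 2 *: x - inner x y *: y], a multiple of the component of [x]
    orthogonal to [y]. *)
Lemma cauchy_schwarz x y : nrm (inner x y) <= nrm x * nrm y.
Proof.
have [->|y0] := eqVneq y 0; first by rewrite inner0r !nrm0 mulr0.
have ny : 0 < nrm y ^+ 2.
  rewrite exprn_gt0// lt_neqAle nrm_ge0 andbT eq_sym.
  by apply: contra_neq y0 => /nrm_eq0.
rewrite -ler_sqr ?nnegrE ?mulr_ge0 ?nrm_ge0// exprMn.
have := sqr_ge0 (nrm (((nrm y ^+ 2)%:C) *: x - inner x y *: y)).
rewrite nrmB2 !nrmZ innerZl innerZr nrm_real (ger0_norm (ltW ny)).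
rewrite (mulrC _ (inner x y)) nrmJ -rmorphM /= => h.
suff : 0 <= nrm y ^+ 2 * (nrm x ^+ 2 * nrm y ^+ 2 - nrm (inner x y) ^+ 2).
  by rewrite pmulr_rge0// subr_ge0.
by apply: le_trans h _; rewrite le_eqVlt; apply/orP; left; apply/eqP; ring.
Qed.

Lemma Re_inner_le x y : complex.Re (inner x y) <= nrm x * nrm y.
Proof. exact: le_trans (Re_le_nrm _) (cauchy_schwarz _ _). Qed.

Lemma parallelogram x y :
  nrm (x + y) ^+ 2 + nrm (x - y) ^+ 2 = 2 * (nrm x ^+ 2 + nrm y ^+ 2).
Proof. by rewrite nrmD2 nrmB2; ring. Qed.

End inner.

(** * Convergence and closed sets in terms of real tolerances *)

Section topology.
Variables (R : realType) (H : hilbertType R).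
Implicit Types (x y z : H) (V : set H) (u : nat -> H).

Definition tends_to u x := forall eps : R, 0 < eps ->
  exists N, forall n, (N <= n)%N -> nrm (u n - x) <= eps.

Definition cauchy_seq u := forall eps : R, 0 < eps ->
  exists N, forall m n, (N <= m)%N -> (N <= n)%N -> nrm (u m - u n) <= eps.

Lemma cvg_tends_to u x : u @ \oo --> x -> tends_to u x.
Proof.
move=> /cvgrPdist_le h eps e0.
have /h[N _ hN] : 0 < eps%:C by rewrite ltcR.
by exists N => n /hN; rewrite nrmE lecR nrmC.
Qed.

Lemma complete u : cauchy_seq u -> exists x, tends_to u x.
Proof.
move=> h; suff /cvg_tends_to : cvgn u by eexists; eassumption.
apply: cauchy_cvg; apply: cauchy_exP => e e0.
(* Radii live in [R[i]], where a positive element is real; halving turns the large inequality of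
   [cauchy_seq] into the strict one of a ball. *)
have eE : e = (complex.Re e)%:C by rewrite RRe_real// gtr0_real.
have {}e0 : 0 < complex.Re e by rewrite -ltcR -eE.
have [N hN] := h (complex.Re e / 2) ltac:(by rewrite divr_gt0).
exists (u N), N => // n /= Nn.
rewrite -ball_normE /ball_/= eE nrmE ltcR.
by apply: le_lt_trans (hN _ _ (leqnn _) Nn) _; rewrite ltr_pdivrMr// ltr_pMr// ltr1n.
Qed.

Lemma closed_approx V x : closed V ->
  (forall eps : R, 0 < eps -> exists2 y, V y & nrm (x - y) <= eps) -> V x.
Proof.
move=> cV h; apply: cV => B /nbhs_ballP[e /= e0 eB].
have eE : e = (complex.Re e)%:C by rewrite RRe_real// gtr0_real.
have {}e0 : 0 < complex.Re e by rewrite -ltcR -eE.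
have [y Vy xy] := h (complex.Re e / 2) ltac:(by rewrite divr_gt0).
exists y; split => //; apply: eB.
rewrite -ball_normE /ball_/= eE nrmE ltcR.
by apply: le_lt_trans xy _; rewrite ltr_pdivrMr// ltr_pMr// ltr1n.
Qed.

Lemma closed_tends_to V u x :
  closed V -> (forall n, V (u n)) -> tends_to u x -> V x.
Proof.
move=> cV Vu ux; apply: closed_approx cV _ => e /ux[N hN].
by exists (u N) => //; rewrite nrmC hN.
Qed.

Lemma closedP V :
  (forall x, (forall eps : R, 0 < eps -> exists2 y, V y & nrm (x - y) <= eps) ->
     V x) -> closed V.
Proof.
move=> h x cx; apply: h => eps e0.
have [|y [Vy xy]] := cx (ball x eps%:C); first by apply: nbhsx_ballx; rewrite ltcR.
exists y => //; move: xy; rewrite -ball_normE /ball_/= nrmE ltcR.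
exact: ltW.
Qed.

Lemma tends_to_unique u x y : tends_to u x -> tends_to u y -> x = y.
Proof.
move=> ux uy; apply/subr0_eq/nrm_eq0/eqP; rewrite eq_le nrm_ge0 andbT.
apply/ler_addgt0Pr => e e0; rewrite add0r.
have e2 : 0 < e / 2 by rewrite divr_gt0.
have [N hN] := ux _ e2; have [M hM] := uy _ e2.
rewrite -(subrKA (u (maxn N M))) (le_trans (nrmD _ _))// (splitr e) lerD//.
  by rewrite nrmC hN// leq_maxl.
by rewrite hM// leq_maxr.
Qed.

End topology.

(** * Riesz representation and orthogonal projection *)

Section riesz.
Variables (R : realType) (H : hilbertType R).
Implicit Types (x y z : H) (V : set H).

Section closed_subspace.
Variables (V : set H) (hV : closed_subspace V).

Lemma csub0 : V 0. Proof. by case: hV. Qed.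
Lemma csubD x y : V x -> V y -> V (x + y).
Proof. by case: hV => _ h _ Vx Vy; rewrite -(scale1r x); exact: h. Qed.
Lemma csubZ (a : R[i]) x : V x -> V (a *: x).
Proof.
by case: hV => V0 h _ Vx; rewrite -(addr0 (a *: x)); exact: h.
Qed.
Lemma csubN x : V x -> V (- x).
Proof. by rewrite -scaleN1r; exact: csubZ. Qed.
Lemma csubB x y : V x -> V y -> V (x - y).
Proof. by move=> Vx Vy; apply: csubD => //; exact: csubN. Qed.
Lemma csub_sum I (r : seq I) (P : pred I) (F : I -> H) :
  (forall i, V (F i)) -> V (\sum_(i <- r | P i) F i).
Proof.
by move=> h; elim/big_ind : _ => //; [exact: csub0|exact: csubD].
Qed.
Lemma csub_closed : closed V. Proof. by case: hV. Qed.

End closed_subspace.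

(* The limit of a minimizing sequence of [nrm x ^+ 2 - 2 Re (phi x)] over [V]
   represents [phi]. *)
Lemma riesz V (phi : H -> R[i]) (M : R) :
  V 0 -> (forall (a : R[i]) x y, V x -> V y -> V (a *: x + y)) ->
  (forall (a : R[i]) x y, V x -> V y -> phi (a *: x + y) = a * phi x + phi y) ->
  (forall x, V x -> nrm (phi x) <= M * nrm x) ->
  exists z, (forall x, V x -> phi x = inner x z) /\
    forall eps : R, 0 < eps -> exists2 y, V y & nrm (z - y) <= eps.
Proof.
move=> V0 linV lin bnd.
have VZ a x : V x -> V (a *: x).
  by move=> Vx; rewrite -(addr0 (a *: x)); exact: linV.
have VD x y : V x -> V y -> V (x + y).
  by move=> Vx Vy; rewrite -(scale1r x); exact: linV.
have phi0 : phi 0 = 0.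
  by have := lin (-1) 0 0 V0 V0; rewrite scaler0 addr0 mulN1r addNr.
have phiZ a x : V x -> phi (a *: x) = a * phi x.
  by move=> Vx; have := lin a x 0 Vx V0; rewrite addr0 phi0 addr0.
have phiD x y : V x -> V y -> phi (x + y) = phi x + phi y.
  by move=> Vx Vy; have := lin 1 x y Vx Vy; rewrite scale1r mul1r.
pose q x := nrm x ^+ 2 - 2 * complex.Re (phi x).
(* Completing the square in [nrm x ^+ 2 - 2 M nrm x]. *)
have qlb x : V x -> - M ^+ 2 <= q x.
  move=> Vx; have := Re_le_nrm (phi x); have := bnd x Vx; rewrite /q.
  by have := sqr_ge0 (nrm x - M); nra.
pose Q := [set q x | x in V].
have hQ : has_inf Q.
  split; first by exists (q 0), 0.
  by exists (- M ^+ 2) => _ [x Vx <-]; exact: qlb.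
pose m := inf Q.
have mq x : V x -> m <= q x by move=> Vx; apply: inf_lbound; [case: hQ|exists x].
have /choice[u hu] : forall n, exists x, V x /\ q x <= m + n.+1%:R^-1.
  move=> n; have n0 : 0 < n.+1%:R^-1 :> R by rewrite invr_gt0.
  have [_ [x Vx <-] h] := inf_adherent n0 hQ.
  by exists x; split => //; exact: ltW.
(* The midpoint of two near-minimizers stays in [V], so [q] is at least [m] there, and the
   parallelogram law bounds their distance. *)
have dist x y d : V x -> V y -> q x <= m + d -> q y <= m + d -> nrm (x - y) ^+ 2 <= 4 * d.
  move=> Vx Vy qx qy; have Vh : V ((2^-1)%:C *: (x + y)) by apply/VZ/VD.
  have := mq _ Vh; have := parallelogram x y; rewrite /q in qx qy *.
  rewrite nrmZ phiZ ?phiD//; last exact: VD.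
  rewrite ReZ ReD nrm_real gtr0_norm ?invr_gt0// exprMn.
  by move: (nrm _ ^+ 2) (nrm _ ^+ 2) (nrm _ ^+ 2) (nrm _ ^+ 2) qx qy => a b c d'; lra.
have tol (eps : R) : 0 < eps -> exists N, forall n, (N <= n)%N -> n.+1%:R^-1 <= eps.
  move=> e0; have [N _ hN] := near_infty_natSinv_lt (PosNum e0).
  by exists N => n /hN /ltW.
have [z uz] : exists z, tends_to u z.
  apply: complete => eps e0.
  have [N hN] := tol (eps ^+ 2 / 4) ltac:(by rewrite divr_gt0// exprn_gt0).
  exists N => i j Ni Nj; rewrite -ler_sqr ?nnegrE ?nrm_ge0 ?(ltW e0)//.
  have [Vi qi] := hu i; have [Vj qj] := hu j.
  have := dist _ _ (eps ^+ 2 / 4) Vi Vj.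
  have -> : 4 * (eps ^+ 2 / 4) = eps ^+ 2 by field.
  apply; [apply: le_trans qi _|apply: le_trans qj _];
    rewrite lerD2l; exact: hN.
exists z; split; last first.
  by move=> eps /uz[N hN]; exists (u N); [case: (hu N)|rewrite nrmC hN].
have Re_eq x : V x -> complex.Re (phi x) = complex.Re (inner x z).
  move=> Vx; rewrite Re_innerC.
  (* First variation of [q] at [z] in the direction [x]. As [z] may lie outside [V], the inequality
     [m <= q] is used at [u n + t x] and the error is absorbed in [e]. *)
  have key (t : R) : 0 <= 2 * t * (complex.Re (inner z x) - complex.Re (phi x)) + t ^+ 2 * nrm x ^+ 2.
    apply/ler_addgt0Pr => e e0.
    have [N1 hN1] := tol (e / 2) ltac:(by rewrite divr_gt0).
    have k0 : 0 < 2 * `|t| * nrm x + 1 by rewrite ltr_wpDl ?mulr_ge0 ?nrm_ge0.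
    have [N2 hN2] := uz (e / 2 / (2 * `|t| * nrm x + 1)) ltac:(by rewrite !divr_gt0).
    pose n := maxn N1 N2; have [Vn qn] := hu n.
    have h1 := hN1 n (leq_maxl _ _); have := hN2 n (leq_maxr _ _).
    rewrite ler_pdivlMr// => h2.
    have := mq (u n + t%:C *: x) (VD _ _ Vn (VZ _ _ Vx)).
    have {qn} qn : q (u n) <= m + e / 2 by rewrite (le_trans qn)// lerD2l.
    move: qn; rewrite /q phiD ?phiZ//; last exact: VZ.
    rewrite nrmD2 nrmZ innerZr ReD ReZ conjR ReZ nrm_real exprMn real_normK ?num_real//.
    have := cauchy_schwarz (u n - z) x; have := Re_le_nrm (t%:C * inner (u n - z) x).
    rewrite nrmM nrm_real ReZ innerBl ReB -innerBl.
    have := nrm_ge0 (u n - z); have := normr_ge0 t; move: h2.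
    move: (nrm (u n - z)) (nrm (inner _ x)) (complex.Re (inner (u n) x)) (nrm (u n) ^+ 2)
      `|t| (nrm x) => d w a b t' x' h2 t0 d0 h3 h4 h5 h6.
    have : t' * w <= t' * (d * x') by apply: ler_wpM2l.
    by lra.
  set c := _ - _ in key.
  suff : c = 0 by rewrite /c; lra.
  have nx := sqr_ge0 (nrm x).
  have k1 : 0 < 1 + nrm x ^+ 2 by lra.
  (* At this [t] the quadratic polynomial is negative unless [c = 0]; the summand [1] keeps the
     denominator positive when [x = 0]. *)
  have := key (- c / (1 + nrm x ^+ 2)).
  set k := 1 + _ in k1 *.
  have -> : 2 * (- c / k) * c + (- c / k) ^+ 2 * nrm x ^+ 2
    = - (c ^+ 2 / k) - c ^+ 2 / k ^+ 2.
    by rewrite /k; field; rewrite -/k gt_eqF.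
  have a1 : 0 <= c ^+ 2 / k by rewrite divr_ge0 ?sqr_ge0 ?ltW.
  have a2 : 0 <= c ^+ 2 / k ^+ 2 by rewrite divr_ge0 ?sqr_ge0.
  move=> h; have /eqP : c ^+ 2 / k = 0 by lra.
  by rewrite mulf_eq0 invr_eq0 (gt_eqF k1) orbF sqrf_eq0 => /eqP.
move=> x Vx; apply/eqP; rewrite eq_complex Re_eq// eqxx /=.
(* The imaginary part at [x] is, up to sign, the real part at ['i x]. *)
have := Re_eq _ (VZ 'i%C x Vx); rewrite phiZ// innerZl !Re_iM.
by move=> /oppr_inj ->.
Qed.

Lemma projection V x : closed_subspace V ->
  exists2 p, V p & forall y, V y -> inner y (x - p) = 0.
Proof.
move=> [V0 lV cV].
have [|y Vy|p [h ap]] := @riesz V (fun y => inner y x) (nrm x) V0 lV.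
- by move=> a y z _ _; rewrite innerDl innerZl.
- by rewrite mulrC cauchy_schwarz.
- exists p; first exact: closed_approx cV ap.
  by move=> y Vy; rewrite innerBr h// subrr.
Qed.

End riesz.

(** * The ring of bounded operators *)

Section operator_def.
Variables (R : realType) (H : hilbertType R).

(** Bundling the boundedness proof makes operators a ring, in which the identities behind the
    theorem are computed; equality remains that of functions. *)
Record operator := Operator { opfun :> H -> H; op_bounded : bounded_op opfun }.

Lemma op_inj (A B : operator) : (A : H -> H) = B -> A = B.
Proof.
by case: A B => [A hA] [B hB] /= AB; subst B; congr Operator; exact: Prop_irrelevance.
Qed.

Lemma op_eq (A B : operator) : (forall x, A x = B x) -> A = B.
Proof. by move=> h; apply/op_inj/funext. Qed.

HB.instance Definition _ := gen_eqMixin operator.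
HB.instance Definition _ := gen_choiceMixin operator.

Lemma bounded_opP (A : H -> H) (M : R) :
  (forall (a : R[i]) x y, A (a *: x + y) = a *: A x + A y) ->
  (forall x, nrm (A x) <= M * nrm x) -> bounded_op A.
Proof. by move=> lin bnd; split; [move=> a x y _ _|exists M => x _]. Qed.

Lemma opP (A : operator) (a : R[i]) x y : A (a *: x + y) = a *: A x + A y.
Proof. by case: A => A [lin ?]; exact: lin. Qed.

Lemma op_bound (A : operator) :
  exists2 M : R, 0 < M & forall x, nrm (A x) <= M * nrm x.
Proof.
case: A => A [? [M hM]]; exists (Num.max M 1); first by rewrite lt_max ltr01 orbT.
move=> x; apply: le_trans (hM x I) _.
by rewrite ler_wpM2r ?nrm_ge0// le_max lexx.
Qed.

Lemma zero_bounded : bounded_op (fun _ : H => 0 : H).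
Proof.
apply: (@bounded_opP _ 0) => [a x y|x]; first by rewrite scaler0 addr0.
by rewrite nrm0 mul0r.
Qed.

Lemma id_bounded : bounded_op (fun x : H => x).
Proof. by apply: (@bounded_opP _ 1) => // x; rewrite mul1r. Qed.

Lemma opp_bounded (A : operator) : bounded_op (fun x => - A x).
Proof.
have [M _ hM] := op_bound A; apply: (@bounded_opP _ M) => [a x y|x].
  by rewrite opP opprD scalerN.
by rewrite nrmN.
Qed.

Lemma add_bounded (A B : operator) : bounded_op (fun x => A x + B x).
Proof.
have [M _ hM] := op_bound A; have [N _ hN] := op_bound B.
apply: (@bounded_opP _ (M + N)) => [a x y|x].
  by rewrite !opP scalerDr addrACA.
by rewrite mulrDl (le_trans (nrmD _ _))// lerD.
Qed.

Lemma comp_bounded (A B : operator) : bounded_op (fun x => A (B x)).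
Proof.
have [M M0 hM] := op_bound A; have [N _ hN] := op_bound B.
apply: (@bounded_opP _ (M * N)) => [a x y|x]; first by rewrite !opP.
by rewrite (le_trans (hM _))// -mulrA ler_pM2l.
Qed.

Lemma scale_bounded (k : R[i]) (A : operator) : bounded_op (fun x => k *: A x).
Proof.
have [M M0 hM] := op_bound A.
apply: (@bounded_opP _ (nrm k * M)) => [a x y|x].
  by rewrite !opP scalerDr !scalerA mulrC.
by rewrite nrmZ -mulrA ler_wpM2l ?nrm_ge0.
Qed.

Definition op0 := Operator zero_bounded.
Definition op1 := Operator id_bounded.
Definition op_opp A := Operator (opp_bounded A).
Definition op_add A B := Operator (add_bounded A B).
Definition op_mul A B := Operator (comp_bounded A B).
Definition op_scale k A := Operator (scale_bounded k A).

Fact op_addA : associative op_add.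
Proof. by move=> A B C; apply: op_eq => x /=; rewrite addrA. Qed.
Fact op_addC : commutative op_add.
Proof. by move=> A B; apply: op_eq => x /=; rewrite addrC. Qed.
Fact op_add0 : left_id op0 op_add.
Proof. by move=> A; apply: op_eq => x /=; rewrite add0r. Qed.
Fact op_addN : left_inverse op0 op_opp op_add.
Proof. by move=> A; apply: op_eq => x /=; rewrite addNr. Qed.

HB.instance Definition _ :=
  GRing.isZmodule.Build operator op_addA op_addC op_add0 op_addN.

Fact op_mulA : associative op_mul.
Proof. by move=> A B C; apply: op_eq. Qed.
Fact op_mul1 : left_id op1 op_mul.
Proof. by move=> A; apply: op_eq. Qed.
Fact op_mulr1 : right_id op1 op_mul.
Proof. by move=> A; apply: op_eq. Qed.
Fact op_mulDl : left_distributive op_mul +%R.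
Proof. by move=> A B C; apply: op_eq. Qed.
Fact op_mulDr : right_distributive op_mul +%R.
Proof.
by move=> A B C; apply: op_eq => x /=; have := opP A 1 (B x) (C x); rewrite !scale1r.
Qed.

(** A ring in which [0 = 1] is allowed, since the space may be trivial here. *)
HB.instance Definition _ := GRing.Zmodule_isPzRing.Build operator
  op_mulA op_mul1 op_mulr1 op_mulDl op_mulDr.

Fact op_scaleA a b A : op_scale a (op_scale b A) = op_scale (a * b) A.
Proof. by apply: op_eq => x /=; rewrite scalerA. Qed.
Fact op_scale1 : left_id 1 op_scale.
Proof. by move=> A; apply: op_eq => x /=; rewrite scale1r. Qed.
Fact op_scaleDr : right_distributive op_scale +%R.
Proof. by move=> a A B; apply: op_eq => x /=; rewrite scalerDr. Qed.
Fact op_scaleDl A : {morph op_scale^~ A : a b / a + b}.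
Proof. by move=> a b; apply: op_eq => x /=; rewrite scalerDl. Qed.

HB.instance Definition _ := GRing.Zmodule_isLmodule.Build R[i] operator
  op_scaleA op_scale1 op_scaleDr op_scaleDl.

End operator_def.
Arguments operator {R} H.

Section operator_theory.
Variables (R : realType) (H : hilbertType R).
Implicit Types (A B C : operator H) (x y z : H).

Lemma addE A B x : (A + B) x = A x + B x. Proof. by []. Qed.
Lemma oppE A x : (- A) x = - A x. Proof. by []. Qed.
Lemma subE A B x : (A - B) x = A x - B x. Proof. by []. Qed.
Lemma mulE A B x : (A * B) x = A (B x). Proof. by []. Qed.
Lemma scaleE (k : R[i]) A x : (k *: A) x = k *: A x. Proof. by []. Qed.
Lemma oneE x : (1 : operator H) x = x. Proof. by []. Qed.
Lemma zeroE x : (0 : operator H) x = 0. Proof. by []. Qed.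
Lemma sumE I (r : seq I) (P : pred I) (F : I -> operator H) x :
  (\sum_(i <- r | P i) F i) x = \sum_(i <- r | P i) F i x.
Proof. by elim/big_rec2 : _ => // i y A _ <-. Qed.
Definition opE := (addE, oppE, mulE, scaleE, oneE, zeroE, sumE).

Lemma opD A x y : A (x + y) = A x + A y.
Proof. by have := opP A 1 x y; rewrite !scale1r. Qed.
Lemma op_z A : A 0 = 0.
Proof. by apply: (addrI (A 0)); rewrite -opD !addr0. Qed.
Lemma opZ A (a : R[i]) x : A (a *: x) = a *: A x.
Proof. by have := opP A a x 0; rewrite op_z !addr0. Qed.
Lemma opN A x : A (- x) = - A x.
Proof. by rewrite -scaleN1r opZ scaleN1r. Qed.
Lemma opB A x y : A (x - y) = A x - A y.
Proof. by rewrite opD opN. Qed.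
Lemma op_sum A I (r : seq I) (P : pred I) (F : I -> H) :
  A (\sum_(i <- r | P i) F i) = \sum_(i <- r | P i) A (F i).
Proof. by elim/big_ind2 : _ => [|a b c d <- <-|//]; [exact: op_z|rewrite opD]. Qed.

Lemma opZl (k : R[i]) A B : (k *: A) * B = k *: (A * B).
Proof. by apply: op_eq => x; rewrite !opE. Qed.
Lemma opZr (k : R[i]) A B : A * (k *: B) = k *: (A * B).
Proof. by apply: op_eq => x; rewrite !opE opZ. Qed.

(** Riesz represents [x |-> inner (A x) y], and [nrm (B y) ^+ 2 = inner (A (B y)) y] bounds the
    representatives. Hence the [get] in [adjoint] has a witness for every bounded operator. *)
Lemma adjoint_spec A : is_adjoint A (adjoint A).
Proof.
apply: getPex; have [M M0 hM] := op_bound A.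
have /choice[B hB] : forall y, exists z, forall x, inner (A x) y = inner x z.
  move=> y.
  have [|x _|z [hz _]] := @riesz _ _ setT (fun x => inner (A x) y) (M * nrm y) I (fun _ _ _ _ _ => I).
  - by move=> a x z _ _; rewrite opP innerDl innerZl.
  - rewrite (le_trans (cauchy_schwarz _ _))// mulrAC.
    by rewrite ler_wpM2r ?nrm_ge0.
  - by exists z => x; exact: hz.
exists B; split => //; apply: (@bounded_opP _ _ _ M) => [a x y|x].
  by apply: inner_ext => z; rewrite innerDr innerZr -!hB innerDr innerZr.
have [->|n0] := eqVneq (nrm (B x)) 0; first by rewrite mulr_ge0 ?nrm_ge0 ?ltW.
rewrite -(@ler_pM2r _ (nrm (B x))) ?lt_def ?n0 ?nrm_ge0//.
rewrite -expr2 nrm2E -hB (le_trans (Re_inner_le _ _))//.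
rewrite mulrAC; apply: ler_wpM2r; [exact: nrm_ge0|exact: hM].
Qed.

Definition adj A := Operator (adjoint_spec A).1.
Local Notation "A ^⋆" := (adj A) (at level 2, format "A ^⋆") : ring_scope.

Lemma adjE A x y : inner (A x) y = inner x (A^⋆ y).
Proof. exact: (adjoint_spec A).2. Qed.

Lemma adjEr A x y : inner x (A y) = inner (A^⋆ x) y.
Proof. by rewrite innerC adjE -innerC. Qed.

Lemma adj_unique A B : (forall x y, inner (A x) y = inner x (B y)) -> A^⋆ = B.
Proof. by move=> h; apply: op_eq => y; apply: inner_ext => x; rewrite -adjE h. Qed.

Lemma adjK A : A^⋆^⋆ = A.
Proof. by apply: adj_unique => x y; rewrite adjEr. Qed.
Lemma adjD A B : (A + B)^⋆ = A^⋆ + B^⋆.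
Proof. by apply: adj_unique => x y; rewrite !opE innerDl innerDr !adjE. Qed.
Lemma adjN A : (- A)^⋆ = - A^⋆.
Proof. by apply: adj_unique => x y; rewrite !opE innerNl innerNr !adjE. Qed.
Lemma adjB A B : (A - B)^⋆ = A^⋆ - B^⋆.
Proof. by rewrite adjD adjN. Qed.
Lemma adjM A B : (A * B)^⋆ = B^⋆ * A^⋆.
Proof. by apply: adj_unique => x y; rewrite !opE !adjE. Qed.
Lemma adj1 : (1 : operator H)^⋆ = 1.
Proof. by apply: adj_unique. Qed.
Lemma adj0 : (0 : operator H)^⋆ = 0.
Proof. by apply: adj_unique => x y; rewrite !opE inner0l inner0r. Qed.
Lemma adjZ (r : R) A : (r%:C *: A)^⋆ = r%:C *: A^⋆.
Proof.
apply: adj_unique => x y; rewrite !opE innerZl innerZr adjE.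
by rewrite conjR.
Qed.
Lemma adj_sum I (r : seq I) (P : pred I) (F : I -> operator H) :
  (\sum_(i <- r | P i) F i)^⋆ = \sum_(i <- r | P i) (F i)^⋆.
Proof. by elim/big_ind2 : _ => [|a b c d <- <-|//]; [exact: adj0|rewrite adjD]. Qed.

(** Explicit bounds stand in for the operator norm, which is never formed. *)
Definition bnd A (M : R) := forall x, nrm (A x) <= M * nrm x.

Lemma bndD A B M N : bnd A M -> bnd B N -> bnd (A + B) (M + N).
Proof. by move=> a b x; rewrite mulrDl (le_trans (nrmD _ _))// lerD. Qed.
Lemma bndN A M : bnd A M -> bnd (- A) M.
Proof. by move=> a x; rewrite opE nrmN. Qed.
Lemma bndB A B M N : bnd A M -> bnd B N -> bnd (A - B) (M + N).
Proof. by move=> a /bndN; exact: bndD. Qed.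
Lemma bndM A B M N : 0 <= M -> bnd A M -> bnd B N -> bnd (A * B) (M * N).
Proof.
by move=> M0 a b x; rewrite (le_trans (a _))// -mulrA ler_wpM2l.
Qed.
Lemma bndZ (k : R[i]) A M : bnd A M -> bnd (k *: A) (nrm k * M).
Proof. by move=> a x; rewrite opE nrmZ -mulrA ler_wpM2l ?nrm_ge0. Qed.
Lemma bnd0 : bnd 0 0.
Proof. by move=> x; rewrite opE nrm0 mul0r. Qed.
Lemma bnd1 : bnd 1 1.
Proof. by move=> x; rewrite opE mul1r. Qed.
Lemma bndW A M N : M <= N -> bnd A M -> bnd A N.
Proof. by move=> MN a x; rewrite (le_trans (a x))// ler_wpM2r ?nrm_ge0. Qed.
Lemma bnd_adj A M : 0 <= M -> bnd A M -> bnd (A^⋆) M.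
Proof.
move=> M0 hM x; have [->|n0] := eqVneq (nrm (A^⋆ x)) 0.
  by rewrite mulr_ge0 ?nrm_ge0.
rewrite -(@ler_pM2r _ (nrm (A^⋆ x))) ?lt_def ?n0 ?nrm_ge0//.
rewrite -expr2 nrm2E -adjE (le_trans (Re_inner_le _ _))//.
rewrite mulrAC; apply: ler_wpM2r; [exact: nrm_ge0|exact: hM].
Qed.

Lemma op_tends A u x : tends_to u x -> tends_to (A \o u) (A x).
Proof.
have [M M0 hM] := op_bound A => h e e0.
have [N hN] := h (e / M) ltac:(by rewrite divr_gt0).
exists N => n /hN; rewrite -opB ler_pdivlMr// mulrC; exact: le_trans.
Qed.

Lemma nullspace_closed A : closed_subspace (nullspace A).
Proof.
have [M M0 hM] := op_bound A; split; rewrite /nullspace/=; first exact: op_z.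
  by move=> a x y /= Ax Ay; rewrite opP Ax Ay scaler0 addr0.
apply: closedP => x h /=; apply/nrm_eq0/eqP; rewrite eq_le nrm_ge0 andbT.
apply/ler_addgt0Pr => e e0; rewrite add0r.
have [y /= Ay xy] := h (e / M) ltac:(by rewrite divr_gt0).
rewrite -(subr0 (A x)) -Ay -opB (le_trans (hM _))//.
by rewrite mulrC -ler_pdivlMr.
Qed.

(** Completeness of the algebra of operators: the limit is taken pointwise, and letting one index go
    to infinity in the Cauchy estimate makes the convergence uniform on the unit ball. *)
Lemma op_lim (U : nat -> operator H) :
  (forall e : R, 0 < e -> exists N, forall m n, (N <= m)%N -> (N <= n)%N ->
     bnd (U m - U n) e) ->
  exists L, forall e : R, 0 < e -> exists N, forall n, (N <= n)%N -> bnd (U n - L) e.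
Proof.
move=> h.
have /choice[L hL] : forall x, exists y, tends_to (fun n => U n x) y.
  move=> x; apply: complete => e e0.
  have n1 : 0 < nrm x + 1 by rewrite ltr_wpDl ?nrm_ge0.
  have [N hN] := h (e / (nrm x + 1)) ltac:(by rewrite divr_gt0).
  exists N => m n Nm Nn; apply: le_trans (hN m n Nm Nn x) _.
  rewrite -[leRHS]mulr1 -mulrA ler_pM2l// mulrC ler_pdivrMr// mul1r.
  by rewrite lerDl.
have close e : 0 < e -> exists N, forall n, (N <= n)%N -> forall x,
    nrm (U n x - L x) <= e * nrm x.
  move=> e0; have [N hN] := h e e0; exists N => n Nn x.
  apply/ler_addgt0Pr => d d0; have [M hM] := hL x d d0.
  rewrite -(subrKA (U (maxn N M) x)) (le_trans (nrmD _ _))// lerD//.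
    by apply: hN => //; exact: leq_maxl.
  by apply: hM; exact: leq_maxr.
have linL (a : R[i]) x y : L (a *: x + y) = a *: L x + L y.
  apply: tends_to_unique (hL _) _ => e e0.
  have k0 : 0 < nrm a + 1 by rewrite ltr_wpDl ?nrm_ge0.
  have [N1 h1] := hL x (e / 2 / (nrm a + 1)) ltac:(by rewrite !divr_gt0).
  have [N2 h2] := hL y (e / 2) ltac:(by rewrite divr_gt0).
  exists (maxn N1 N2) => n; rewrite geq_max => /andP[n1 n2].
  rewrite opP opprD addrACA -scalerBr (le_trans (nrmD _ _))// (splitr e).
  rewrite lerD ?h2// nrmZ; have := h1 n n1; rewrite ler_pdivlMr//.
  apply: le_trans; rewrite mulrC ler_wpM2l ?nrm_ge0//.
  by rewrite lerDl.
have bL : bounded_op L.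
  have [N hN] := close 1 ltr01; have [M M0 hM] := op_bound (U N).
  apply: (@bounded_opP _ _ _ (1 + M)) => // x.
  rewrite -(subrK (U N x) (L x)) (le_trans (nrmD _ _))// mulrDl lerD//.
  by rewrite nrmC hN.
by exists (Operator bL) => e /close.
Qed.

Definition inverse A B := A * B = 1 /\ B * A = 1.

(** The lower bound gives injectivity and a closed range, because preimages of a Cauchy sequence are
    Cauchy; injectivity of the adjoint makes the range dense. *)
Lemma bounded_below_inverse A (c : R) : 0 < c ->
  (forall x, c * nrm x <= nrm (A x)) -> (forall x, A^⋆ x = 0 -> x = 0) ->
  exists B, inverse A B.
Proof.
move=> c0 hc inj.
have injA x : A x = 0 -> x = 0.
  move=> Ax; apply/nrm_eq0/eqP; rewrite eq_le nrm_ge0 andbT.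
  by have := hc x; rewrite Ax nrm0 pmulr_rle0.
have cV : closed_subspace (range A).
  split; first by exists 0; rewrite ?op_z.
    by move=> a _ _ [x _ <-] [y _ <-]; exists (a *: x + y) => //; rewrite opP.
  apply: closedP => y hy.
  have /choice[u hu] : forall n, exists x, nrm (y - A x) <= n.+1%:R^-1.
    move=> n; have [_ [x _ <-] h] := hy n.+1%:R^-1 ltac:(by rewrite invr_gt0).
    by exists x.
  have Auy : tends_to (A \o u) y.
    move=> e e0; have [N _ hN] := near_infty_natSinv_lt (PosNum e0).
    exists N => n /hN /ltW /=; rewrite nrmC; exact: le_trans.
  have [x ux] : exists x, tends_to u x.
    apply: complete => e e0.
    have [N hN] := Auy (c * e / 2) ltac:(by rewrite divr_gt0// mulr_gt0).
    exists N => m n /hN Nm /hN Nn.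
    rewrite -(ler_pM2l c0) (le_trans (hc _))// opB -(subrKA y).
    rewrite (le_trans (nrmD _ _))// (splitr (c * e)) lerD// nrmC; exact: Nn.
  by exists x => //; exact: tends_to_unique (op_tends A ux) Auy.
have surj y : exists x, A x = y.
  have [p [x _ <-] h] := projection y cV; exists x.
  apply/esym/subr0_eq/inj/inner_ext => z.
  by rewrite -adjE inner0r h//; exists z.
have [B hB] := choice surj.
have bB : bounded_op B.
  apply: (@bounded_opP _ _ _ c^-1) => [a x y|x].
    by apply/subr0_eq/injA; rewrite opB opP !hB subrr.
  by rewrite mulrC ler_pdivlMr// mulrC -[x in leRHS]hB.
exists (Operator bB); split; apply: op_eq => x; rewrite !opE//=.
by apply/subr0_eq/injA; rewrite opB hB subrr.
Qed.

Definition pos A := forall x, 0 <= inner (A x) x.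

Lemma pos_Re A x : pos A -> inner (A x) x = (complex.Re (inner (A x) x))%:C.
Proof. by move=> /(_ x) h; rewrite RRe_real// ger0_real. Qed.

Lemma pos_ge0 A x : pos A -> 0 <= complex.Re (inner (A x) x).
Proof. by move=> p; rewrite -ler0c -pos_Re. Qed.

Lemma posP A : A^⋆ = A -> (forall x, 0 <= complex.Re (inner (A x) x)) -> pos A.
Proof.
move=> sA h x; rewrite -(@RRe_real _ (inner (A x) x)) ?ler0c//.
by apply/CrealP; rewrite -innerC adjE sA.
Qed.

(** Polarization at [x + y] and at [x + 'i y]; the second evaluation is where the complex scalars
    enter. *)
Lemma quadratic_form_eq0 A : (forall x, inner (A x) x = 0) -> A = 0.
Proof.
move=> A0; apply/op_eq => x; rewrite opE.
apply: inner_ext => y; rewrite inner0r; apply: inner_eq0C.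
have h1 : inner (A x) y + inner (A y) x = 0.
  by have := A0 (x + y); rewrite opD !(innerDl, innerDr) !A0 addr0 add0r.
have h2 : inner (A x) y - inner (A y) x = 0.
  have := A0 (x + 'i%C *: y); rewrite opD opZ !(innerDl, innerDr, innerZl, innerZr) !A0.
  rewrite !mulr0 addr0 add0r => /(congr1 ( *%R 'i%C)).
  rewrite mulr0 mulrDr !mulrA -expr2 sqr_i.
  have -> : (('i%C)^*)%R = - 'i%C :> R[i] by apply/eqP; rewrite eq_complex /= oppr0 !eqxx.
  by rewrite mulrN -expr2 sqr_i opprK mul1r mulN1r.
have : inner (A x) y *+ 2 = 0.
  by rewrite mulr2n; move: h1; rewrite -(subr0_eq h2).
by move=> /eqP; rewrite mulrn_eq0 => /eqP.
Qed.

Lemma pos_adj A : pos A -> A^⋆ = A.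
Proof.
move=> p; apply/subr0_eq/quadratic_form_eq0 => x.
by rewrite opE innerDl opE innerNl -adjEr innerC pos_Re// conjR subrr.
Qed.

End operator_theory.
Notation "A ^⋆" := (adj A) (at level 2, format "A ^⋆") : ring_scope.

(* Pairing with a test vector turns an identity in the noncommutative ring of
   operators into one between complex numbers, which [ring] decides. *)
Ltac vec_ring := apply: inner_ext => ?;
  rewrite ?(opE, opD, opN, op_z, opZ, innerDr, innerNr, inner0r, innerZr, conjR);
  ring.
Ltac op_ring := apply: op_eq => ?; vec_ring.

Section positive.
Variables (R : realType) (H : hilbertType R).
Implicit Types (A B C : operator H) (x y z : H).

Lemma posD A B : pos A -> pos B -> pos (A + B).
Proof. by move=> a b x; rewrite opE innerDl addr_ge0. Qed.
Lemma pos_gram A : pos (A^⋆ * A).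
Proof. by move=> x; rewrite opE -adjEr innerxx ler0c sqr_ge0. Qed.
Lemma pos_gramr A : pos (A * A^⋆).
Proof. by move=> x; rewrite opE adjE innerxx ler0c sqr_ge0. Qed.
Lemma pos_conj A B : pos A -> pos (B^⋆ * A * B).
Proof. by move=> a x; rewrite !opE -adjEr. Qed.
Lemma posZ (r : R) A : 0 <= r -> pos A -> pos (r%:C *: A).
Proof. by move=> r0 a x; rewrite opE innerZl mulr_ge0 ?ler0c. Qed.

(** This is [A^2 <= m A]: evaluate the form of [A] at [x - m^-1 A x] and use the upper bound at
    [A x]. *)
Lemma pos_bound A (m : R) x : 0 < m -> pos A ->
  (forall x, complex.Re (inner (A x) x) <= m * nrm x ^+ 2) ->
  nrm (A x) ^+ 2 <= m * complex.Re (inner (A x) x).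
Proof.
move=> m0 pA hm; have sA := pos_adj pA.
have := pos_ge0 (x - (m^-1)%:C *: A x) pA.
rewrite opB opZ innerBl !innerBr !innerZr !innerZl !ReB !conjR !ReZ.
rewrite [inner (A (A x)) x]adjE sA -nrm2E => h.
have h2 := hm (A x).
have i0 : 0 < m^-1 by rewrite invr_gt0.
have : m^-1 * (m^-1 * complex.Re (inner (A (A x)) (A x))) <= m^-1 * nrm (A x) ^+ 2.
  by rewrite ler_pM2l// mulrC ler_pdivrMr// mulrC.
move=> h3; rewrite mulrC -ler_pdivrMr// mulrC; lra.
Qed.

Lemma pos_bnd A (m : R) : 0 < m -> pos A ->
  (forall x, complex.Re (inner (A x) x) <= m * nrm x ^+ 2) -> bnd A m.
Proof.
move=> m0 pA hm x; rewrite -ler_sqr ?nnegrE ?mulr_ge0 ?nrm_ge0 ?(ltW m0)//.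
rewrite (le_trans (pos_bound _ m0 pA hm))// exprMn expr2 -mulrA.
by rewrite ler_pM2l.
Qed.

Lemma bnd_inner A (m : R) x : bnd A m ->
  complex.Re (inner (A x) x) <= m * nrm x ^+ 2.
Proof.
move=> h; rewrite (le_trans (Re_inner_le _ _))// expr2 mulrA.
by rewrite ler_wpM2r ?nrm_ge0.
Qed.

Lemma pos_ker A x : pos A -> complex.Re (inner (A x) x) = 0 -> A x = 0.
Proof.
move=> pA h; have [m m0 hm] := op_bound A.
have := @pos_bound A m x m0 pA (fun y => @bnd_inner A m y hm).
rewrite h mulr0 => h2; apply/nrm_eq0/eqP.
by rewrite -sqrf_eq0 eq_le h2 sqr_ge0.
Qed.

Lemma inverse_unique A B B' : inverse A B -> inverse A B' -> B = B'.
Proof.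
by move=> [_ BA] [AB' _]; rewrite -[B]mulr1 -AB' mulrA BA mul1r.
Qed.

Lemma inverse_sym A B : inverse A B -> inverse B A.
Proof. by case. Qed.

Lemma inverse_adj A B : inverse A B -> inverse A^⋆ B^⋆.
Proof. by case=> AB BA; split; rewrite -adjM ?AB ?BA adj1. Qed.

Lemma inverseM A B A' B' : inverse A A' -> inverse B B' -> inverse (A * B) (B' * A').
Proof.
move=> [a1 a2] [b1 b2]; split.
  by rewrite mulrA -(mulrA A) b1 mulr1.
by rewrite mulrA -(mulrA B') a2 mulr1.
Qed.

Lemma inverse_comm A B C : inverse A B -> A * C = C * A -> B * C = C * B.
Proof.
move=> [AB BA] h.
by rewrite -[C in LHS]mulr1 -AB [C * (A * B)]mulrA -h !mulrA BA mul1r.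
Qed.

Lemma inverse_selfadj A B : inverse A B -> A^⋆ = A -> B^⋆ = B.
Proof. by move=> i sA; have := inverse_adj i; rewrite sA => /inverse_unique; apply. Qed.

Lemma inverse_pos A B : inverse A B -> pos A -> pos B.
Proof.
move=> i pA; have sB := inverse_selfadj i (pos_adj pA).
by have := pos_conj B pA; rewrite sB i.2 mul1r.
Qed.

Lemma pos_inverse A (c : R) : 0 < c -> pos A ->
  (forall x, c * nrm x ^+ 2 <= complex.Re (inner (A x) x)) ->
  exists B, inverse A B.
Proof.
move=> c0 pA hc; have h x : c * nrm x <= nrm (A x).
  have [->|n0] := eqVneq (nrm x) 0; first by rewrite mulr0 nrm_ge0.
  have n1 : 0 < nrm x by rewrite lt_def n0 nrm_ge0.
  by rewrite -(ler_pM2r n1) -mulrA -expr2 (le_trans (hc x))// Re_inner_le.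
apply: (bounded_below_inverse c0 h) => x; rewrite pos_adj// => Ax.
have := h x; rewrite Ax nrm0 pmulr_rle0// => n0.
by apply/nrm_eq0/eqP; rewrite eq_le n0 nrm_ge0.
Qed.

Lemma inverse_bounded_below A B : inverse A B ->
  exists2 c : R, 0 < c & forall x, c * nrm x <= nrm (A x).
Proof.
move=> [_ BA]; have [M M0 hM] := op_bound B; exists M^-1; first by rewrite invr_gt0.
move=> x; rewrite mulrC ler_pdivrMr// mulrC.
by rewrite (le_trans _ (hM _))// -mulE BA.
Qed.

Lemma bnd_small_eq0 A : (forall e : R, 0 < e -> bnd A e) -> A = 0.
Proof.
move=> h; apply: op_eq => x; rewrite opE; apply/nrm_eq0/eqP.
rewrite eq_le nrm_ge0 andbT; apply/ler_addgt0Pr => e e0; rewrite add0r.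
have n1 : 0 < nrm x + 1 by rewrite ltr_wpDl ?nrm_ge0.
have := h (e / (nrm x + 1)) ltac:(by rewrite divr_gt0) x.
move=> /le_trans; apply; rewrite -mulrA ler_piMr ?(ltW e0)//.
by rewrite mulrC ler_pdivrMr// mul1r lerDl.
Qed.

(** * Square roots of positive operators *)

Section sqrt_iteration.
Variables (Z : operator H) (Z1 : bnd Z 1) (sZ : Z^⋆ = Z).

(** Fixed-point iteration for [2 Y = Z + Y^2], that is, for [(1 - Y)^2 = 1 - Z]; it is applied to
    [Z = 1 - A / m], so that [1 - Y] is a root of [A / m]. *)
Fixpoint sqrt_iter n : operator H :=
  if n is m.+1 then (2^-1)%:C *: (Z + sqrt_iter m * sqrt_iter m) else 0.

(* The scalar iteration with [Z = 1] majorizes the increments. *)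
Fixpoint sqrt_maj n : R :=
  if n is m.+1 then (1 + sqrt_maj m ^+ 2) / 2 else 0.

Let maj_ge0 n : 0 <= sqrt_maj n.
Proof. by case: n => //= n; rewrite divr_ge0// addr_ge0// sqr_ge0. Qed.

Let maj_le1 n : sqrt_maj n <= 1.
Proof.
elim: n => //= n IH; rewrite ler_pdivrMr// mul1r.
by have := maj_ge0 n; nra.
Qed.

Let half_bnd A (M : R) : bnd A M -> bnd ((2^-1)%:C *: A) (M / 2).
Proof.
by move=> /(bndZ (2^-1)%:C); rewrite nrm_real gtr0_norm ?invr_gt0// mulrC.
Qed.

Let iter_bnd n : bnd (sqrt_iter n) (sqrt_maj n).
Proof.
elim: n => [|n IH] /=; first exact: bnd0.
apply: half_bnd; apply: bndD => //; rewrite expr2; exact: bndM.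
Qed.

Let iter_step n :
  bnd (sqrt_iter n.+1 - sqrt_iter n) (sqrt_maj n.+1 - sqrt_maj n).
Proof.
elim: n => [|n IH].
  by rewrite -[sqrt_iter 0]/0 -[sqrt_maj 0]/0 !subr0; exact: (iter_bnd 1).
rewrite -[sqrt_iter n.+2]/((2^-1)%:C *: (Z + sqrt_iter n.+1 * sqrt_iter n.+1)).
rewrite -[sqrt_maj n.+2]/((1 + sqrt_maj n.+1 ^+ 2) / 2).
rewrite [X in _ - X]/(sqrt_iter n.+1)/= -/(sqrt_iter n.+1) -/(sqrt_maj n.+1).
set Y' := sqrt_iter n.+1 in IH *; set Y := sqrt_iter n in IH *.
(* A difference of squares, factored without commuting [Y] and [Y']. The scalar majorant satisfies
   the same identity, so the bound reproduces itself exactly. *)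
have -> : (2^-1)%:C *: (Z + Y' * Y') - (2^-1)%:C *: (Z + Y * Y) =
  (2^-1)%:C *: (Y' * (Y' - Y) + (Y' - Y) * Y).
  rewrite -scalerBr mulrBr mulrBl addrA subrK opprD addrACA subrr add0r.
  by [].
have hY : bnd Y (sqrt_maj n) by exact: iter_bnd.
have hY' : bnd Y' (sqrt_maj n.+1) by exact: iter_bnd.
have d0 : 0 <= sqrt_maj n.+1 - sqrt_maj n.
  by rewrite /= subr_ge0; have := sqr_ge0 (sqrt_maj n - 1); lra.
have := half_bnd (bndD (bndM (maj_ge0 n.+1) hY' IH) (bndM d0 IH hY)).
apply: bndW; rewrite -[sqrt_maj n.+1]/((1 + sqrt_maj n ^+ 2) / 2).
by rewrite le_eqVlt; apply/orP; left; apply/eqP; field.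
Qed.

Let maj_mono n : sqrt_maj n <= sqrt_maj n.+1.
Proof. by rewrite /=; have := sqr_ge0 (sqrt_maj n - 1); lra. Qed.

Let iter_dist n k :
  bnd (sqrt_iter (n + k) - sqrt_iter n) (sqrt_maj (n + k) - sqrt_maj n).
Proof.
elim: k => [|k IH]; first by rewrite addn0 !subrr; exact: bnd0.
rewrite addnS -(subrKA (sqrt_iter (n + k))) -(subrKA (sqrt_maj (n + k))).
exact: bndD.
Qed.

Let maj_homo m n : (m <= n)%N -> sqrt_maj m <= sqrt_maj n.
Proof. exact: (homo_leq (@lexx _ _) (@le_trans _ _) maj_mono). Qed.

(** The increments are dominated by those of a nondecreasing real sequence bounded by [1]. *)
Let iter_cauchy (e : R) : 0 < e -> exists N, forall m n, (N <= m)%N -> (N <= n)%N ->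
  bnd (sqrt_iter m - sqrt_iter n) e.
Proof.
move=> e0; pose S := [set sqrt_maj n | n in [set: nat]].
have hS : has_sup S.
  by split; [exists (sqrt_maj 0), 0%N|exists 1 => _ [n _ <-]].
have [_ [N _ <-] hN] := sup_adherent e0 hS.
have ub n : sqrt_maj n <= sup S by apply: sup_upper_bound => //; exists n.
suff h m n : (N <= m)%N -> (m <= n)%N -> bnd (sqrt_iter n - sqrt_iter m) e.
  exists N => m n Nm Nn; have [mn|nm] := leqP m n.
    by rewrite -opprB; apply: bndN; exact: h.
  by apply: h => //; exact: ltnW.
move=> Nm mn; rewrite -(subnKC mn); apply: bndW (iter_dist _ _).
by rewrite subnKC//; have := ub n; have := maj_homo Nm; lra.
Qed.

Lemma sqrt_iter_lim : exists Y, [/\ Y + Y = Z + Y * Y, bnd Y 1, Y^⋆ = Y &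
  forall C, C * Z = Z * C -> C * Y = Y * C].
Proof.
have [Y hY] := op_lim iter_cauchy; exists Y.
have Y1 : bnd Y 1.
  move=> x; apply/ler_addgt0Pr => e e0.
  have n1 : 0 < nrm x + 1 by rewrite ltr_wpDl ?nrm_ge0.
  have [N hN] := hY (e / (nrm x + 1)) ltac:(by rewrite divr_gt0).
  rewrite -(subrK (sqrt_iter N x) (Y x)) addrC (le_trans (nrmD _ _))// lerD//.
    by rewrite (le_trans (iter_bnd N x))// ler_wpM2r ?nrm_ge0.
  rewrite nrmC (le_trans (hN N (leqnn _) x))// -mulrA ler_piMr ?(ltW e0)//.
  by rewrite mulrC ler_pdivrMr// mul1r lerDl.
have sI n : (sqrt_iter n)^⋆ = sqrt_iter n.
  by elim: n => [|n IH] /=; rewrite ?adj0// adjZ adjD adjM IH sZ.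
split => //.
- apply/subr0_eq/bnd_small_eq0 => e e0.
  (* The error below consists of four terms, each at most [e / 4]. *)
  have [N hN] := hY (e / 4) ltac:(by rewrite divr_gt0).
  have h1 := hN N.+1 (leqnSn _); have h0 := hN N (leqnn _).
  set U := sqrt_iter N.+1 in h1; set V := sqrt_iter N in h0.
  have UV : U + U = Z + V * V.
    have half2 : 2^-1 + 2^-1 = 1 :> R by field.
    by rewrite /U/= -scalerDl -rmorphD/= half2 scale1r.
  have -> : Y + Y - (Z + Y * Y) =
      - ((U - Y) + (U - Y)) + (V * (V - Y) + (V - Y) * Y).
    have -> : Z = U + U - V * V by rewrite UV addrK.
    by op_ring.
  have V1 : bnd V 1 by apply: bndW (iter_bnd _).
  have d0 : 0 <= e / 4 by rewrite divr_ge0// ltW.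
  apply: bndW (bndD (bndN (bndD h1 h1)) (bndD (bndM ler01 V1 h0) (bndM d0 h0 Y1))).
  by rewrite le_eqVlt; apply/orP; left; apply/eqP; field.
- apply/subr0_eq/bnd_small_eq0 => e e0.
  have [N hN] := hY (e / 2) ltac:(by rewrite divr_gt0).
  have h0 := hN N (leqnn _).
  have -> : Y^⋆ - Y = (sqrt_iter N - Y) - (sqrt_iter N - Y)^⋆.
    by rewrite adjB sI; op_ring.
  rewrite (splitr e); apply: bndB => //; apply: bnd_adj => //.
  by rewrite divr_ge0// ltW.
- move=> C CZ; apply/subr0_eq/bnd_small_eq0 => e e0.
  have [M M0 hM] := op_bound C.
  have k0 : 0 < e / (2 * M) by rewrite divr_gt0// mulr_gt0.
  have [N hN] := hY _ k0.
  have h0 := hN N (leqnn _).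
  have CI n : C * sqrt_iter n = sqrt_iter n * C.
    elim: n => [|n IH] /=; first by rewrite mulr0 mul0r.
    by rewrite opZr opZl mulrDr mulrDl CZ mulrA IH -mulrA IH mulrA.
  have -> : C * Y - Y * C = (sqrt_iter N - Y) * C - C * (sqrt_iter N - Y).
    by rewrite mulrBl mulrBr CI; op_ring.
  apply: bndW (bndB (bndM (ltW k0) h0 hM) (bndM (ltW M0) hM h0)).
  by rewrite le_eqVlt; apply/orP; left; apply/eqP; field; rewrite gt_eqF.
Qed.

End sqrt_iteration.

(** The commutation clause yields uniqueness of the root, and later lets the root of [C] commute
    with [E] and with [f^⋆ f]. *)
Lemma sqrt_exists A : pos A -> exists W, [/\ pos W, W * W = A &
  forall C, C * A = A * C -> C * W = W * C].
Proof.
move=> pA; have [m m0 hm] := op_bound A.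
pose Z := 1 - (m^-1)%:C *: A.
have sA := pos_adj pA.
have sZ : Z^⋆ = Z by rewrite /Z adjB adj1 adjZ sA.
have ReZx x : complex.Re (inner (Z x) x) = nrm x ^+ 2 - m^-1 * complex.Re (inner (A x) x).
  by rewrite !opE innerBl innerZl ReB ReZ -nrm2E.
have pZ : pos Z.
  apply: posP sZ _ => x; rewrite ReZx subr_ge0 mulrC ler_pdivrMr// mulrC.
  exact: bnd_inner.
have Z1 : bnd Z 1.
  apply: pos_bnd => // x; rewrite ReZx mul1r gerBl mulr_ge0 ?invr_ge0 ?(ltW m0)//.
  exact: pos_ge0.
have [Y [YY Y1 sY cY]] := sqrt_iter_lim Z1 sZ.
have mE : (Num.sqrt m)%:C * (Num.sqrt m)%:C = m%:C :> R[i].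
  by rewrite -rmorphM /= -expr2 sqr_sqrtr// ltW.
exists ((Num.sqrt m)%:C *: (1 - Y)); split.
- apply: posZ (sqrtr_ge0 _) _; apply: posP; first by rewrite adjB adj1 sY.
  move=> x; rewrite !opE innerBl ReB -nrm2E subr_ge0.
  by have := bnd_inner x Y1; rewrite mul1r.
- rewrite opZl opZr scalerA mE.
  have -> : (1 - Y) * (1 - Y) = 1 - (Y + Y) + Y * Y by op_ring.
  have -> : 1 - (Y + Y) + Y * Y = (m^-1)%:C *: A by rewrite YY /Z; op_ring.
  by rewrite scalerA -rmorphM/= mulfV ?gt_eqF// scale1r.
- move=> C CA; rewrite opZr opZl mulrBr mulrBl mulr1 mul1r cY//.
  by rewrite /Z mulrBr mulrBl mulr1 mul1r opZr opZl CA.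
Qed.

(** For [z = (B - C) x], commutation gives [(B + C) z = 0]. Both forms being nonnegative,
    [B z = C z = 0], hence [inner z z = inner x ((B - C) z) = 0]. *)
Let sqrt_unique_comm B C :
  pos B -> pos C -> B * C = C * B -> B * B = C * C -> B = C.
Proof.
move=> pB pC cBC BC; apply/subr0_eq/op_eq => x; rewrite zeroE.
pose D := B - C; pose z := D x.
have Dz : inner (B z) z + inner (C z) z = 0.
  rewrite -innerDl -addE -mulE mulrDl !mulrBr BC cBC addrA subrK subrr.
  by rewrite opE inner0l.
have Bz := pos_ge0 z pB; have Cz := pos_ge0 z pC.
have {}Dz : complex.Re (inner (B z) z) + complex.Re (inner (C z) z) = 0.
  by rewrite -ReD Dz.
have B0 : B z = 0 by apply: pos_ker pB _; lra.
have C0 : C z = 0 by apply: pos_ker pC _; lra.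
have sD : D^⋆ = D by rewrite adjB !pos_adj.
by apply: innerxx_eq0; rewrite -/D adjE sD -/z subE B0 C0 subrr inner0r.
Qed.

(** [B] and [C] commute with their common square, hence with the root [W] of it, and each equals [W]
    by the commuting case. *)
Lemma sqrt_unique B C : pos B -> pos C -> B * B = C * C -> B = C.
Proof.
move=> pB pC BC; have pA : pos (B * B) by rewrite -{1}(pos_adj pB); exact: pos_gram.
have [W [pW WW cW]] := sqrt_exists pA.
rewrite (sqrt_unique_comm pB pW); last 2 first.
- by rewrite cW// mulrA.
- by rewrite WW.
apply/esym/sqrt_unique_comm => //; last by rewrite WW.
by rewrite cW// BC mulrA.
Qed.

End positive.

(** * Compactness and the Fredholm alternative *)

Section families.
Variables (R : realType) (H : hilbertType R).
Implicit Types (A B C : operator H) (x y z : H) (V : set H) (s : seq H).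

Fact rank1_bounded a b : bounded_op (fun x : H => inner x a *: b).
Proof.
apply: (@bounded_opP _ _ _ (nrm a * nrm b)) => [k x y|x].
  by rewrite innerDl innerZl scalerDl scalerA.
by rewrite nrmZ mulrAC ler_wpM2r ?nrm_ge0// mulrC cauchy_schwarz.
Qed.
Definition rank1 a b : operator H := Operator (rank1_bounded a b).

Lemma rank1E a b x : rank1 a b x = inner x a *: b. Proof. by []. Qed.

Lemma adj_rank1 a b : (rank1 a b)^⋆ = rank1 b a.
Proof.
by apply: adj_unique => x y; rewrite !rank1E innerZl innerZr -innerC mulrC.
Qed.

Lemma mul_rank1 A a b : A * rank1 a b = rank1 a (A b).
Proof. by apply: op_eq => x; rewrite mulE !rank1E opZ. Qed.

Lemma rank1_mul A a b : rank1 a b * A = rank1 (A^⋆ a) b.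
Proof. by apply: op_eq => x; rewrite mulE !rank1E adjE. Qed.

Definition onfam n (a : 'I_n -> H) := forall i j, inner (a i) (a j) = (i == j)%:R.

Definition onb_of V n (a : 'I_n -> H) :=
  [/\ onfam a, forall i, V (a i) & forall x, V x -> x = \sum_i inner x (a i) *: a i].

Lemma onfam_comb n (a : 'I_n -> H) (c : 'I_n -> R[i]) j : onfam a ->
  inner (\sum_i c i *: a i) (a j) = c j.
Proof.
move=> oa; rewrite inner_suml (bigD1 j)//= innerZl oa eqxx mulr1.
by rewrite big1 ?addr0// => i ij; rewrite innerZl oa (negbTE ij) mulr0.
Qed.

Lemma onfam_nrm2 n (a : 'I_n -> H) (c : 'I_n -> R[i]) : onfam a ->
  nrm (\sum_i c i *: a i) ^+ 2 = \sum_i nrm (c i) ^+ 2.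
Proof.
move=> oa; rewrite nrm2E inner_sumr Re_sum; apply: eq_bigr => j _.
by rewrite innerZr onfam_comb// mulrC nrmJ.
Qed.

Definition famproj n (a : 'I_n -> H) : operator H := \sum_i rank1 (a i) (a i).

Lemma famprojE n (a : 'I_n -> H) x : famproj a x = \sum_i inner x (a i) *: a i.
Proof. by rewrite sumE; apply: eq_bigr => i _; rewrite rank1E. Qed.

Lemma famproj_orth n (a : 'I_n -> H) x j : onfam a ->
  inner (x - famproj a x) (a j) = 0.
Proof. by move=> oa; rewrite famprojE innerBl onfam_comb// subrr. Qed.

Lemma famproj_nrm2 n (a : 'I_n -> H) x : onfam a ->
  nrm x ^+ 2 = \sum_i nrm (inner x (a i)) ^+ 2 + nrm (x - famproj a x) ^+ 2.
Proof.
move=> oa; rewrite -(onfam_nrm2 (fun i => inner x (a i)) oa) -famprojE -pythagoras.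
  by rewrite addrC subrK.
rewrite {1}famprojE inner_suml big1// => i _; rewrite innerZl.
by rewrite (inner_eq0C (famproj_orth x i oa)) mulr0.
Qed.

Lemma bessel_fam n (a : 'I_n -> H) x : onfam a ->
  \sum_i nrm (inner x (a i)) ^+ 2 <= nrm x ^+ 2.
Proof. by move=> oa; rewrite (famproj_nrm2 x oa) lerDl sqr_ge0. Qed.

Lemma famprojC_le n (a : 'I_n -> H) x : onfam a ->
  nrm (x - famproj a x) <= nrm x.
Proof.
move=> oa; rewrite -ler_sqr ?nnegrE ?nrm_ge0// [leRHS](famproj_nrm2 x oa).
by rewrite lerDr sumr_ge0// => i _; exact: sqr_ge0.
Qed.

Lemma exists_orthogonal_comb m n (x : 'I_m -> H) (b : 'I_n -> H) : (n < m)%N ->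
  exists2 c : 'rV[R[i]]_m, c != 0 &
    forall j, inner (\sum_i c 0 i *: x i) (b j) = 0.
Proof.
move=> nm; pose M := \matrix_(i < m, j < n) inner (x i) (b j).
have : kermx M != 0.
  rewrite -mxrank_eq0 mxrank_ker subn_eq0 -ltnNge.
  exact: leq_ltn_trans (rank_leq_col _) nm.
move=> /rowV0Pn[c /sub_kermxP cM c0]; exists c => // j.
have := congr1 (fun A : 'rV_n => A 0 j) cM; rewrite !mxE => <-.
by rewrite inner_suml; apply: eq_bigr => i _; rewrite innerZl !mxE.
Qed.

(** Take an orthonormal family in [V] of maximal length. Lengths are at most [n], as a longer family
    has a nonzero combination orthogonal to all [s i]; a vector outside the span would extend the
    family by its normalized residual. *)
Lemma subspace_finite_onb V n (s : 'I_n -> H) : closed_subspace V ->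
  (forall v, V v -> (forall i, inner v (s i) = 0) -> v = 0) ->
  exists k (a : 'I_k -> H), onb_of V a.
Proof.
move=> hV hs.
pose P k := `[< exists a : 'I_k -> H, onfam a /\ forall i, V (a i) >].
have P0 : exists k, P k.
  by exists 0%N; apply/asboolP; exists (fun=> 0); split; case.
have Pn k : P k -> (k <= n)%N.
  move=> /asboolP[a [oa Va]]; rewrite leqNgt; apply/negP => nk.
  have [c c0 hc] := exists_orthogonal_comb a s nk.
  have := hs _ (csub_sum hV _ _ (fun i => csubZ hV (c 0 i) (Va i))) hc.
  move=> h; move/eqP: c0; apply; apply/rowP => i.
  by rewrite -(onfam_comb (fun i => c 0 i) i oa) h inner0l mxE.
have [k /asboolP[a [oa Va]] kmax] := ex_maxnP P0 Pn.
exists k, a; split => // x Vx; apply/subr0_eq.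
set r := _ - _; have rE : r = x - famproj a x by rewrite famprojE.
apply/eqP/negPn/negP => r0.
have ra j : inner r (a j) = 0 by rewrite rE famproj_orth.
have Vr : V r.
  by apply: csubB => //; apply: csub_sum => // i; exact: csubZ.
have nr : nrm r != 0 by apply: contra_neq r0 => /nrm_eq0.
pose r' := ((nrm r)^-1)%:C *: r.
have r'r' : inner r' r' = 1.
  rewrite innerxx nrmZ nrm_real ger0_norm ?invr_ge0 ?nrm_ge0//.
  by rewrite mulVf// expr1n.
have r'a j : inner r' (a j) = 0 by rewrite innerZl ra mulr0.
have /kmax : P k.+1.
  apply/asboolP; exists (fun i => if unlift ord_max i is Some j then a j else r').
  split; last by move=> i; case: unliftP => [j|] _ //; exact: csubZ.
  move=> i j; case: (unliftP ord_max i) => [i'|] ->; case: (unliftP ord_max j) => [j'|] ->.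
  - by rewrite oa (inj_eq (@lift_inj _ _)).
  - by rewrite inner_eq0C// eq_sym (negbTE (neq_lift _ _)).
  - by rewrite r'a (negbTE (neq_lift _ _)).
  - by rewrite r'r' eqxx.
by rewrite ltnn.
Qed.

Lemma subspace_finite_onb_seq V s : closed_subspace V ->
  (forall v, V v -> {in s, forall a, inner v a = 0} -> v = 0) ->
  exists k (a : 'I_k -> H), onb_of V a.
Proof.
move=> hV hs; apply: (@subspace_finite_onb V (size s) (fun i => nth 0 s i)) => //.
move=> v Vv h; apply: hs => // a /(nthP 0)[i si <-].
exact: (h (Ordinal si)).
Qed.

Lemma subspace_infinite_seq V : closed_subspace V ->
  (forall s, exists v, [/\ V v, v != 0 & {in s, forall a, inner v a = 0}]) ->
  exists u : nat -> H, (forall n, V (u n)) /\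
    forall m n, inner (u m) (u n) = (m == n)%:R.
Proof.
move=> hV h.
have /choice[f hf] : forall s, exists v,
    [/\ V v, inner v v = 1 & {in s, forall a, inner v a = 0}].
  move=> s; have [v [Vv v0 vs]] := h s; exists (((nrm v)^-1)%:C *: v); split.
  - exact: csubZ.
  - rewrite innerxx nrmZ nrm_real ger0_norm ?invr_ge0 ?nrm_ge0//.
    rewrite mulVf ?expr1n//; by apply: contra_neq v0 => /nrm_eq0.
  - by move=> a /vs va; rewrite innerZl va mulr0.
(* [S n] lists the vectors chosen before step [n], so each choice is orthogonal to all earlier
   ones. *)
pose S := fix S n := if n is m.+1 then f (S m) :: S m else [::].
pose u n := f (S n); exists u; split; first by move=> n; case: (hf (S n)).
have uS m n : (m < n)%N -> u m \in S n.
  elim: n => // n IH; rewrite ltnS leq_eqVlt => /orP[/eqP->|/IH] /=.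
    by rewrite in_cons eqxx.
  by rewrite in_cons orbC => ->.
have lt m n : (m < n)%N -> inner (u n) (u m) = 0.
  by move=> /uS; case: (hf (S n)) => _ _; apply.
move=> m n; case: ltngtP => [mn|mn|->]; last by case: (hf (S n)).
  exact/inner_eq0C/lt.
exact: lt.
Qed.

Lemma onb_has_dim V n (a : 'I_n -> H) : onb_of V a -> has_dim V n.
Proof.
move=> [oa Va ha]; exists a; split => // x Vx.
exists (\row_i inner x (a i)); split.
  by rewrite [LHS]ha//; apply: eq_bigr => i _; rewrite mxE.
move=> c ->; apply/rowP => i; rewrite mxE.
exact: (onfam_comb (fun i => c 0 i)).
Qed.

Lemma has_dim_unique V m n : has_dim V m -> has_dim V n -> m = n.
Proof.
suff le m' n' : has_dim V m' -> has_dim V n' -> (m' <= n')%N.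
  by move=> h1 h2; apply/eqP; rewrite eqn_leq !le//.
move=> {m n} [b [Vb hb]] [b' [Vb' hb']].
have /choice[M hM] : forall i, exists c : 'rV[R[i]]_n', b i = \sum_j c 0 j *: b' j.
  by move=> i; have [c [hc _]] := hb' _ (Vb i); exists c.
have /choice[N hN] : forall j, exists c : 'rV[R[i]]_m', b' j = \sum_i c 0 i *: b i.
  by move=> j; have [c [hc _]] := hb _ (Vb' j); exists c.
pose M' := \matrix_(i < m', j < n') M i 0 j.
pose N' := \matrix_(j < n', i < m') N j 0 i.
(* The two changes of basis compose to the identity by uniqueness of coefficients, and the rank of
   the product is at most [n']. *)
suff MN : M' *m N' = 1%:M.
  by rewrite -(mxrank1 R[i] m') -MN (leq_trans (mxrankM_maxl _ _))// rank_leq_col.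
apply/row_matrixP => i; have [c [_ uc]] := hb _ (Vb i).
rewrite -(uc (row i (M' *m N'))); last first.
  rewrite [LHS]hM.
  under eq_bigr do rewrite hN scaler_sumr.
  rewrite exchange_big/=; apply: eq_bigr => k _; rewrite !mxE scaler_suml.
  by apply: eq_bigr => j _; rewrite !mxE scalerA.
apply: uc; rewrite (bigD1 i)//= !mxE eqxx scale1r big1 ?addr0// => k ki.
by rewrite !mxE eq_sym (negbTE ki) scale0r.
Qed.

Lemma dimE V n : has_dim V n -> dim V = n.
Proof.
move=> h; have hd : has_dim V (dim V).
  by apply: (@getPex _ [set n | has_dim V n]); exists n.
exact: has_dim_unique hd h.
Qed.

End families.

Section compactness.
Variables (R : realType) (H : hilbertType R).
Implicit Types (A B C K : operator H) (x y z : H) (V : set H) (s : seq H).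

Definition small_off A (d : R) := exists s,
  forall x, {in s, forall a, inner x a = 0} -> nrm (A x) <= d * nrm x.

(* Compactness, as smallness off a finite-dimensional subspace. *)
Definition cpt A := forall e : R, 0 < e -> small_off A e.

Lemma small_offD A B (d e : R) : small_off A d -> small_off B e -> small_off (A + B) (d + e).
Proof.
move=> [s hs] [t ht]; exists (s ++ t) => x hx.
rewrite opE mulrDl (le_trans (nrmD _ _))// lerD//.
  by apply: hs => a sa; rewrite hx// mem_cat sa.
by apply: ht => a sa; rewrite hx// mem_cat sa orbT.
Qed.

Lemma small_offMl A C (M d : R) : 0 <= M -> bnd C M -> small_off A d -> small_off (C * A) (M * d).
Proof.
move=> M0 hM [s hs]; exists s => x /hs hx.
by rewrite opE (le_trans (hM _))// -mulrA ler_wpM2l.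
Qed.

Lemma small_offMr A C (M d : R) : 0 <= d -> bnd C M -> small_off A d -> small_off (A * C) (d * M).
Proof.
move=> d0 hM [s hs]; exists (map C^⋆ s) => x hx.
rewrite opE (le_trans (hs _ _)) => [//|a sa|].
  by rewrite adjE hx// map_f.
by rewrite -mulrA ler_wpM2l.
Qed.

Lemma cptD A B : cpt A -> cpt B -> cpt (A + B).
Proof.
move=> hA hB e e0; rewrite (splitr e).
by apply: small_offD; [apply: hA|apply: hB]; rewrite divr_gt0.
Qed.

Lemma cptMl A C : cpt A -> cpt (C * A).
Proof.
move=> hA e e0; have [M M0 hM] := op_bound C.
have := small_offMl (ltW M0) hM (hA (e / M) ltac:(by rewrite divr_gt0)).
by rewrite mulrC divfK// gt_eqF.
Qed.

Lemma cptMr A C : cpt A -> cpt (A * C).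
Proof.
move=> hA e e0; have [M M0 hM] := op_bound C.
have k0 : 0 < e / M by rewrite divr_gt0.
by have := small_offMr (ltW k0) hM (hA _ k0); rewrite divfK// gt_eqF.
Qed.

Lemma cptN A : cpt A -> cpt (- A).
Proof. by move=> /(cptMl (-1)); rewrite mulN1r. Qed.

Lemma cptZ (k : R[i]) A : cpt A -> cpt (k *: A).
Proof. by move=> /(cptMl (k *: (1 : operator H))); rewrite opZl mul1r. Qed.

Lemma cpt_sum I (r : seq I) (P : pred I) (F : I -> operator H) :
  (forall i, cpt (F i)) -> cpt (\sum_(i <- r | P i) F i).
Proof.
move=> h; elim/big_ind : _ => // [e e0|]; last exact: cptD.
by exists [::] => x _; rewrite opE nrm0 mulr_ge0 ?nrm_ge0 ?ltW.
Qed.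

Lemma cpt_rank1 a b : cpt (rank1 a b).
Proof.
move=> e e0; exists [:: a] => x /(_ a (mem_head _ _)) xa.
by rewrite rank1E xa scale0r nrm0 mulr_ge0 ?nrm_ge0 ?ltW.
Qed.

Lemma small_off_onfam A (d : R) : small_off A d -> exists k (a : 'I_k -> H),
  onfam a /\ forall x, (forall i, inner x (a i) = 0) -> nrm (A x) <= d * nrm x.
Proof.
move=> [s hs].
(* [V] is the double orthogonal complement of [s], hence its span; an orthonormal basis of it can
   replace the list. *)
pose V := [set x | forall y, {in s, forall a, inner y a = 0} -> inner x y = 0].
have cV : closed_subspace V.
  split; first by move=> y _; rewrite inner0l.
    by move=> a x y Vx Vy z sz; rewrite innerDl innerZl Vx// Vy// mulr0 addr0.
  apply: closedP => x hx y sy.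
  have : x \in nullspace (rank1 y y).
    rewrite inE; apply: closed_approx (csub_closed (nullspace_closed _)) _.
    move=> e /hx[v Vv xv]; exists v => //.
    by rewrite /nullspace/= Vv// scale0r.
  rewrite inE /nullspace/= => /(congr1 (fun v => inner v y)).
  rewrite innerZl inner0l => /eqP; rewrite mulf_eq0 => /orP[/eqP//|/eqP].
  by move=> /innerxx_eq0 ->; rewrite inner0r.
have sV a : a \in s -> V a by move=> sa y /(_ a sa) /inner_eq0C.
have [|k [a [oa Va ha]]] := subspace_finite_onb_seq (s := s) cV.
  by move=> v Vv /Vv /innerxx_eq0.
exists k, a; split => // x xa; apply: hs => b /sV /ha ->.
by rewrite inner_sumr big1// => i _; rewrite innerZr xa mulr0.
Qed.

Lemma cpt_finite_rank A (e : R) : cpt A -> 0 < e -> exists k (a b : 'I_k -> H),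
  bnd (A - \sum_i rank1 (a i) (b i)) e.
Proof.
move=> hA e0; have [k [a [oa ha]]] := small_off_onfam (hA e e0).
exists k, a, (fun i => A (a i)) => x.
have -> : (A - \sum_i rank1 (a i) (A (a i))) x = A (x - famproj a x).
  rewrite subE sumE opB famprojE op_sum; congr (_ - _).
  by apply: eq_bigr => i _; rewrite opZ.
rewrite (le_trans (ha _ _))// => [i|]; first exact: famproj_orth.
by rewrite ler_pM2l// famprojC_le.
Qed.

(** The adjoint of a finite-rank approximation with range spanned by the [b i] vanishes on their
    orthogonal complement. *)
Lemma cpt_adj A : cpt A -> cpt A^⋆.
Proof.
move=> hA e e0; have [k [a [b hab]]] := cpt_finite_rank hA e0.
have {}hab := bnd_adj (ltW e0) hab.
exists [seq b i | i <- enum 'I_k] => x hx.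
have xb i : inner x (b i) = 0 by rewrite hx// map_f// mem_enum.
have := hab x; rewrite adjB subE adj_sum sumE big1 ?subr0// => i _.
by rewrite adj_rank1 rank1E xb scale0r.
Qed.

(** On combinations of the [b i] the operator [M] acts on coefficients through the matrix [1 + G].
    Injectivity of [M] makes that matrix invertible, and the inverse of [M] is then given by the
    Woodbury formula. *)
Lemma finite_rank_perturbation n (a b : 'I_n -> H) :
  let M := 1 + \sum_i rank1 (a i) (b i) in
  (forall x, M x = 0 -> x = 0) -> exists B, inverse M B.
Proof.
move=> M inj.
have ME x : M x = x + \sum_i inner x (a i) *: b i.
  by rewrite addE sumE.
pose G := \matrix_(i < n, j < n) inner (b i) (a j).
have uG : 1%:M + G \in unitmx.
  rewrite -row_free_unit -kermx_eq0; apply/negPn/negP => /rowV0Pn[c /sub_kermxP cG c0].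
  have {}cG i : c 0 i = - inner (\sum_j c 0 j *: b j) (a i).
    apply/eqP; rewrite -addr_eq0; apply/eqP.
    have := congr1 (fun A : 'rV_n => A 0 i) cG.
    rewrite mulmxDr mulmx1 !mxE => <-; congr (_ + _).
    by rewrite inner_suml; apply: eq_bigr => j _; rewrite innerZl !mxE.
  have h : M (\sum_j c 0 j *: b j) = 0.
    rewrite ME -big_split/= big1// => i _.
    by rewrite {1}cG scaleNr addNr.
  (* The [b i] may be dependent, so that a vanishing combination says nothing directly about [c];
     the relation [cG] recovers [c] from the vector. *)
  move/eqP: c0; apply; apply/rowP => i.
  by rewrite cG (inj _ h) inner0l oppr0 mxE.
pose N := invmx (1%:M + G).
pose B : operator H := 1 - \sum_i \sum_j N j i *: rank1 (a j) (b i).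
pose c y := (\row_j inner y (a j)) *m N.
have BE y : B y = y - \sum_i c y 0 i *: b i.
  rewrite subE sumE; congr (_ - _); apply: eq_bigr => i _.
  rewrite sumE mxE scaler_suml; apply: eq_bigr => j _.
  by rewrite scaleE rank1E scalerA mxE mulrC.
have cG y i : c y 0 i + inner (\sum_j c y 0 j *: b j) (a i) = inner y (a i).
  have := congr1 (fun A : 'rV_n => A 0 i) (mulmxKV uG (\row_j inner y (a j))).
  rewrite -/N -/(c y) mulmxDr mulmx1 !mxE => <-; congr (_ + _).
  by rewrite inner_suml; apply: eq_bigr => j _; rewrite innerZl !mxE.
have MB : M * B = 1.
  apply: op_eq => y; rewrite mulE ME BE oneE -addrA -[RHS]addr0; congr (_ + _).
  rewrite addrC -sumrB big1// => i _.
  by rewrite innerBl -(cG y i) addrK subrr.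
exists B; split => //; apply/subr0_eq/op_eq => x; rewrite zeroE; apply: inj.
by rewrite -mulE mulrBr mulrA MB mul1r mulr1 subrr.
Qed.

(** Both [1 + K] and its adjoint are bounded below by [2^-1]. *)
Lemma small_perturbation K : bnd K 2^-1 -> exists B, inverse (1 + K) B.
Proof.
move=> hK; have bel L : bnd L 2^-1 -> forall x, 2^-1 * nrm x <= nrm ((1 + L) x).
  move=> hL x; have : nrm x <= nrm ((1 + L) x) + nrm (L x).
    by rewrite -{1}(addrK (L x) x) nrmB.
  by have := hL x; lra.
apply: (bounded_below_inverse _ (bel K hK)) => // x.
rewrite adjD adj1 => h; have := bel _ (bnd_adj _ hK) x.
rewrite h nrm0 pmulr_rle0// => /(_ ltac:(by [])) n0.
by apply/nrm_eq0/eqP; rewrite eq_le n0 nrm_ge0.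
Qed.

(** With [L] the small remainder of a finite-rank approximation, [1 + L] is invertible and factors
    out of [1 + K]; the other factor is a finite-rank perturbation of the identity. *)
Lemma compact_perturbation K : cpt K -> (forall x, (1 + K) x = 0 -> x = 0) ->
  exists B, inverse (1 + K) B.
Proof.
move=> cK inj; have [k [a [b hab]]] := cpt_finite_rank cK (ltac:(by []) : 0 < 2^-1 :> R).
set L := K - _ in hab; have [C [LC CL]] := small_perturbation hab.
have KE : 1 + K = (1 + L) * (1 + \sum_i rank1 (a i) (C (b i))).
  have -> : \sum_i rank1 (a i) (C (b i)) = C * \sum_i rank1 (a i) (b i).
    by rewrite mulr_sumr; apply: eq_bigr => i _; rewrite mul_rank1.
  by rewrite mulrDr mulr1 mulrA LC mul1r /L addrA subrK.
have [|B iB] := @finite_rank_perturbation k a (fun i => C (b i)).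
  by move=> x hx; apply: inj; rewrite KE mulE hx op_z.
by exists (B * C); rewrite KE; exact: inverseM.
Qed.

Lemma nullspace_finite K : cpt K ->
  exists k (a : 'I_k -> H), onb_of (nullspace (1 + K)) a.
Proof.
move=> cK; have [s hs] := cK 2^-1 ltac:(by []).
apply: (subspace_finite_onb_seq (s := s) (nullspace_closed _)) => v /= Mv /hs.
have -> : K v = - v by apply/eqP; rewrite -addr_eq0 addrC; apply/eqP.
rewrite nrmN => h; apply/nrm_eq0; have := nrm_ge0 v; lra.
Qed.

(** [F] maps the kernel injectively into the cokernel, so [1 + K + F] is injective and hence
    invertible. If [p < q], the vector [b] of index [p] would be orthogonal to the range of both
    [1 + K] and [F], against surjectivity. *)
Let fredholm_half K p q (a : 'I_p -> H) (b : 'I_q -> H) (pq : (p <= q)%N) :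
  cpt K -> onb_of (nullspace (1 + K)) a -> onb_of (nullspace (1 + K)^⋆) b ->
  (exists B, inverse (1 + K + \sum_i rank1 (a i) (b (widen_ord pq i))) B) /\
  (q <= p)%N.
Proof.
move=> cK [oa Na ha] [ob Nb hb].
set F := \sum_i _.
have Mb x i : inner ((1 + K) x) (b i) = 0 by rewrite adjE (Nb i) inner0r.
have owid : onfam (fun i => b (widen_ord pq i)) by move=> i j; rewrite ob.
have FE x : F x = \sum_i inner x (a i) *: b (widen_ord pq i) by rewrite sumE.
have [||B [VB BV]] := @compact_perturbation (K + F).
- by apply: cptD => //; apply: cpt_sum => i; exact: cpt_rank1.
- move=> x; rewrite addrA addE => h.
  have xa i : inner x (a i) = 0.
    rewrite -(onfam_comb (fun i => inner x (a i)) i owid) -FE.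
    by rewrite -[F x](addKr ((1 + K) x)) h addr0 innerNl Mb oppr0.
  have Mx : (1 + K) x = 0.
    by move: h; rewrite FE big1 ?addr0// => i _; rewrite xa scale0r.
  by rewrite (ha x Mx) big1// => i _; rewrite xa scale0r.
split; first by exists B; rewrite -addrA; split.
rewrite leqNgt; apply/negP => pq'.
have : inner ((1 + (K + F)) (B (b (Ordinal pq')))) (b (Ordinal pq')) = 1.
  by rewrite -mulE VB oneE ob eqxx.
rewrite addrA addE innerDl Mb add0r FE inner_suml big1 => [|i _].
  by move=> /eqP; rewrite eq_sym oner_eq0.
rewrite innerZl ob [_ == _](_ : _ = false) ?mulr0//.
by apply/negbTE; rewrite -val_eqE /= ltn_eqF.
Qed.

(** The previous lemma for [K] and for [K^⋆] gives the two inequalities between the dimensions. If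
    [y] is orthogonal to all [b i], the correction term vanishes at [B y], which therefore solves
    the equation. *)
Lemma fredholm_alternative K : cpt K -> exists n (a b : 'I_n -> H),
  [/\ onb_of (nullspace (1 + K)) a, onb_of (nullspace (1 + K)^⋆) b,
      (forall y, (forall i, inner y (b i) = 0) -> exists x, (1 + K) x = y) &
      exists B, inverse (1 + K + \sum_i rank1 (a i) (b i)) B].
Proof.
move=> cK; have [p [a ha]] := nullspace_finite cK.
have cK' := cpt_adj cK; have [q [b hb']] := nullspace_finite cK'.
have hb : onb_of (nullspace (1 + K)^⋆) b by rewrite adjD adj1.
have pq : p = q.
  apply/eqP; rewrite eqn_leq; have [h|h] := leqP p q.
    by have [_ ->] := fredholm_half h cK ha hb.
  have ha' : onb_of (nullspace (1 + K^⋆)^⋆) a by rewrite adjD adj1 adjK.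
  by have [_ hle] := fredholm_half (ltnW h) cK' hb' ha'; rewrite leqNgt h in hle.
subst q; have [[B iB] _] := fredholm_half (leqnn p) cK ha hb.
have {}iB : inverse (1 + K + \sum_i rank1 (a i) (b i)) B.
  suff <- : \sum_i rank1 (a i) (b (widen_ord (leqnn p) i)) = \sum_i rank1 (a i) (b i) by [].
  by apply: eq_bigr => i _; congr (rank1 _ (b _)); exact/val_inj.
exists p, a, b; split => //; last by exists B.
move=> y yb; exists (B y).
case: (ha) (hb) => oa Na ca [ob Nb cb].
have := congr1 (fun A : operator H => A y) iB.1; rewrite mulE oneE addE sumE => h.
have Bya i : inner (B y) (a i) = 0.
  rewrite -(onfam_comb (fun i => inner (B y) (a i)) i ob) -(yb i) -[in RHS]h innerDl.
  by rewrite adjE (Nb i) inner0r add0r.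
by rewrite -[RHS]h big1 ?addr0// => i _; rewrite rank1E Bya scale0r.
Qed.

End compactness.

(** * Synthesis operators and operator ideals *)

Section orthonormal_sequence.
Variables (R : realType) (H : hilbertType R) (u : nat -> H).
Hypothesis ou : forall m n, inner (u m) (u n) = (m == n)%:R.

Lemma onseq_fam n : onfam (fun i : 'I_n => u i).
Proof. by move=> i j; rewrite ou. Qed.

Lemma bessel_seq x n : \sum_(k < n) nrm (inner x (u k)) ^+ 2 <= nrm x ^+ 2.
Proof. exact: (bessel_fam x (onseq_fam (n := n))). Qed.

Lemma onseq_block_nrm2 (c : nat -> R[i]) m n :
  nrm (\sum_(m <= k < n) c k *: u k) ^+ 2 = \sum_(m <= k < n) nrm (c k) ^+ 2.
Proof.
rewrite -{1 2}(add0n m) !big_addn !big_mkord.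
apply: (onfam_nrm2 (a := fun i : 'I_(n - m) => u (i + m)%N) (fun i => c (i + m)%N)).
by move=> i j; rewrite ou eqn_add2r.
Qed.

(** The partial sums of the squared coefficients are nondecreasing and bounded, which makes the
    vector sums Cauchy. *)
Lemma riesz_fischer (c : nat -> R[i]) (B : R) : 0 <= B ->
  (forall n, \sum_(k < n) nrm (c k) ^+ 2 <= B ^+ 2) ->
  exists x, (forall k, inner x (u k) = c k) /\ nrm x <= B.
Proof.
move=> B0 hB; pose S n := \sum_(0 <= k < n) c k *: u k.
pose T n := \sum_(0 <= k < n) nrm (c k) ^+ 2.
have TB n : T n <= B ^+ 2 by rewrite /T big_mkord.
have SB n : nrm (S n) <= B.
  by rewrite -ler_sqr ?nnegrE ?nrm_ge0// onseq_block_nrm2; exact: TB.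
have [x Sx] : exists x, tends_to S x.
  apply: complete => e e0; pose Q := range T.
  have hQ : has_sup Q by split; [exists (T 0%N), 0%N|exists (B ^+ 2) => _ [n _ <-]].
  have [_ [N _ <-] hN] := sup_adherent (exprn_gt0 2 e0) hQ.
  have ub n : T n <= sup Q by apply: sup_upper_bound => //; exists n.
  exists N.
  suff h m n : (N <= m)%N -> (m <= n)%N -> nrm (S n - S m) <= e.
    move=> m n Nm Nn; have [mn|nm] := leqP m n; first by rewrite nrmC h.
    by rewrite h// ltnW.
  move=> Nm mn; rewrite -ler_sqr ?nnegrE ?nrm_ge0 ?(ltW e0)//.
  have -> : S n - S m = \sum_(m <= k < n) c k *: u k.
    by rewrite /S (big_cat_nat (leq0n m) mn)//= addrAC subrr add0r.
  rewrite onseq_block_nrm2.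
  have -> : \sum_(m <= k < n) nrm (c k) ^+ 2 = T n - T m.
    by rewrite /T (big_cat_nat (leq0n m) mn)//= addrAC subrr add0r.
  have : T N <= T m.
    by rewrite /T (big_cat_nat (leq0n N) Nm)//= lerDl sumr_ge0// => i _; exact: sqr_ge0.
  by have := ub n; lra.
exists x; split=> [k|].
  apply/subr0_eq/nrm_eq0/eqP; rewrite eq_le nrm_ge0 andbT.
  apply/ler_addgt0Pr => e e0; rewrite add0r.
  have [N hN] := Sx e e0; have Nk := leq_maxl N k.+1.
  have <- : inner (S (maxn N k.+1)) (u k) = c k.
    have kM : (k < maxn N k.+1)%N by rewrite leq_maxr.
    rewrite /S big_mkord.
    exact: (onfam_comb (fun i : 'I_ _ => c i) (Ordinal kM) (onseq_fam (n := maxn N k.+1))).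
  rewrite -innerBl (le_trans (cauchy_schwarz _ _))//.
  have -> : nrm (u k) = 1.
    by apply/eqP; rewrite -(@eqrXn2 _ 2)// ?nrm_ge0// nrm2E ou eqxx expr1n.
  by rewrite mulr1 nrmC hN.
apply/ler_addgt0Pr => e e0; have [N hN] := Sx e e0.
rewrite -(subrK (S N) x) addrC (le_trans (nrmD _ _))// lerD//.
by rewrite nrmC hN.
Qed.

End orthonormal_sequence.

Section basis.
Variables (R : realType) (H : hilbertType R) (e : nat -> H).
Hypothesis he : orthonormal_basis e.
Implicit Types (A B T : operator H) (x y : H) (F G : nat -> H).

Lemma basis_expansion x :
  tends_to (fun n => \sum_(0 <= k < n) inner x (e k) *: e k) x.
Proof. by apply: cvg_tends_to; case: he => _; apply. Qed.

Lemma basis_total x : (forall k, inner x (e k) = 0) -> x = 0.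
Proof.
move=> h; apply: tends_to_unique (basis_expansion x) _ => d d0.
by exists 0%N => n _; rewrite big1 ?subr0 ?nrm0 ?(ltW d0)// => k _; rewrite h scale0r.
Qed.

Lemma basis_ext A B : (forall n, A (e n) = B (e n)) -> A = B.
Proof.
move=> h; rewrite -[A]adjK -[B]adjK; congr adj; apply: op_eq => y.
apply/subr0_eq/basis_total => k; apply: inner_eq0C.
by rewrite innerBr -!adjE h subrr.
Qed.

(** The analysis operator, sending [f] to the vector with coefficients [inner f (F k)], exists by
    Riesz-Fischer; the synthesis operator is its adjoint. *)
Lemma synthesis_exists F (b : R) : 0 <= b ->
  (forall f n, \sum_(k < n) nrm (inner f (F k)) ^+ 2 <= b * nrm f ^+ 2) ->
  exists T, forall n, T (e n) = F n.
Proof.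
move=> b0 hb; have oe := he.1.
have /choice[C hC] : forall f, exists x,
    (forall k, inner x (e k) = inner f (F k)) /\ nrm x <= Num.sqrt b * nrm f.
  move=> f; apply: riesz_fischer => //.
    by rewrite mulr_ge0 ?sqrtr_ge0 ?nrm_ge0.
  by move=> n; rewrite exprMn sqr_sqrtr.
have bC : bounded_op C.
  apply: (@bounded_opP _ _ _ (Num.sqrt b)) => [a x y|x]; last by case: (hC x).
  apply/subr0_eq/basis_total => k; rewrite innerBl innerDl innerZl.
  rewrite (hC _).1 (hC x).1 (hC y).1 innerDl innerZl; exact: subrr.
exists (Operator bC)^⋆ => n; apply: inner_ext => f.
by rewrite -adjE (hC f).1.
Qed.

Lemma synthesisE T F : (forall n, T (e n) = F n) -> synthesis e F = T.
Proof.
move=> hT; have : [set A | bounded_op A /\ forall n, A (e n) = F n] (synthesis e F).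
  by apply: getPex; exists (opfun T); split; [exact: op_bounded|].
case=> bA hA; rewrite -[LHS]/(opfun (Operator bA)); congr opfun.
by apply: basis_ext => n; rewrite hT -hA.
Qed.

Lemma frame_synthesis (S : set H) F : closed_subspace S -> is_frame S F ->
  exists T, [/\ forall n, T (e n) = F n, forall x, S (T x) &
    exists2 a : R, 0 < a & forall f, S f -> a * nrm f ^+ 2 <= nrm (T^⋆ f) ^+ 2].
Proof.
move=> hS [SF [a [b [a0 ab hab]]]]; have b0 : 0 <= b by rewrite (le_trans (ltW a0)).
have [T TF] : exists T, forall n, T (e n) = F n.
  (* The frame inequality is available on [S] only. A vector and its projection to [S] have the same
     coefficients against [F], and the projection is no longer than the vector. *)
  apply: (synthesis_exists b0) => f n; have [p Sp hp] := projection f hS.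
  have fF k : inner f (F k) = inner p (F k).
    by apply/subr0_eq; rewrite -innerBl; apply: inner_eq0C; exact: hp.
  under eq_bigr do rewrite fF.
  have [_ h] := andP (hab p Sp).
  apply: (@le_trans _ _ (b * nrm p ^+ 2)).
    rewrite -lee_fin (le_trans _ h)// -sumEFin.
    rewrite -(big_mkord xpredT (fun k => (nrm (inner p (F k)) ^+ 2)%:E)).
    by apply: nneseries_lim_ge => k _ _; rewrite lee_fin sqr_ge0.
  rewrite ler_wpM2l// -[f in leRHS](subrK p) addrC pythagoras; last exact: hp.
  by rewrite lerDl sqr_ge0.
exists T; split => //.
  move=> x; apply: closed_tends_to (csub_closed hS) _ (op_tends T (basis_expansion x)).
  move=> n; rewrite /= op_sum; apply: csub_sum => // k.
  by rewrite opZ TF; exact: csubZ.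
exists a => // f Sf; have [h _] := andP (hab f Sf).
rewrite -lee_fin (le_trans h)//.
apply: lime_le.
  by apply: is_cvg_nneseries => k _ _; rewrite lee_fin sqr_ge0.
apply: nearW => n; rewrite big_mkord sumEFin lee_fin.
apply: le_trans (bessel_seq he.1 (T^⋆ f) n).
by apply: ler_sum => k _; rewrite -TF adjEr.
Qed.

End basis.

Section ideal.
Variables (R : realType) (H : hilbertType R) (e : nat -> H).
Hypothesis he : orthonormal_basis e.
Variable J : set (H -> H).
Hypothesis hJ : proper_operator_ideal J.
Implicit Types (A B C : operator H).

Let oJ : operator_ideal J. Proof. by case: hJ. Qed.

Lemma idealD A B : J A -> J B -> J (A + B).
Proof. by case: oJ => _ _ h _ _; exact: h. Qed.
Lemma idealMl A B : J A -> J (B * A).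
Proof. by case: oJ => _ _ _ h _ JA; apply: (h B A) => //; exact: op_bounded. Qed.
Lemma idealMr A B : J A -> J (A * B).
Proof. by case: oJ => _ _ _ _ h JA; apply: (h A B) => //; exact: op_bounded. Qed.
Lemma ideal0 : J (0 : operator H).
Proof. by case: oJ. Qed.
Lemma idealN A : J A -> J (- A).
Proof. by move=> /(@idealMl _ (-1)); rewrite mulN1r. Qed.
Lemma idealB A B : J A -> J B -> J (A - B).
Proof. by move=> JA /idealN; exact: idealD. Qed.
Lemma idealZ (k : R[i]) A : J A -> J (k *: A).
Proof. by move=> /(@idealMl _ (k *: (1 : operator H))); rewrite opZl mul1r. Qed.
Lemma ideal_sum I (r : seq I) (P : pred I) (F : I -> operator H) :
  (forall i, J (F i)) -> J (\sum_(i <- r | P i) F i).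
Proof. by move=> h; elim/big_ind : _ => //; [exact: ideal0|exact: idealD]. Qed.

Lemma ideal_proper : ~ J (1 : operator H).
Proof.
move=> J1; case: hJ => _ _; apply; apply/seteqP; split => A.
  by case: oJ => h _ _ _ _; exact: h.
by move=> bA; have := idealMr (Operator bA) J1; rewrite mul1r.
Qed.

(** A nonzero element of [J], sandwiched between two rank-one operators, gives every rank-one
    operator. *)
Lemma ideal_rank1 (a b : H) : J (rank1 a b).
Proof.
have [A JA [x Ax]] : exists2 A : operator H, J A & exists x, A x != 0.
  apply/not_exists2P => h; case: hJ => _ + _; apply; apply/seteqP; split => [A JA|_ ->].
    have bA : bounded_op A by case: oJ => + _ _ _ _; apply.
    case: (h (Operator bA)) => // nx; apply/funext => x /=.
    by apply/eqP/negPn/negP => Ax; apply: nx; exists x.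
  by case: oJ.
have y0 : inner (A x) (A x) != 0.
  by apply: contra_neq Ax => /innerxx_eq0.
have -> : rank1 a b = rank1 (A x) ((inner (A x) (A x))^-1 *: b) * A * rank1 a x.
  apply: op_eq => z; rewrite !mulE !rank1E !opZ innerZl scalerA.
  by rewrite mulfK.
by apply: idealMr; exact: idealMl.
Qed.

Lemma ideal_not_invertible A B : J A -> inverse A B -> False.
Proof. by move=> JA [AB _]; apply: ideal_proper; rewrite -AB; exact: idealMr. Qed.

(* For [D := A^⋆ A] in the ideal, [N] is the negative part of [D - d]. On the
   nullspace of [N] we have [D >= d], so this nullspace is finite-dimensional
   as otherwise a compression of [D] to it would be invertible; on its
   orthogonal complement [D <= d]. *)
Lemma ideal_cpt A : J A -> cpt A.
Proof.
move=> JA eps eps0; pose d : R := eps ^+ 2; have d0 : 0 < d by rewrite exprn_gt0.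
pose D : operator H := A^⋆ * A; have pD : pos D := pos_gram A; have sD := pos_adj pD.
pose X : operator H := D - d%:C *: (1 : operator H).
have sX : X^⋆ = X by rewrite /X adjB adjZ adj1 sD.
have pX : pos (X * X) by rewrite -{1}sX; exact: pos_gram.
have [W [pW WW cW]] := sqrt_exists pX.
have XW : X * W = W * X by apply: cW; rewrite mulrA.
have sW := pos_adj pW.
pose N := W - X; pose P := W + X.
have NP : N * P = 0.
  have -> : N * P = (W * W - X * X) + (W * X - X * W) by rewrite /N /P; op_ring.
  by rewrite WW XW !subrr addr0.
have sN : N^⋆ = N by rewrite adjB sW sX.
have sP : P^⋆ = P by rewrite adjD sW sX.
have DE x : complex.Re (inner (D x) x) = complex.Re (inner (X x) x) + d * nrm x ^+ 2.
  by rewrite /X !opE innerBl innerZl ReB ReZ -nrm2E subrK.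
have V_ge x : N x = 0 -> d * nrm x ^+ 2 <= complex.Re (inner (D x) x).
  rewrite subE => /subr0_eq Wx; rewrite DE -Wx lerDr; exact: pos_ge0.
have V_le x : P x = 0 -> complex.Re (inner (D x) x) <= d * nrm x ^+ 2.
  rewrite addE => /eqP; rewrite addrC addr_eq0 => /eqP Xx; rewrite DE Xx innerNl ReN.
  by rewrite gerDr oppr_le0; exact: pos_ge0.
pose V := nullspace N; have cV : closed_subspace V := nullspace_closed N.
have [[s hs]|hs] :=
    pselect (exists s : seq H, forall v, V v -> {in s, forall a, inner v a = 0} -> v = 0).
  have [k [a [oa Va ha]]] := subspace_finite_onb_seq cV hs.
  exists [seq a i | i <- enum 'I_k] => x hx.
  have xa i : inner x (a i) = 0 by rewrite hx// map_f// mem_enum.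
  (* Since [N P = 0], the vector [P (P x)] lies in [V], to which [x] is orthogonal; so
     [inner (P x) (P x) = 0]. *)
  have Px : P x = 0.
    apply: innerxx_eq0; rewrite adjE sP (ha (P (P x))); last first.
      by change (N (P (P x)) = 0); rewrite -(mulE N P) NP.
    by rewrite inner_sumr big1// => i _; rewrite innerZr xa mulr0.
  rewrite -ler_sqr ?nnegrE ?mulr_ge0 ?nrm_ge0 ?(ltW eps0)// exprMn -/d.
  by have := V_le x Px; rewrite mulE -adjEr -nrm2E.
have [|u [Vu ou]] := subspace_infinite_seq cV.
  move=> s; apply: contrapT => h; apply: hs; exists s => v Vv vs.
  apply/eqP/negPn/negP => v0; apply: h; by exists v.
(* [U] is an isometry of the whole space into [V]. The compression of [D] along it lies in [J] and
   is bounded below by [d], hence invertible. *)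
have [U Ue] : exists U : operator H, forall n, U (e n) = u n.
  apply: (synthesis_exists he ler01) => f n; rewrite mul1r; exact: bessel_seq.
have UU : U^⋆ * U = 1.
  apply: (basis_ext he) => n; rewrite mulE Ue oneE.
  apply/subr0_eq/(basis_total he) => k.
  by rewrite innerBl -adjEr Ue ou he.1 subrr.
have NU : N * U = 0 by apply: (basis_ext he) => n; rewrite mulE Ue zeroE; exact: Vu.
have UE x : nrm (U x) ^+ 2 = nrm x ^+ 2 by rewrite !nrm2E adjE -mulE UU.
have [|B iB] := pos_inverse (A := U^⋆ * D * U) d0 (pos_conj U pD).
  move=> x; rewrite !mulE -adjEr -UE; apply: V_ge.
  by rewrite -mulE NU.
exfalso; apply: ideal_not_invertible iB.
by apply: idealMr; apply: idealMl; exact: idealMl.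
Qed.

End ideal.

(** * Projections and closed range operators *)

Section projections.
Variables (R : realType) (H : hilbertType R).
Implicit Types (A B C F G E P Q K : operator H) (x y z : H) (S : set H).

Definition projector P := P^⋆ = P /\ P * P = P.

Lemma projectorC P : projector P -> projector (1 - P).
Proof.
case=> sP PP; split; first by rewrite adjB adj1 sP.
by rewrite mulrBr mulr1 mulrBl mul1r PP subrr subr0.
Qed.

Lemma projector_exists S : closed_subspace S ->
  exists P, [/\ projector P, forall x, S (P x) & forall x, S x -> P x = x].
Proof.
move=> hS; have /choice[p hp] : forall x, exists p,
    S p /\ forall y, S y -> inner y (x - p) = 0.
  by move=> x; have [p Sp h] := projection x hS; exists p.
have uniq x q : S q -> (forall y, S y -> inner y (x - q) = 0) -> p x = q.
  move=> Sq hq; have [Sp h] := hp x; apply/subr0_eq/innerxx_eq0.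
  have Spq : S (p x - q) by exact: csubB.
  rewrite -[X in inner _ X](_ : (x - q) - (x - p x) = _); last first.
    by rewrite opprB addrC subrKA.
  by rewrite innerBr hq// h// subrr.
have linp (a : R[i]) x y : p (a *: x + y) = a *: p x + p y.
  have [Sx hx] := hp x; have [Sy hy] := hp y; apply: uniq.
    by apply: csubD => //; exact: csubZ.
  move=> z Sz; rewrite opprD addrACA -scalerBr innerDr innerZr hx// hy//.
  by rewrite mulr0 addr0.
have bp : bounded_op p.
  apply: (@bounded_opP _ _ _ 1) => // x; have [Sx hx] := hp x.
  rewrite mul1r -ler_sqr ?nnegrE ?nrm_ge0// -[x in leRHS](subrK (p x)) addrC.
  by rewrite pythagoras ?lerDl ?sqr_ge0//; exact: hx.
have pid x : S x -> p x = x.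
  by move=> Sx; apply: uniq => // y _; rewrite subrr inner0r.
exists (Operator bp); split => [|x|x]; [split| |exact: pid].
- apply: adj_unique => x y /=; have [Sx hx] := hp x; have [Sy hy] := hp y.
  rewrite -[y in LHS](subrK (p y)) innerDr hy// add0r.
  by rewrite -[x in RHS](subrK (p x)) innerDl (inner_eq0C (hx _ Sy)) add0r.
- by apply: op_eq => x; rewrite mulE /=; apply: pid; case: (hp x).
- by case: (hp x).
Qed.

Lemma projector_absorb P Q : projector P -> projector Q ->
  (forall x, Q x = 0 -> P x = 0) -> P = P * Q.
Proof.
move=> hP [sQ QQ] h; apply: op_eq => x; rewrite mulE.
apply/subr0_eq; rewrite -opB; apply: h.
by rewrite opB -mulE QQ subrr.
Qed.

Lemma projector_ker_unique P Q : projector P -> projector Q ->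
  (forall x, P x = 0 <-> Q x = 0) -> P = Q.
Proof.
move=> hP hQ h.
have PQ := projector_absorb hP hQ (fun x => (h x).2).
have QP := projector_absorb hQ hP (fun x => (h x).1).
by rewrite PQ -[in RHS]hQ.1 [in RHS]QP adjM hP.1 hQ.1.
Qed.

(* [A] factors through [B] on the left as soon as [nrm (A x)] is dominated by
   [nrm (B x)] (R. G. Douglas). *)
Lemma douglas A B : (forall x, nrm (A x) <= nrm (B x)) -> exists K, A = K * B.
Proof.
move=> AB.
(* [P] projects onto the orthogonal complement of the range of [B]. *)
have [P [hP NP PN]] := projector_exists (nullspace_closed B^⋆).
have B0 x : B x = 0 -> A x = 0.
  move=> Bx; apply/nrm_eq0/eqP; rewrite eq_le nrm_ge0 andbT.
  by have := AB x; rewrite Bx nrm0.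
have wd x x' : B x = B x' -> A x = A x'.
  by move=> h; apply/subr0_eq; rewrite -opB B0// opB h subrr.
have PC v : inner (v - P v) (P v) = 0.
  by rewrite adjEr hP.1 opB -(mulE P P) hP.2 subrr inner0l.
have PB x : P (B x) = 0.
  apply: innerxx_eq0; rewrite adjE hP.1 adjE.
  by rewrite (NP (P (B x))) inner0r.
(* [Z y] represents [B x |-> inner (A x) y] on [range B], which need not be closed. Subtracting
   [P z] normalizes the representative, and the approximation by vectors [B x] gives its bound. The
   factor [K] is the adjoint of [Z]. *)
have /choice[Z hZ] : forall y, exists z,
    [/\ forall x, inner (A x) y = inner (B x) z, P z = 0 & nrm z <= nrm y].
  move=> y; pose V := range B.
  have /choice[r hr] : forall v, exists x, V v -> B x = v.
    by move=> v; have [[x _ <-]|] := pselect (V v); [exists x|exists 0].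
  pose phi v := inner (A (r v)) y.
  have phiE x : phi (B x) = inner (A x) y.
    by rewrite /phi; congr (inner _ y); apply: wd; apply: hr; exists x.
  have [| | |v Vv|z [hz apz]] := @riesz _ _ V phi (nrm y).
  - by exists 0; rewrite ?op_z.
  - by move=> a _ _ [x _ <-] [x' _ <-]; exists (a *: x + x') => //; rewrite opP.
  - move=> a _ _ [x _ <-] [x' _ <-]; rewrite -opP !phiE opP.
    by rewrite innerDl innerZl.
  - rewrite (le_trans (cauchy_schwarz _ _))// mulrC ler_wpM2l ?nrm_ge0//.
    by rewrite -[in leRHS](hr v Vv) AB.
  have hzx x : inner (A x) y = inner (B x) (z - P z).
    rewrite -phiE hz; last by exists x.
    by rewrite innerBr [inner _ (P z)]adjEr hP.1 PB inner0l subr0.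
  exists (z - P z); split => //; first by rewrite opB -mulE hP.2 subrr.
  set w := z - P z in hzx *.
  have [->|n0] := eqVneq (nrm w) 0; first exact: nrm_ge0.
  have n1 : 0 < nrm w by rewrite lt_def n0 nrm_ge0.
  rewrite -(ler_pM2r n1); apply/ler_addgt0Pr => e e0.
  have k0 : 0 < nrm w + nrm y by rewrite ltr_wpDr ?nrm_ge0.
  have [_ [x _ <-] zx] := apz (e / (nrm w + nrm y)) ltac:(by rewrite divr_gt0).
  have wx : nrm (w - B x) <= e / (nrm w + nrm y).
    apply: le_trans zx.
    have -> : w - B x = (1 - P) (z - B x).
      by rewrite subE oneE [in RHS]opB PB subr0 /w addrAC.
    rewrite subE oneE -ler_sqr ?nnegrE ?nrm_ge0// -[z - B x in leRHS](subrK (P (z - B x))) [leRHS]pythagoras.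
      by rewrite lerDl sqr_ge0.
    exact: PC.
  have wE : nrm w * nrm w = complex.Re (inner (w - B x) w) + complex.Re (inner (A x) y).
    by rewrite hzx -ReD -innerDl subrK -expr2 nrm2E.
  have h1 := Re_inner_le (w - B x) w; have h2 := Re_inner_le (A x) y.
  have h3 := AB x; have h4 : nrm (B x) <= nrm w + nrm (w - B x).
    by rewrite -{1}(subKr w (B x)) nrmB.
  have h5 : nrm (A x) * nrm y <= (nrm w + nrm (w - B x)) * nrm y.
    by rewrite ler_wpM2r ?nrm_ge0// (le_trans h3).
  move: wx; rewrite ler_pdivlMr// => wx; rewrite wE; lra.
have bZ : bounded_op Z.
  apply: (@bounded_opP _ _ _ 1) => [a y y'|y]; last first.
    by rewrite mul1r; case: (hZ y).
  have [h1 P1 _] := hZ y; have [h2 P2 _] := hZ y'; have [h3 P3 _] := hZ (a *: y + y').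
  (* [d] is orthogonal to [range B], hence fixed by [P], but [P] also kills it. *)
  apply/subr0_eq; set d := _ - _.
  have Pd : P d = 0 by rewrite opB opP P1 P2 P3 scaler0 addr0 subrr.
  rewrite -Pd PN//; apply: inner_ext => x.
  rewrite -adjE inner0r innerBr innerDr innerZr -h1 -h2 -h3.
  by rewrite innerDr innerZr subrr.
exists (Operator bZ)^⋆; apply: op_eq => x; apply: inner_ext => y.
rewrite mulE -adjE /=; apply/esym; rewrite innerC.
by have [<- _ _] := hZ y; rewrite -innerC.
Qed.

Lemma pos_gram_nrm A W x : pos W -> W * W = A^⋆ * A -> nrm (W x) = nrm (A x).
Proof.
move=> pW WW; apply/eqP; rewrite -(@eqrXn2 _ 2)// ?nrm_ge0// !nrm2E.
by rewrite adjE (pos_adj pW) -mulE WW mulE -adjE.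
Qed.

End projections.

Section ideal_adjoint.
Variables (R : realType) (H : hilbertType R) (J : set (H -> H)).
Hypothesis hJ : proper_operator_ideal J.
Implicit Types (A B C F G E P Q K : operator H).

(** [A] and its modulus [W] have the same norm at every vector, so each is a left multiple of the
    other: [A = K W] and [W = L A] give [A^⋆ = W K^⋆ = L A K^⋆]. *)
Lemma ideal_adj A : J A -> J A^⋆.
Proof.
move=> JA; have [W [pW WW _]] := sqrt_exists (pos_gram A).
have hn x := pos_gram_nrm x pW WW.
have [K AK] : exists K, A = K * W by apply: douglas => x; rewrite hn.
have [L WL] : exists L, W = L * A by apply: douglas => x; rewrite hn.
rewrite {1}AK adjM (pos_adj pW) WL -mulrA.
by apply: (idealMl hJ); exact: (idealMr hJ).
Qed.

Lemma ideal_inverseB A B A' B' : inverse A A' -> inverse B B' ->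
  J (A - B) -> J (A' - B').
Proof.
move=> [AA' A'A] [BB' B'B] JAB.
have -> : A' - B' = - (A' * (A - B) * B').
  by rewrite mulrBr mulrBl A'A mul1r -mulrA BB' mulr1 opprB.
by apply: (idealN hJ); apply: (idealMr hJ); exact: (idealMl hJ).
Qed.

End ideal_adjoint.

Section closed_range.
Variables (R : realType) (H : hilbertType R).
Implicit Types (A B C D F G E P Q K : operator H) (x y z : H).

(* An operator [F] with closed range, [E] being the projection onto the
   orthogonal complement of its nullspace. *)
Record closed_range F E C : Prop := ClosedRange {
  cr_proj : projector E;
  cr_FE : F * E = F;
  cr_ker : forall x, F x = 0 -> E x = 0;
  cr_inv : inverse (F^⋆ * F + (1 - E)) C }.

Section facts.
Variables (F E C : operator H) (h : closed_range F E C).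

Lemma cr_EF : E * F^⋆ = F^⋆.
Proof. by rewrite -[in RHS](cr_FE h) adjM (cr_proj h).1. Qed.

Let BE : (F^⋆ * F + (1 - E)) * E = F^⋆ * F.
Proof.
by rewrite mulrDl -mulrA (cr_FE h) mulrBl mul1r (cr_proj h).2 subrr addr0.
Qed.

Let EB : E * (F^⋆ * F + (1 - E)) = F^⋆ * F.
Proof.
by rewrite mulrDr mulrA cr_EF mulrBr mulr1 (cr_proj h).2 subrr addr0.
Qed.

Lemma cr_CE : C * E = E * C.
Proof. by apply: inverse_comm (cr_inv h) _; rewrite BE EB. Qed.

Lemma cr_FFC : F^⋆ * F * C = E.
Proof. by rewrite -EB -mulrA (cr_inv h).1 mulr1. Qed.

Lemma cr_CFF : C * (F^⋆ * F) = E.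
Proof. by rewrite -BE mulrA (cr_inv h).2 mul1r. Qed.

Lemma cr_C1E : C * (1 - E) = 1 - E.
Proof.
have {1}-> : 1 - E = (F^⋆ * F + (1 - E)) * (1 - E).
  by rewrite mulrBr mulr1 BE addrAC subrr add0r.
by rewrite mulrA (cr_inv h).2 mul1r.
Qed.

Lemma cr_posB : pos (F^⋆ * F + (1 - E)).
Proof.
apply: posD; first exact: pos_gram.
have [s p] := projectorC (cr_proj h).
by rewrite -p -{1}s; exact: pos_gram.
Qed.

Lemma cr_posC : pos C.
Proof. exact: inverse_pos (cr_inv h) cr_posB. Qed.

Lemma cr_adjC : C^⋆ = C.
Proof. exact: pos_adj cr_posC. Qed.

Lemma cr_nullspace x : F x = 0 <-> E x = 0.
Proof.
split; first exact: (cr_ker h).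
by rewrite -(cr_FE h) mulE => ->; rewrite op_z.
Qed.

Definition ranproj := F * C * F^⋆.

Lemma ranprojF : ranproj * F = F.
Proof. by rewrite /ranproj -!mulrA cr_CFF (cr_FE h). Qed.

Lemma ranproj_projector : projector ranproj.
Proof.
split; first by rewrite /ranproj !adjM adjK cr_adjC mulrA.
by rewrite {2}/ranproj 2!mulrA ranprojF.
Qed.

Lemma ranproj_range x : ranproj x = x <-> range F x.
Proof.
split=> [<-|[y _ <-]]; last by rewrite -mulE ranprojF.
by exists (C (F^⋆ x)).
Qed.

(** Passing to the dual exchanges [C] with the operator it inverts, so dualizing twice returns
    [F]. *)
Lemma closed_range_dual :
  closed_range (F * C) E (F^⋆ * F + (1 - E)).
Proof.
split; first exact: cr_proj h.
- by rewrite -mulrA cr_CE mulrA (cr_FE h).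
- move=> x; rewrite mulE => /(cr_ker h); rewrite -mulE -cr_CE mulE => CE.
  have := congr1 (fun A : operator H => A (E x)) (cr_inv h).1.
  by rewrite mulE CE op_z.
- have -> : (F * C)^⋆ * (F * C) + (1 - E) = C.
    rewrite adjM cr_adjC -mulrA (mulrA F^⋆) cr_FFC -cr_C1E -mulrDr.
    by rewrite addrC subrK mulr1.
  exact: inverse_sym (cr_inv h).
Qed.

(** The Gram operator of [F * K] is [E] itself, and [E + (1 - E) = 1]. *)
Lemma closed_range_parseval K : pos K -> K * K = C -> K * E = E * K ->
  K * (F^⋆ * F) = F^⋆ * F * K -> closed_range (F * K) E 1.
Proof.
move=> pK KK KE KF; split; first exact: cr_proj h.
- by rewrite -mulrA KE mulrA (cr_FE h).
- move=> x; rewrite mulE => /(cr_ker h); rewrite -mulE -KE mulE => KEx.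
  have CE : C (E x) = 0 by rewrite -KK mulE KEx op_z.
  have := congr1 (fun A : operator H => A (E x)) (cr_inv h).1.
  by rewrite mulE CE op_z.
- have -> : (F * K)^⋆ * (F * K) + (1 - E) = 1.
    rewrite adjM (pos_adj pK) -mulrA (mulrA F^⋆) -KF mulrA KK cr_CFF.
    by rewrite addrC subrK.
  by split; rewrite mul1r.
Qed.

End facts.

(** The lower bound lives on the side of the range: it makes [A = F F^⋆ + (1 - P)] invertible. Its
    inverse [B] is then carried to the domain, where [F^⋆ B F] is the projection [E]. *)
Lemma closed_range_exists F (S : set H) : closed_subspace S ->
  (forall x, S (F x)) ->
  (exists2 a : R, 0 < a & forall f, S f -> a * nrm f ^+ 2 <= nrm (F^⋆ f) ^+ 2) ->
  exists E C, closed_range F E C /\ range F = S.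
Proof.
move=> hS SF [a a0 ha]; have [P [hP SP PS]] := projector_exists hS.
have PF : P * F = F by apply: op_eq => x; rewrite mulE PS.
have FP : F^⋆ * P = F^⋆ by rewrite -[in RHS]PF adjM hP.1.
have [sP' PP'] := projectorC hP.
pose A := F * F^⋆ + (1 - P).
have pA : pos A.
  apply: posD; first exact: pos_gramr.
  by rewrite -PP' -{1}sP'; exact: pos_gram.
have ReA x : complex.Re (inner (A x) x) = nrm (F^⋆ x) ^+ 2 + nrm ((1 - P) x) ^+ 2.
  rewrite addE innerDl ReD mulE adjE -nrm2E; congr (_ + _).
  by rewrite -{1}PP' mulE adjE sP' -nrm2E.
have [B iB] : exists B, inverse A B.
  apply: (@pos_inverse _ _ A (Num.min a 1)) => //; first by rewrite lt_min a0 ltr01.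
  move=> x; rewrite ReA.
  have -> : nrm x ^+ 2 = nrm (P x) ^+ 2 + nrm ((1 - P) x) ^+ 2.
    rewrite -pythagoras ?subE ?oneE; first by rewrite addrC subrK.
    by rewrite adjE hP.1 opB -mulE hP.2 subrr inner0r.
  rewrite mulrDr lerD//.
    rewrite -FP mulE (le_trans _ (ha _ (SP x)))// ler_wpM2r ?sqr_ge0//.
    by rewrite ge_min lexx.
  by rewrite ler_piMl ?sqr_ge0// ge_min lexx orbT.
have [AB BA] := iB.
have AF : A * F = F * F^⋆ * F by rewrite mulrDl mulrBl mul1r PF subrr addr0.
have FA : F^⋆ * A = F^⋆ * (F * F^⋆) by rewrite mulrDr mulrBr mulr1 FP subrr addr0.
have sB : B^⋆ = B := inverse_selfadj iB (pos_adj pA).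
have BFFF : B * (F * F^⋆ * F) = F by rewrite -AF mulrA BA mul1r.
have FFFB : F^⋆ * (F * F^⋆) * B = F^⋆ by rewrite -FA -mulrA AB mulr1.
pose E := F^⋆ * B * F.
have sE : E^⋆ = E by rewrite /E !adjM adjK sB mulrA.
have comA : A * (F * F^⋆) = F * F^⋆ * A.
  by rewrite mulrA AF -(mulrA F _ A) FA !mulrA.
have comB := inverse_comm iB comA.
have FE : F * E = F by rewrite /E !mulrA -comB -mulrA.
have EE : E * E = E by rewrite {1}/E -mulrA FE.
have EF : E * F^⋆ = F^⋆ by rewrite -[in RHS]FE adjM sE.
(* [F^⋆ B^2 F] is the Moore-Penrose inverse of [F^⋆ F], and [1 - E] inverts the added summand. *)
exists E, (1 - E + F^⋆ * (B * B) * F); split.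
  split => // [x Fx|]; first by rewrite !mulE Fx !op_z.
  have FFE : F^⋆ * F * (F^⋆ * (B * B) * F) = E.
    have -> : F^⋆ * F * (F^⋆ * (B * B) * F) = F^⋆ * (F * F^⋆) * B * B * F.
      by rewrite !mulrA.
    by rewrite FFFB.
  have c1 : (1 - E) * (F^⋆ * (B * B) * F) = 0.
    by rewrite !mulrA mulrBl mul1r EF subrr !mul0r.
  have c2 : F^⋆ * F * (1 - E) = 0 by rewrite mulrBr mulr1 -mulrA FE subrr.
  have c3 := (projectorC (conj sE EE)).2.
  have i1 : (F^⋆ * F + (1 - E)) * (1 - E + F^⋆ * (B * B) * F) = 1.
    by rewrite mulrDr [X in X + _ = _]mulrDl [X in _ + X = _]mulrDl c2 c3 FFE c1 add0r addr0 subrK.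
  have sX : (F^⋆ * F + (1 - E))^⋆ = F^⋆ * F + (1 - E).
    by rewrite adjD adjB adj1 sE adjM adjK.
  have sY : (1 - E + F^⋆ * (B * B) * F)^⋆ = 1 - E + F^⋆ * (B * B) * F.
    by rewrite adjD adjB adj1 sE !adjM sB adjK !mulrA.
  by split => //; have := congr1 (@adj _ _) i1; rewrite adjM sX sY adj1.
apply/seteqP; split => [_ [x _ <-] //|s Ss].
exists (F^⋆ (B s)) => //.
have ABs : A (B s) = s by rewrite -mulE AB.
rewrite -[RHS]ABs addE mulE -[LHS]addr0; congr (_ + _).
have comP : A * P = P * A.
  by rewrite mulrDl mulrDr -mulrA FP mulrA PF mulrBl mulrBr mulr1 mul1r.
rewrite subE oneE -{1}(PS s Ss) -(mulE B) (inverse_comm iB comP) mulE.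
by rewrite subrr.
Qed.

End closed_range.

Section core.
Variables (R : realType) (H : hilbertType R) (e : nat -> H).
Hypothesis he : orthonormal_basis e.
Variable J : set (H -> H).
Hypothesis hJ : proper_operator_ideal J.
Implicit Types (A B C D F G E P Q K W : operator H) (x y z : H).

Lemma closed_range_ker_unique F G E E' C D :
  closed_range F E C -> closed_range G E' D ->
  (forall x, F x = 0 <-> G x = 0) -> E = E'.
Proof.
move=> hF hG FG; apply: projector_ker_unique (cr_proj hF) (cr_proj hG) _ => x.
by rewrite -(cr_nullspace hF) -(cr_nullspace hG).
Qed.

Lemma ideal_gramB F G : J (F - G) -> J (F^⋆ * F - G^⋆ * G).
Proof.
move=> JFG.
have -> : F^⋆ * F - G^⋆ * G = F^⋆ * (F - G) + (F - G)^⋆ * G.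
  by rewrite adjB mulrBr mulrBl addrA subrK.
apply: (idealD hJ); first exact: (idealMl hJ).
by apply: (idealMr hJ); exact: (ideal_adj hJ).
Qed.

Lemma ideal_gramrB F G : J (F - G) -> J (F * F^⋆ - G * G^⋆).
Proof. by move=> /(ideal_adj hJ); rewrite adjB => /ideal_gramB; rewrite !adjK. Qed.

Section same_kernel.
Variables (F G E C D : operator H).
Hypotheses (hF : closed_range F E C) (hG : closed_range G E D).
Hypothesis JFG : J (F - G).

Lemma ideal_crB : J (C - D).
Proof.
apply: (ideal_inverseB hJ (cr_inv hF) (cr_inv hG)).
by rewrite opprD addrACA subrr addr0; exact: ideal_gramB.
Qed.

Lemma ideal_dualB : J (F * C - G * D).
Proof.
have -> : F * C - G * D = (F - G) * C + G * (C - D).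
  by rewrite mulrBr mulrBl addrA subrK.
apply: (idealD hJ); first exact: (idealMr hJ).
by apply: (idealMl hJ); exact: ideal_crB.
Qed.

Let P := ranproj F C.
Let Q := ranproj G D.

Lemma ideal_ranprojB : J (P - Q).
Proof.
have -> : P - Q = (F * C - G * D) * F^⋆ + G * D * (F - G)^⋆.
  by rewrite adjB mulrBr mulrBl addrA subrK.
apply: (idealD hJ); first by apply: (idealMr hJ); exact: ideal_dualB.
by apply: (idealMl hJ); exact: (ideal_adj hJ).
Qed.

(** [D * G^⋆] is the Moore-Penrose inverse of [G]. So [L] sends [G x] to [F x] and vanishes on the
    orthogonal complement of [range G]. *)
Let L := F * D * G^⋆.
Let W0 := L + (1 - P) * (1 - Q).

Let hP : projector P := ranproj_projector hF.
Let hQ : projector Q := ranproj_projector hG.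

Let LQ : L * Q = L.
Proof.
rewrite /L /Q /ranproj -!mulrA (mulrA G^⋆ G) (mulrA (G^⋆ * G)) (cr_FFC hG).
by rewrite (cr_EF hG).
Qed.

Let PL : P * L = L.
Proof. by rewrite /L !mulrA (ranprojF hF). Qed.

Let LG : L * G = F.
Proof. by rewrite /L -!mulrA (cr_CFF hG) (cr_FE hF). Qed.

Let L'L : G * C * F^⋆ * L = Q.
Proof.
rewrite /L /Q /ranproj -!mulrA (mulrA F^⋆ F) (mulrA C) (cr_CFF hF).
by rewrite (mulrA E) -(cr_CE hG) -mulrA (cr_EF hG).
Qed.

Let LL' : L * (G * C * F^⋆) = P.
Proof.
rewrite !mulrA LG.
by rewrite /P /ranproj.
Qed.

Let L0 x : L x = 0 <-> Q x = 0.
Proof. by split=> h; [rewrite -L'L|rewrite -LQ]; rewrite mulE h op_z. Qed.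

Let La0 x : L^⋆ x = 0 <-> P x = 0.
Proof.
split=> h; [rewrite -(hP.1) -LL' adjM|rewrite -PL adjM hP.1]; by rewrite mulE h op_z.
Qed.

Let W0_ideal : J (W0 - 1).
Proof.
have -> : W0 - 1 = (F - G) * D * G^⋆ - P * (P - Q).
  have -> : (F - G) * D * G^⋆ = L - Q by rewrite /L /Q /ranproj !mulrBl.
  by rewrite mulrBr hP.2 /W0; op_ring.
apply: (idealB hJ); first by do 2!apply: (idealMr hJ).
by apply: (idealMl hJ); exact: ideal_ranprojB.
Qed.

(** The two summands of [W0] have orthogonal ranges, so each vanishes on the kernel. This and the
    next equality identify kernel and cokernel with the two spaces in [pair_index]. *)
Let W0_nullspace : nullspace W0 = nullspace Q `&` range P.
Proof.
apply/seteqP; split => x.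
  move=> Wx; have {}Wx : W0 x = 0 by [].
  have : P (W0 x) = 0 by rewrite Wx op_z.
  rewrite -mulE mulrDr PL [P * (_ * _)]mulrA [P * (1 - P)]mulrBr mulr1 hP.2 subrr mul0r addr0 => Lx.
  split; first exact/L0.
  have := Wx; rewrite addE Lx add0r mulE [(1 - Q) x]subE (L0 x).1// subr0.
  by rewrite subE oneE => /subr0_eq xP; exists x.
move=> [Qx [y _ xy]]; change (W0 x = 0).
have {}Qx : Q x = 0 by [].
rewrite addE (L0 x).2// add0r mulE [(1 - Q) x]subE Qx subr0 oneE subE oneE.
by rewrite -xy -(mulE P P) hP.2 subrr.
Qed.

Let W0_conullspace : nullspace W0^⋆ = range Q `&` nullspace P.
Proof.
have [sP PP] := hP; have [sQ QQ] := hQ.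
have WE : W0^⋆ = L^⋆ + (1 - Q) * (1 - P).
  by rewrite adjD [((1 - P) * (1 - Q))^⋆]adjM !adjB adj1 sP sQ.
apply/seteqP; split => x.
  move=> Wx; have {}Wx : W0^⋆ x = 0 by [].
  have QL : Q * L^⋆ = L^⋆ by rewrite -[in RHS]LQ adjM sQ.
  have : Q (W0^⋆ x) = 0 by rewrite Wx op_z.
  rewrite -mulE WE mulrDr QL [Q * (_ * _)]mulrA [Q * (1 - Q)]mulrBr mulr1 QQ subrr mul0r addr0 => Lx.
  split; last exact/La0.
  have := Wx; rewrite WE addE Lx add0r mulE [(1 - P) x]subE (La0 x).1// subr0.
  by rewrite subE oneE => /subr0_eq xP; exists x.
move=> [[y _ xy] Px]; change (W0^⋆ x = 0).
have {}Px : P x = 0 by [].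
rewrite WE addE (La0 x).2// add0r mulE [(1 - P) x]subE Px subr0 oneE subE oneE.
by rewrite -xy -(mulE Q Q) QQ subrr.
Qed.

(* [W0] carries [range Q] onto [range P] and compresses one orthogonal
   complement to the other; having index zero, it becomes invertible after a
   finite-rank correction, which leaves [W0 * G = F] unaffected. *)
Lemma core_extension :
  exists W, [/\ exists B, inverse W B, J (W - 1), W * G = F &
    exists n, has_dim (nullspace Q `&` range P) n /\ has_dim (range Q `&` nullspace P) n].
Proof.
have W0E : 1 + (W0 - 1) = W0 by rewrite addrC subrK.
have [n [a [b []]]] := fredholm_alternative (ideal_cpt he hJ W0_ideal).
rewrite W0E => ha hb _ [B iB].
exists (W0 + \sum_i rank1 (a i) (b i)); split.
- by exists B.
- rewrite addrAC; apply: (idealD hJ) => //; apply: (ideal_sum hJ) => i.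
  exact: (ideal_rank1 hJ).
- have QG : Q * G = G := ranprojF hG.
  have W0G : W0 * G = F.
    rewrite [W0 * G]mulrDl LG -[(1 - P) * (1 - Q) * G]mulrA.
    by rewrite [(1 - Q) * G]mulrBl mul1r QG subrr mulr0 addr0.
  rewrite mulrDl W0G mulr_suml big1 ?addr0// => i _; rewrite rank1_mul.
  (* The vectors [a i] lie in the nullspace of [Q], which is that of [G^⋆]; so the correction
     vanishes on [range G]. *)
  have [_ Na _] := ha; have := Na i; rewrite W0_nullspace => -[Qa _].
  have {}Qa : Q (a i) = 0 by [].
  have -> : G^⋆ (a i) = 0.
    by rewrite -QG adjM hQ.1 mulE Qa op_z.
  by apply: op_eq => x; rewrite rank1E inner0r scale0r.
- exists n; rewrite -W0_nullspace -W0_conullspace.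
  by split; [exact: onb_has_dim ha|exact: onb_has_dim hb].
Qed.

(** [M = Q P + (1 - Q) (1 - P)] belongs to [1 + J], and [Q P] is its block from [range P] to
    [range Q]. The Fredholm alternative for [M] gives the closed range and the finite
    codimension. *)
Lemma core_fredholm_pair : fredholm_pair P Q.
Proof.
have [sP PP] := hP; have [sQ QQ] := hQ.
have orth X : projector X -> orth_projection X.
  move=> [sX XX]; split; first exact: op_bounded.
    by apply/funext => x /=; rewrite -mulE XX.
  by rewrite -[LHS]/(opfun (X^⋆)) sX.
split; [exact: orth|exact: orth|].
have [_ [_ _ _ [n [dn _]]]] := core_extension.
pose M := Q * P + (1 - Q) * (1 - P).
have JM : J (M - 1).
  have -> : M - 1 = Q * (P - Q) - (P - Q) * P.
    by rewrite mulrBr mulrBl PP QQ /M; op_ring.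
  by apply: (idealB hJ); [apply: (idealMl hJ)|apply: (idealMr hJ)]; exact: ideal_ranprojB.
have ME : 1 + (M - 1) = M by rewrite addrC subrK.
have [k [a [b []]]] := fredholm_alternative (ideal_cpt he hJ JM).
rewrite ME => _ [ob Nb _] surj _.
have QM : Q * M = Q * P.
  have -> : Q * M = Q * Q * P + (Q - Q * Q) * (1 - P) by rewrite /M; op_ring.
  by rewrite QQ subrr mul0r addr0.
have MP : M * P = Q * P.
  have -> : M * P = Q * (P * P) + (1 - Q) * (P - P * P) by rewrite /M; op_ring.
  by rewrite PP subrr mulr0 addr0.
have Mb x i : inner (M x) (b i) = 0.
  by rewrite adjE (Nb i) inner0r.
have rP x : range P x -> P x = x by move=> [y _ <-]; rewrite -mulE PP.
have rQ x : range Q x -> Q x = x by move=> [y _ <-]; rewrite -mulE QQ.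
split.
- exists n; suff -> : range P `&` nullspace (Q \o P) = nullspace Q `&` range P by [].
  rewrite setIC; apply/seteqP; split => x [] h Px; split => //.
    by change (Q (P x) = 0) in h; rewrite (rP x Px) in h.
  by change (Q (P x) = 0); rewrite (rP x Px).
(* The image consists of the vectors of [range Q] that are orthogonal to all [b i]. *)
- suff -> : (Q \o P) @` range P = nullspace (1 - Q) `&` nullspace (famproj b).
    by apply: closedI; exact: csub_closed (nullspace_closed _).
  apply/seteqP; split => [_ [x Px <-]|y [Qy by0]].
    have QPx : Q (P x) = M (P x) by rewrite -[RHS]mulE MP mulE (rP x Px).
    split; first by change ((1 - Q) (Q (P x)) = 0); rewrite subE oneE -(mulE Q Q) QQ subrr.
    change (famproj b (Q (P x)) = 0); rewrite famprojE big1// => i _.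
    by rewrite QPx Mb scale0r.
  have {}Qy : y - Q y = 0 by [].
  have {}by0 : famproj b y = 0 by [].
  have [i|x Mx] := surj y.
    by rewrite -(famproj_orth y i ob) by0 subr0.
  exists (P x); first by exists x.
  change (Q (P (P x)) = y); rewrite -(mulE P P) PP -(mulE Q P) -QM mulE Mx.
  by apply/esym/subr0_eq.
- exists k, (fun i => Q (b i)); split=> [i|y Qy]; first by exists (b i).
  have [i|x Mx] := surj (y - famproj b y); first exact: famproj_orth.
  exists (P x); first by exists x.
  exists (fun i => inner y (b i)).
  change (y = Q (P (P x)) + \sum_i inner y (b i) *: Q (b i)).
  rewrite -(mulE P P) PP -(mulE Q P) -QM mulE Mx opB rQ// famprojE op_sum.
  by under [X in _ = _ + X]eq_bigr do rewrite -opZ; rewrite subrK.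
Qed.

End same_kernel.

(** [E = E'] expresses the equality of the nullspaces, in the form in which it can be
    substituted. *)
Lemma core F G E E' C D : closed_range F E C -> closed_range G E' D ->
  (exists2 W, (exists B, inverse W B) /\ J (W - 1) & W * G = F) <->
  J (F - G) /\ E = E'.
Proof.
move=> hF hG; split=> [[W [[B [_ BW]] JW] WG]|[JFG EE']].
  split; first by rewrite -WG -[X in _ - X]mul1r -mulrBl; exact: (idealMr hJ).
  apply: closed_range_ker_unique hF hG _ => x; rewrite -WG mulE.
  split=> [h|->]; last by rewrite op_z.
  by rewrite -[G x]/((1 : operator H) (G x)) -BW mulE h op_z.
subst E'; have [W [iW JW WG _]] := core_extension hF hG JFG.
by exists W.
Qed.

End core.

(** * Singular values and Ky Fan norms *)

Section spectral_sequence.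
Variables (R : realType) (H : hilbertType R).
Implicit Types (A B C D F G E P Q K W : operator H) (x y z : H).

(** [m] is the supremum of the form on the unit ball. Were it not an eigenvalue, [1 - D / m] would
    be injective, hence invertible and bounded below by compactness, and then [pos_bound] for
    [1 - D / m] would push the form below [m (1 - d^2)]. *)
Lemma pos_top_eigenvector D : pos D -> cpt D -> exists (m : R) (u : H),
  [/\ 0 <= m, bnd D m, D u = m%:C *: u & inner u u = (m != 0)%:R /\ (m = 0 -> u = 0)].
Proof.
move=> pD cD; have [M M0 hM] := op_bound D.
pose S := [set complex.Re (inner (D x) x) | x in [set x | nrm x <= 1]].
have hS : has_sup S.
  split; first by exists 0, 0; rewrite ?inner0r//= nrm0.
  exists M => _ [x /= x1 <-]; rewrite (le_trans (bnd_inner x hM))//.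
  by rewrite ler_piMr ?(ltW M0)// expr_le1// nrm_ge0.
pose m := sup S.
have hm x : complex.Re (inner (D x) x) <= m * nrm x ^+ 2.
  have [n0|n0] := eqVneq (nrm x) 0; first by rewrite (nrm_eq0 n0) inner0r nrm0 expr0n mulr0.
  have n1 : 0 < nrm x by rewrite lt_def n0 nrm_ge0.
  have : complex.Re (inner (D (((nrm x)^-1)%:C *: x)) (((nrm x)^-1)%:C *: x)) <= m.
    apply: sup_upper_bound => //; exists (((nrm x)^-1)%:C *: x) => //=.
    by rewrite nrmZ nrm_real ger0_norm ?invr_ge0 ?(ltW n1)// mulVf.
  rewrite opZ innerZl innerZr conjR !ReZ mulrA -expr2 exprVn mulrC ler_pdivrMr//.
  by rewrite exprn_gt0.
have m0 : 0 <= m.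
  by apply: sup_upper_bound => //; exists 0; rewrite /= ?nrm0// inner0r.
have [mE|mN] := eqVneq m 0.
  (* If [m = 0] then [D = 0]; the vector [0] is a filler that lets the sequences built from this
     lemma continue with zeros. *)
  exists 0, 0; rewrite op_z scaler0 inner0l eqxx; split => // x.
  rewrite mul0r (pos_ker pD) ?nrm0//; apply/eqP; rewrite eq_le pos_ge0// andbT.
  by rewrite (le_trans (hm x))// mE mul0r.
have {}m0 : 0 < m by rewrite lt_def mN.
have bD := pos_bnd m0 pD hm.
suff [u u0 Du] : exists2 u, u != 0 & D u = m%:C *: u.
  have nu : nrm u != 0 by apply: contra_neq u0 => /nrm_eq0.
  exists m, (((nrm u)^-1)%:C *: u); split; [exact: ltW|by []| |].
    by rewrite opZ Du !scalerA mulrC.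
  rewrite mN innerxx nrmZ nrm_real ger0_norm ?invr_ge0 ?nrm_ge0//.
  by rewrite mulVf// expr1n; split => // /eqP; rewrite (negbTE mN).
apply/not_exists2P => noeig.
pose K := - ((m^-1)%:C *: D); have cK : cpt K by apply/cptN/cptZ.
have KE x : (1 + K) x = x - (m^-1)%:C *: D x by [].
have mV : m%:C * (m^-1)%:C = 1 :> R[i] by rewrite -rmorphM/= mulfV.
have [|B iB] := compact_perturbation cK.
  move=> x; rewrite KE => /subr0_eq xE; apply: contrapT => /eqP x0.
  case: (noeig x) => //; apply.
  by rewrite {2}xE scalerA mV scale1r.
have ReK x : complex.Re (inner ((1 + K) x) x) = nrm x ^+ 2 - m^-1 * complex.Re (inner (D x) x).
  by rewrite KE innerBl innerZl ReB ReZ -nrm2E.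
have sK : K^⋆ = K by rewrite adjN adjZ (pos_adj pD).
have pK : pos (1 + K).
  apply: posP; first by rewrite adjD adj1 sK.
  move=> x; rewrite ReK subr_ge0 mulrC ler_pdivrMr// mulrC; exact: hm.
have K1 x : complex.Re (inner ((1 + K) x) x) <= 1 * nrm x ^+ 2.
  by rewrite ReK mul1r gerBl mulr_ge0 ?invr_ge0 ?(ltW m0)// pos_ge0.
have [c c0 hc] := inverse_bounded_below iB.
pose d := Num.min c 1.
have d0 : 0 < d by rewrite lt_min c0 ltr01.
have d1 : d ^+ 2 <= 1 by rewrite expr_le1// ?(ltW d0)// ge_min lexx orbT.
have hd x : nrm x <= 1 -> complex.Re (inner (D x) x) <= m * (1 - d ^+ 2).
  move=> x1; have := pos_bound x ltr01 pK K1; rewrite mul1r ReK => h1.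
  have h2 : d ^+ 2 * nrm x ^+ 2 <= nrm ((1 + K) x) ^+ 2.
    rewrite -exprMn lerXn2r ?nnegrE ?mulr_ge0 ?nrm_ge0 ?(ltW d0)//.
    by rewrite (le_trans _ (hc x))// ler_wpM2r ?nrm_ge0// ge_min lexx.
  have h3 : nrm x ^+ 2 <= 1 by rewrite expr_le1// nrm_ge0.
  rewrite mulrC -ler_pdivrMr// mulrC.
  have : (1 - d ^+ 2) * nrm x ^+ 2 <= 1 - d ^+ 2 by rewrite ler_piMr// subr_ge0.
  lra.
have : m <= m * (1 - d ^+ 2).
  apply: ge_sup; first by case: hS.
  by move=> _ [x /= x1 <-]; exact: hd.
rewrite -{1}(mulr1 m) ler_pM2l// lerBrDl gerDr leNgt => /negP; apply.
by rewrite exprn_gt0.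
Qed.

Section deflation.
Variables (D0 : operator H) (pD0 : pos D0) (cD0 : cpt D0).

Let step_ex : forall D, exists p : R * H, pos D -> cpt D ->
  [/\ 0 <= p.1, bnd D p.1, D p.2 = p.1%:C *: p.2 &
      inner p.2 p.2 = (p.1 != 0)%:R /\ (p.1 = 0 -> p.2 = 0)].
Proof.
move=> D; have [pD|] := pselect (pos D); last by exists (0, 0).
have [cD|] := pselect (cpt D); last by exists (0, 0).
by have [m [u h]] := pos_top_eigenvector pD cD; exists (m, u).
Qed.

Let step := projT1 (choice step_ex).
Let stepP := projT2 (choice step_ex).

Let p D := rank1 (step D).2 (step D).2.
(** Splits off one top eigenvector at a time. Compressing on both sides keeps the operator positive;
    one side alone gives the same operator, as [deflate_qE] shows. *)
Fixpoint deflate n : operator H :=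
  if n is m.+1 then (1 - p (deflate m)) * deflate m * (1 - p (deflate m)) else D0.

Let m n : R := (step (deflate n)).1.
Let u n : H := (step (deflate n)).2.
Let q n := rank1 (u n) (u n).

Let deflate_pc n : pos (deflate n) /\ cpt (deflate n).
Proof.
elim: n => [//|n [IHp IHc]] /=; split; last by apply/cptMr/cptMl.
have s : (1 - p (deflate n))^⋆ = 1 - p (deflate n) by rewrite adjB adj1 adj_rank1.
by rewrite -{1}s; exact: pos_conj.
Qed.

Let m_ge0 n : 0 <= m n.
Proof. by have [h1 h2] := deflate_pc n; case: (stepP h1 h2). Qed.
Let m_bnd n : bnd (deflate n) (m n).
Proof. by have [h1 h2] := deflate_pc n; case: (stepP h1 h2). Qed.
Let m_eig n : deflate n (u n) = (m n)%:C *: u n.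
Proof. by have [h1 h2] := deflate_pc n; case: (stepP h1 h2). Qed.
Let u_unit n : inner (u n) (u n) = (m n != 0)%:R.
Proof. by have [h1 h2] := deflate_pc n; case: (stepP h1 h2) => _ _ _ []. Qed.
Let u_zero n : m n = 0 -> u n = 0.
Proof. by have [h1 h2] := deflate_pc n; case: (stepP h1 h2) => _ _ _ []. Qed.

Let deflateS n : deflate n.+1 = (1 - q n) * deflate n * (1 - q n).
Proof. by []. Qed.

Let qu n : q n (u n) = u n.
Proof.
rewrite rank1E u_unit; have [/u_zero->|_] := eqVneq (m n) 0; first by rewrite scaler0.
by rewrite scale1r.
Qed.

Let deflate_u n : deflate n.+1 (u n) = 0.
Proof. by rewrite deflateS !mulE [(1 - q n) (u n)]subE qu subrr !op_z. Qed.

Let deflate_orth n x : deflate n x = 0 -> inner x (u n) = 0.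
Proof.
move=> h; have [/u_zero->|m0] := eqVneq (m n) 0; first by rewrite inner0r.
have : (m n)%:C * inner x (u n) = 0.
  rewrite -[X in X * _]conjR -innerZr -m_eig adjEr.
  by rewrite (pos_adj (deflate_pc n).1) h inner0l.
move=> /eqP; rewrite mulf_eq0 => /orP[|/eqP//].
by rewrite eq_complex /= (negbTE m0).
Qed.

Let deflate_u_lt k n : (k < n)%N -> deflate n (u k) = 0.
Proof.
elim: n => // n IH; rewrite ltnS leq_eqVlt => /orP[/eqP->|/IH h]; first exact: deflate_u.
rewrite deflateS !mulE [(1 - q n) (u k)]subE rank1E (deflate_orth h) scale0r subr0.
by rewrite oneE h op_z.
Qed.

Let u_orth j k : inner (u j) (u k) = ((j == k) && (m k != 0))%:R.
Proof.
case: ltngtP => [jk|kj|->]; last exact: u_unit.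
  exact/deflate_orth/deflate_u_lt.
exact/inner_eq0C/deflate_orth/deflate_u_lt.
Qed.

Let deflate_qE n : deflate n.+1 = deflate n * (1 - q n).
Proof.
have h : q n * (deflate n * (1 - q n)) = 0.
  apply: op_eq => x; rewrite zeroE !mulE rank1E.
  rewrite adjE (pos_adj (deflate_pc n).1) m_eig innerZr conjR subE innerBl.
  rewrite rank1E innerZl u_unit.
  have [->|_] := eqVneq (m n) 0; first by rewrite mul0r scale0r.
  by rewrite mulr1 subrr mulr0 scale0r.
by rewrite deflateS -mulrA mulrBl mul1r h subr0.
Qed.

Let deflateE n : deflate n = D0 * (1 - \sum_(k < n) q k).
Proof.
elim: n => [|n IH]; first by rewrite big_ord0 subr0 mulr1.
rewrite deflate_qE IH big_ord_recr/= -mulrA; congr (_ * _).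
have qq : (\sum_(k < n) q k) * q n = 0.
  rewrite mulr_suml big1// => k _; apply: op_eq => x.
  by rewrite mulE !rank1E innerZl u_orth gtn_eqF//= mulr0 scale0r.
by rewrite mulrBr mulr1 mulrBl mul1r qq subr0 opprD addrA.
Qed.

Let D0u k : D0 (u k) = (m k)%:C *: u k.
Proof.
rewrite -m_eig deflateE mulE subE sumE big1 ?subr0// => j _.
by rewrite rank1E u_orth gtn_eqF ?scale0r.
Qed.

Let m_noninc : nonincreasing_seq m.
Proof.
apply/nonincreasing_seqP => n.
have [->|m0] := eqVneq (m n.+1) 0; first exact: m_ge0.
have u1 : nrm (u n.+1) = 1.
  by apply/eqP; rewrite -(@eqrXn2 _ 2)// ?nrm_ge0// nrm2E u_unit m0 expr1n.
have := m_bnd n (u n.+1); rewrite u1 mulr1; apply: le_trans.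
have <- : deflate n.+1 (u n.+1) = deflate n (u n.+1).
  rewrite deflate_qE mulE subE rank1E u_orth gtn_eqF//= scale0r subr0.
  by [].
by rewrite m_eig nrmZ nrm_real ger0_norm// u1 mulr1.
Qed.

(** Otherwise the [u n] are orthonormal with eigenvalues at least [eps], and some combination of
    [size s + 1] of them is orthogonal to [s], where [D0] shrinks by [eps / 2]. *)
Let m_to0 (eps : R) : 0 < eps -> exists n, m n < eps.
Proof.
move=> e0; apply/not_existsP => h.
have {}h n : eps <= m n by rewrite leNgt; apply/negP; exact: h.
have ou : forall j k, inner (u j) (u k) = (j == k)%:R.
  by move=> j k; rewrite u_orth (gt_eqF (lt_le_trans e0 (h k))) andbT.
have [s hs] := cD0 (ltac:(by rewrite divr_gt0) : 0 < eps / 2).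
have [c c0 hc] := exists_orthogonal_comb (fun i : 'I_(size s).+1 => u i)
  (fun i : 'I_(size s) => nth 0 s i) (ltnSn _).
have oa := onseq_fam ou (n := (size s).+1).
set x := \sum_i _ in hc.
have xE : nrm x ^+ 2 = \sum_i nrm (c 0 i) ^+ 2 by exact: onfam_nrm2.
have DxE : nrm (D0 x) ^+ 2 = \sum_(i < (size s).+1) nrm ((m i)%:C * c 0 i) ^+ 2.
  rewrite -(onfam_nrm2 (fun i : 'I__ => (m i)%:C * c 0 i) oa) op_sum; congr (nrm _ ^+ 2).
  by apply: eq_bigr => i _; rewrite opZ D0u scalerA mulrC.
have x0 : 0 < nrm x ^+ 2.
  rewrite lt_def sqr_ge0 andbT; apply: contra_neq c0 => /eqP.
  rewrite xE psumr_eq0 => [/allP h0|i _]; last exact: sqr_ge0.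
  apply/rowP => i; rewrite mxE; apply/nrm_eq0/eqP; rewrite -sqrf_eq0.
  by apply: h0; rewrite mem_index_enum.
have h1 : nrm (D0 x) <= eps / 2 * nrm x.
  apply: hs => a /(nthP 0)[i si <-]; exact: (hc (Ordinal si)).
have h2 : eps ^+ 2 * nrm x ^+ 2 <= nrm (D0 x) ^+ 2.
  rewrite DxE xE mulr_sumr; apply: ler_sum => i _.
  rewrite nrmM exprMn ler_wpM2r ?sqr_ge0// lerXn2r ?nnegrE ?nrm_ge0 ?(ltW e0)//.
  by rewrite nrm_real ger0_norm.
have : eps ^+ 2 * nrm x ^+ 2 <= (eps / 2) ^+ 2 * nrm x ^+ 2.
  have e20 : 0 <= eps / 2 by rewrite divr_ge0// ltW.
  by rewrite (le_trans h2)// -exprMn lerXn2r ?nnegrE ?nrm_ge0// mulr_ge0 ?nrm_ge0.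
rewrite ler_pM2r// expr_div_n ler_pdivlMr ?exprn_gt0//.
have : 0 < eps ^+ 2 by rewrite exprn_gt0.
lra.
Qed.

(** The [u n] with [m n = l] span the eigenspace: the residual [y] of an eigenvector is orthogonal
    to every [u j], so [D0] agrees on it with [deflate N], whose bound [m N] is below [l]. *)
Let eigenspace_dim (l : R) : 0 < l -> exists2 k,
  has_dim [set x | D0 x = l%:C *: x] k & ([set n | m n = l] #= `I_k)%card.
Proof.
move=> l0; have [N mN] := m_to0 l0.
pose I := [seq n <- iota 0 N | m n == l].
have IP n : (n \in I) = (m n == l).
  rewrite mem_filter mem_iota/= add0n; apply: andb_idr => /eqP mn.
  rewrite ltnNge; apply/negP => Nn.
  by have := m_noninc Nn; rewrite mn leNgt mN.
have uI : uniq I by rewrite filter_uniq// iota_uniq.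
exists (size I); last first.
  have -> : [set n | m n = l] = [set` [fset n in I]%fset].
    by apply/seteqP; split => n /=; rewrite finmap.inE IP => /eqP.
  by apply/card_eq_fsetP; rewrite card_fseq undup_id.
have mI (i : 'I_(size I)) : m (nth 0%N I i) = l by apply/eqP; rewrite -IP mem_nth.
apply: (@onb_has_dim _ _ _ _ (fun i : 'I_(size I) => u (nth 0%N I i))).
have oI : onfam (fun i : 'I_(size I) => u (nth 0%N I i)).
  by move=> i j; rewrite u_orth mI (gt_eqF l0) andbT nth_uniq.
split => // [i|x Dx]; first by rewrite /= D0u mI.
rewrite -famprojE; apply/subr0_eq; set y := x - _.
have Dy : D0 y = l%:C *: y.
  rewrite opB Dx scalerBr; congr (_ - _); rewrite famprojE op_sum scaler_sumr.
  by apply: eq_bigr => i _; rewrite opZ D0u mI !scalerA mulrC.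
have yu j : inner y (u j) = 0.
  have [/eqP|mj] := eqVneq (m j) l.
    by rewrite -IP => /(nthP 0%N)[i si <-]; exact: (famproj_orth x (Ordinal si) oI).
  have : (l - m j)%:C * inner y (u j) = 0.
    rewrite rmorphB/= mulrBl -innerZl -Dy.
    rewrite -[(m j)%:C]conjR -innerZr -D0u adjEr (pos_adj pD0); exact: subrr.
  move=> /eqP; rewrite mulf_eq0 => /orP[|/eqP//].
  by rewrite eq_complex /= eqxx andbT subr_eq0 eq_sym (negbTE mj).
have := m_bnd N y; rewrite deflateE mulE subE sumE big1 => [|k _]; last first.
  by rewrite rank1E yu scale0r.
rewrite subr0 oneE Dy nrmZ nrm_real gtr0_norm// => h.
apply/nrm_eq0/eqP; rewrite eq_le nrm_ge0 andbT leNgt; apply/negP => y0.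
by move: h; rewrite ler_pM2r// leNgt mN.
Qed.

Lemma spectral_sequence : exists (s : nat -> R) (v : nat -> H),
  [/\ (forall n, 0 <= s n) /\ nonincreasing_seq s,
      forall j k, inner (v j) (v k) = ((j == k) && (s k != 0))%:R,
      forall k, D0 (v k) = (s k)%:C *: v k,
      forall n, bnd (D0 * (1 - \sum_(k < n) rank1 (v k) (v k))) (s n) &
      forall l : R, 0 < l -> exists2 k,
        has_dim [set x | D0 x = l%:C *: x] k & ([set n | s n = l] #= `I_k)%card].
Proof.
exists m, u; split => //; try by split.
by move=> n; rewrite -deflateE.
Qed.

End deflation.
End spectral_sequence.

Section singular_values.
Variables (R : realType) (H : hilbertType R).
Implicit Types (A B C D W : operator H) (x y z : H).

(** At the first difference, say [t' n < s' n], let [l = s' n]. The indices where [t'] equals [l]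
    lie below [n] and serve [s'] as well, which has [n] in addition; yet both level sets have the
    cardinality of one eigenspace dimension. *)
Lemma is_singular_values_unique A (s t : nat -> R) :
  is_singular_values A s -> is_singular_values A t -> s = t.
Proof.
suff le s' t' n : is_singular_values A s' -> is_singular_values A t' ->
    (forall k, (k < n)%N -> s' k = t' k) -> s' n <= t' n.
  move=> hs ht; apply/funext => n; elim/ltn_ind: n => n IH.
  apply/eqP; rewrite eq_le !le// => k /IH; exact: esym.
move=> {s t} [s0 sn hs] [t0 tn ht] IH; rewrite leNgt; apply/negP => tsn.
have l0 : 0 < s' n by exact: le_lt_trans tsn.
have [k ds cs] := hs _ l0; have [k' dt ct] := ht _ l0.
have kk := has_dim_unique ds dt; subst k'.
have fs : finite_set [set j | s' j = s' n] by apply/finite_setP; exists k.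
have ft : finite_set [set j | t' j = s' n] by apply/finite_setP; exists k.
have : (fset_set [set j | t' j = s' n] `<` fset_set [set j | s' j = s' n])%fset.
  have lt j : t' j = s' n -> (j < n)%N.
    move=> tj; rewrite ltnNge; apply/negP => nj.
    by have := tn _ _ nj; rewrite tj leNgt tsn.
  rewrite fproperE; apply/andP; split.
    apply/fsubsetP => j; rewrite !in_fset_set// !inE/= => tj.
    by rewrite IH ?tj// lt.
  apply/negP => /fsubsetP/(_ n); rewrite !in_fset_set// !inE/= => /(_ erefl)/lt.
  by rewrite ltnn.
move=> /fproper_ltn_card.
by rewrite (card_fset_set cs) (card_fset_set ct) ltnn.
Qed.

Lemma abs_opE A W : pos W -> W * W = A^⋆ * A -> abs_op A = W.
Proof.
move=> pW WW; have : [set B | positive_op B /\ B \o B = adjoint A \o A] (abs_op A).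
  apply: getPex; exists (opfun W); split.
    by split; [exact: op_bounded|].
  by apply/funext => x /=; rewrite -mulE WW.
case=> -[bB pB] BB; rewrite -[LHS]/(opfun (Operator bB)); congr opfun.
apply: sqrt_unique => //; rewrite WW; apply: op_inj; exact: BB.
Qed.

Lemma singular_valuesP A : cpt A -> exists W (v : nat -> H),
  let s := singular_values A in
  [/\ pos W /\ W * W = A^⋆ * A, (forall n, 0 <= s n) /\ nonincreasing_seq s,
      forall j k, inner (v j) (v k) = ((j == k) && (s k != 0))%:R,
      forall k, W (v k) = (s k)%:C *: v k &
      forall n, bnd (W * (1 - \sum_(k < n) rank1 (v k) (v k))) (s n)].
Proof.
move=> cA; have [W [pW WW _]] := sqrt_exists (pos_gram A).
have cW : cpt W.
  by move=> eps /cA[s hs]; exists s => x /hs; rewrite (pos_gram_nrm x pW WW).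
have [s [v [[s0 sn] vv Wv bW hdim]]] := spectral_sequence pW cW.
have hs : is_singular_values A s.
  split => // l /hdim[k dk ck]; exists k => //.
  by rewrite (abs_opE pW WW).
have sE : singular_values A = s.
  have hg : is_singular_values A (singular_values A).
    by apply: (@getPex _ [set s | is_singular_values A s]); exists s.
  exact: is_singular_values_unique hg hs.
by exists W, v; rewrite /= sE; split.
Qed.

End singular_values.

Section ky_fan.
Variables (R : realType) (H : hilbertType R) (n : nat).
Implicit Types (A B C D W : operator H) (u z : H) (x y : 'I_n -> H).

(** Unlike orthonormal families, these are stable under contractions, which makes the Ky Fan norm
    monotone under composition on either side. *)
Definition bessel_family x :=
  forall u, \sum_i nrm (inner u (x i)) ^+ 2 <= nrm u ^+ 2.

Definition pairing A x y : R := \sum_i complex.Re (inner (A (x i)) (y i)).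

(* For compact [A] this is the Ky Fan norm, the sum of the first [n] singular
   values of [A]. *)
Definition ky_fan A := sup [set pairing A xy.1 xy.2 |
  xy in [set xy : ('I_n -> H) * ('I_n -> H) | bessel_family xy.1 /\ bessel_family xy.2]].

Lemma bessel_family_nrm x i : bessel_family x -> nrm (x i) <= 1.
Proof.
move=> hx; have := hx (x i); rewrite (bigD1 i)//= => h.
have {h} : nrm (inner (x i) (x i)) ^+ 2 <= nrm (x i) ^+ 2.
  apply: le_trans h; rewrite lerDl sumr_ge0// => j _; exact: sqr_ge0.
rewrite innerxx nrm_real ger0_norm ?sqr_ge0// => h.
rewrite leNgt; apply/negP => x1.
have x2 : 1 < nrm (x i) ^+ 2 by rewrite expr_gt1// nrm_ge0.
by move: h; rewrite leNgt expr2 ltr_pMr ?x2// (lt_trans ltr01).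
Qed.

Lemma pairing_bnd A (m : R) x y : 0 <= m -> bnd A m ->
  bessel_family x -> bessel_family y -> pairing A x y <= n%:R * m.
Proof.
move=> m0 hm hx hy; rewrite mulr_natl -[in leRHS](card_ord n) -sumr_const.
apply: ler_sum => i _; rewrite (le_trans (Re_inner_le _ _))//.
have h1 := bessel_family_nrm i hx; have h2 := bessel_family_nrm i hy.
have h3 : nrm (A (x i)) <= m by rewrite (le_trans (hm _))// ler_piMr.
by rewrite -[leRHS]mulr1 ler_pM ?nrm_ge0.
Qed.

Lemma ky_fan_ub A x y : bessel_family x -> bessel_family y -> pairing A x y <= ky_fan A.
Proof.
move=> hx hy; apply: sup_upper_bound; last by exists (x, y).
split; first by exists (pairing A x y), (x, y).
have [m m0 hm] := op_bound A.
by exists (n%:R * m) => _ [[x' y'] /= [? ?] <-]; apply: pairing_bnd => //; exact: ltW.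
Qed.

Lemma bessel_family0 : bessel_family (fun=> 0).
Proof.
by move=> u; rewrite big1 ?sqr_ge0// => i _; rewrite inner0r nrm0 expr0n.
Qed.

Lemma ky_fan_le A (c : R) :
  (forall x y, bessel_family x -> bessel_family y -> pairing A x y <= c) -> ky_fan A <= c.
Proof.
move=> h; apply: ge_sup.
  by exists (pairing A (fun=> 0) (fun=> 0)), (fun=> 0, fun=> 0) => //; split; exact: bessel_family0.
by move=> _ [[x y] /= [? ?] <-]; exact: h.
Qed.

Lemma pairingD A B x y : pairing (A + B) x y = pairing A x y + pairing B x y.
Proof. by rewrite -big_split; apply: eq_bigr => i _; rewrite addE innerDl ReD. Qed.

Lemma pairingZ (r : R) A x y : pairing (r%:C *: A) x y = r * pairing A x y.
Proof. by rewrite mulr_sumr; apply: eq_bigr => i _; rewrite scaleE innerZl ReZ. Qed.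

Lemma ky_fanD A B : ky_fan (A + B) <= ky_fan A + ky_fan B.
Proof.
by apply: ky_fan_le => x y hx hy; rewrite pairingD lerD// ky_fan_ub.
Qed.

Lemma bessel_family_mul C (r : R) x : 0 < r -> bnd C^⋆ r ->
  bessel_family x -> bessel_family (fun i => (r^-1)%:C *: C (x i)).
Proof.
move=> r0 hr hx u.
under eq_bigr do rewrite innerZr conjR adjEr nrmM nrm_real exprMn.
rewrite -mulr_sumr gtr0_norm ?invr_gt0// exprVn mulrC ler_pdivrMr ?exprn_gt0//.
by rewrite (le_trans (hx _))// mulrC -exprMn lerXn2r ?nnegrE ?nrm_ge0// mulr_ge0 ?nrm_ge0 ?(ltW r0).
Qed.

Lemma ky_fanMr A C (r : R) : 0 < r -> bnd C r -> ky_fan (A * C) <= r * ky_fan A.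
Proof.
move=> r0 hr; apply: ky_fan_le => x y hx hy.
rewrite -ler_pdivrMl//.
apply: le_trans (ky_fan_ub _ (bessel_family_mul r0 (bnd_adj (ltW r0) hr) hx) hy).
rewrite mulr_sumr; apply: ler_sum => i _.
by rewrite opZ innerZl ReZ mulE.
Qed.

Lemma ky_fanMl A C (r : R) : 0 < r -> bnd C r -> ky_fan (C * A) <= r * ky_fan A.
Proof.
move=> r0 hr; apply: ky_fan_le => x y hx hy.
have hC : bnd (C^⋆)^⋆ r by rewrite adjK.
rewrite -ler_pdivrMl//.
apply: le_trans (ky_fan_ub _ hx (bessel_family_mul r0 hC hy)).
rewrite mulr_sumr; apply: ler_sum => i _.
by rewrite innerZr conjR ReZ mulE adjE.
Qed.

Lemma ky_fanZ A (r : R) : 0 < r -> ky_fan (r%:C *: A) = r * ky_fan A.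
Proof.
move=> r0; apply/eqP; rewrite eq_le; apply/andP; split.
  by apply: ky_fan_le => x y hx hy; rewrite pairingZ ler_pM2l// ky_fan_ub.
rewrite mulrC -ler_pdivlMr//; apply: ky_fan_le => x y hx hy.
by rewrite ler_pdivlMr// mulrC -pairingZ ky_fan_ub.
Qed.

End ky_fan.

Section ky_fan_singular_values.
Variables (R : realType) (H : hilbertType R).
Implicit Types (A B C D W : operator H).

(* Orthonormal up to some vectors that vanish. *)
Definition ponfam n (a : 'I_n -> H) (b : 'I_n -> bool) :=
  forall i j, inner (a i) (a j) = ((i == j) && b j)%:R.

Lemma ponfam_comb n (a : 'I_n -> H) b (c : 'I_n -> R[i]) j : ponfam a b ->
  inner (\sum_i c i *: a i) (a j) = c j * (b j)%:R.
Proof.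
move=> oa; rewrite inner_suml (bigD1 j)//= innerZl oa eqxx.
by rewrite big1 ?addr0// => i ij; rewrite innerZl oa (negbTE ij) mulr0.
Qed.

Lemma ponfam_coef n (a : 'I_n -> H) b u j : ponfam a b ->
  inner u (a j) * (b j)%:R = inner u (a j).
Proof.
move=> oa; case bj : (b j); first by rewrite mulr1.
have -> : a j = 0 by apply: innerxx_eq0; rewrite oa bj andbF.
by rewrite inner0r mul0r.
Qed.

Lemma ponfam_orth n (a : 'I_n -> H) b u j : ponfam a b ->
  inner (u - famproj a u) (a j) = 0.
Proof.
by move=> oa; rewrite innerBl famprojE (ponfam_comb _ j oa) (ponfam_coef u j oa) subrr.
Qed.

Lemma ponfam_nrm2 n (a : 'I_n -> H) b u : ponfam a b ->
  nrm u ^+ 2 = nrm (famproj a u) ^+ 2 + nrm (u - famproj a u) ^+ 2.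
Proof.
move=> oa; rewrite -pythagoras; first by rewrite addrC subrK.
rewrite {1}famprojE inner_suml big1// => i _; rewrite innerZl.
by rewrite (inner_eq0C (ponfam_orth u i oa)) mulr0.
Qed.

Lemma ponfam_bessel n (a : 'I_n -> H) b : ponfam a b -> bessel_family a.
Proof.
move=> oa u; rewrite (ponfam_nrm2 u oa).
suff -> : nrm (famproj a u) ^+ 2 = \sum_i nrm (inner u (a i)) ^+ 2.
  by rewrite lerDl sqr_ge0.
rewrite nrm2E famprojE inner_sumr Re_sum; apply: eq_bigr => i _.
by rewrite innerZr (ponfam_comb _ i oa) (ponfam_coef u i oa) mulrC nrmJ.
Qed.

(** The singular vectors themselves attain the sum. For the upper bound, [A] is split into a part of
    norm at most [s n], which contributes [n * s n], and a finite-rank part contributing the sum of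
    the [s k - s n]. *)
Lemma ky_fan_singular_values A n : cpt A ->
  ky_fan n A = \sum_(i < n) singular_values A i.
Proof.
move=> cA; have [W [v /=]] := singular_valuesP cA.
set s := singular_values A => -[[pW WW] [s0 sn] vv Wv bW].
(* Left singular vectors; [w k] vanishes together with [v k] when [s k = 0]. *)
pose w k := ((s k)^-1)%:C *: A (v k).
have vz k : s k = 0 -> v k = 0.
  by move=> sk; apply: innerxx_eq0; rewrite vv sk !eqxx.
have WWv k : (W * W) (v k) = (s k ^+ 2)%:C *: v k.
  by rewrite mulE Wv opZ Wv scalerA -rmorphM.
have Av k : A (v k) = (s k)%:C *: w k.
  have [sk|sk] := eqVneq (s k) 0; first by rewrite vz// op_z sk scale0r.
  by rewrite /w scalerA -rmorphM/= mulfV// scale1r.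
have wA j z : inner (A z) (w j) = (s j)%:C * inner z (v j).
  have [sj|sj] := eqVneq (s j) 0; first by rewrite /w vz// op_z scaler0 !inner0r mulr0.
  rewrite /w innerZr conjR adjE -mulE -WW WWv innerZr conjR mulrA -rmorphM/=.
  by rewrite expr2 mulKf.
have ww j k : inner (w j) (w k) = ((j == k) && (s k != 0))%:R.
  rewrite {1}/w innerZl wA vv; have [->|//] := eqVneq j k; last first.
    by rewrite !mulr0.
  have [->|sk] := eqVneq (s k) 0; first by rewrite !mulr0.
  by rewrite mulr1 -rmorphM/= mulVf.
clearbody w.
have ov : ponfam (fun i : 'I_n => v i) (fun i => s i != 0) by move=> i j; rewrite vv.
have ow : ponfam (fun i : 'I_n => w i) (fun i => s i != 0) by move=> i j; rewrite ww.
apply/eqP; rewrite eq_le; apply/andP; split; last first.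
  apply: le_trans (ky_fan_ub A (ponfam_bessel ov) (ponfam_bessel ow)).
  apply: ler_sum => i _; rewrite wA vv ReZ.
  have [->|_] := eqVneq (s i) 0; first by rewrite mul0r.
  by rewrite eqxx mulr1.
apply: ky_fan_le => x y hx hy.
(* The weights [s k - s n], rather than [s k], leave in [A - F] a multiple [s n] of a partial
   isometry on the first vectors, so that its bound remains [s n]. *)
pose F := \sum_(k < n) (s k - s n)%:C *: rank1 (v k) (w k).
pose E := famproj (fun i : 'I_n => v i).
have bA' : bnd (A - F) (s n).
  move=> z; have -> : (A - F) z = A (z - E z) + (s n)%:C *: \sum_(k < n) inner z (v k) *: w k.
    have FE k : ((s k - s n)%:C *: rank1 (v k) (w k)) z =
        A (inner z (v k) *: v k) - (s n)%:C *: (inner z (v k) *: w k).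
      rewrite scaleE rank1E opZ Av !scalerA -scalerBl; congr (_ *: _).
      by rewrite rmorphB/=; ring.
    rewrite subE sumE opB famprojE op_sum scaler_sumr.
    under [X in _ - X = _]eq_bigr do rewrite FE.
    by rewrite sumrB opprB addrA addrAC.
  rewrite -ler_sqr ?nnegrE ?mulr_ge0 ?nrm_ge0// exprMn (ponfam_nrm2 z ov) mulrDr.
  rewrite pythagoras; last first.
    rewrite innerZr inner_sumr big1 ?mulr0// => k _.
    by rewrite innerZr wA (ponfam_orth z k ov) !mulr0.
  rewrite addrC nrmZ nrm_real ger0_norm// exprMn lerD//.
    rewrite ler_wpM2l ?sqr_ge0// famprojE !nrm2E !inner_sumr !Re_sum.
    apply: ler_sum => k _; rewrite !innerZr.
    have /= -> := ponfam_comb (fun i : 'I_n => inner z (v i)) k ov.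
    by have /= -> := ponfam_comb (fun i : 'I_n => inner z (v i)) k ow.
  rewrite -exprMn lerXn2r ?nnegrE ?mulr_ge0 ?nrm_ge0//.
  rewrite -(pos_gram_nrm _ pW WW).
  have /= zE k := ponfam_orth z k ov; rewrite -/E in zE *.
  move: (z - E z) zE => z' zE.
  have := bW n z'; rewrite mulE subE sumE big1 ?subr0// => k _.
  by rewrite rank1E zE scale0r.
rewrite -[A](subrK F) pairingD.
have h1 := pairing_bnd (s0 n) bA' hx hy.
have h2 : pairing F x y <= \sum_(k < n) (s k - s n).
  have -> : pairing F x y = \sum_(k < n) (s k - s n) * pairing (rank1 (v k) (w k)) x y.
    rewrite /pairing; under [RHS]eq_bigr do rewrite mulr_sumr.
    rewrite exchange_big/=; apply: eq_bigr => i _.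
    rewrite sumE inner_suml Re_sum; apply: eq_bigr => k _.
    by rewrite scaleE innerZl ReZ.
  apply: ler_sum => k _; rewrite ler_piMr ?subr_ge0//.
    by apply: sn; exact: ltnW.
  have vle : nrm (v k) ^+ 2 <= 1 by rewrite nrm2E vv; case: (_ && _).
  have wle : nrm (w k) ^+ 2 <= 1 by rewrite nrm2E ww; case: (_ && _).
  (* The product of two coefficients is at most half the sum of their squares, and both families are
     Bessel. *)
  have : pairing (rank1 (v k) (w k)) x y <=
      \sum_i (nrm (inner (v k) (x i)) ^+ 2 + nrm (inner (w k) (y i)) ^+ 2) / 2.
    apply: ler_sum => i _; rewrite rank1E innerZl (le_trans (Re_le_nrm _))// nrmM.
    rewrite innerC nrm_conj.
    have := sqr_ge0 (nrm (inner (v k) (x i)) - nrm (inner (w k) (y i))); lra.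
  rewrite -mulr_suml big_split/=; have := hx (v k); have := hy (w k); lra.
have -> : \sum_(i < n) s i = n%:R * s n + \sum_(k < n) (s k - s n).
  rewrite sumrB sumr_const card_ord mulr_natl addrC subrK//.
by rewrite lerD.
Qed.

End ky_fan_singular_values.

(** * Total boundedness and relatively compact images *)

Section total_boundedness.
Variables (R : realType) (H : hilbertType R).
Implicit Types (A B K : operator H) (x y z : H) (S : set H).

Definition totally_bounded S := forall e : R, 0 < e ->
  exists s : seq H, forall y, S y -> exists2 p, p \in s & nrm (y - p) <= e.

Lemma ultra_cover (T : Type) (U : set_system T) (I : eqType) (s : seq I) (B : I -> set T) :
  UltraFilter U -> U (fun t => exists2 i, i \in s & B i t) -> exists2 i, i \in s & U (B i).
Proof.
move=> uU; elim: s => [|i s IH] h.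
  by exfalso; apply: (@filter_not_empty _ U); apply: filterS h => t [].
have [UB|UB] := in_ultra_setVsetC (B i) uU; first by exists i; rewrite ?mem_head.
have [|j js Uj] := IH; last by exists j; rewrite // in_cons js orbT.
apply: filterS2 h UB => t [j]; rewrite in_cons => /orP[/eqP->//|js Bj _].
by exists j.
Qed.

(** An ultrafilter containing a finite union of small balls contains one of them, so it is Cauchy
    and converges. *)
Lemma totally_bounded_precompact S : totally_bounded S -> precompact S.
Proof.
move=> tS; rewrite precompactE compact_ultra => U uU US.
have cU : cvg U.
  apply: cauchy_cvg; apply: cauchy_exP => e e0.
  have eE : e = (complex.Re e)%:C by rewrite RRe_real// gtr0_real.
  have {}e0 : 0 < complex.Re e by rewrite -ltcR -eE.
  (* A point of the closure is moved into [S] at cost a sixth of the radius and to the net at cost a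
     third, half in total. *)
  have [s hs] := tS (complex.Re e / 3) ltac:(by rewrite divr_gt0).
  have [|p ps Up] := @ultra_cover _ U _ s (fun p => [set y | nrm (y - p) <= complex.Re e / 2]) uU.
    apply: filterS US => y cy.
    have [y' [Sy' yy']] := cy (ball y (complex.Re e / 6)%:C)
      (ltac:(by apply: nbhsx_ballx; rewrite ltcR divr_gt0)).
    have [p ps yp] := hs y' Sy'; exists p => //=.
    move: yy'; rewrite -ball_normE /ball_/= nrmE ltcR => yy'.
    rewrite -(subrKA y') (le_trans (nrmD _ _))//; lra.
  exists p; apply: filterS Up => y /= yp.
  rewrite -ball_normE /ball_/= eE nrmE ltcR nrmC.
  by apply: le_lt_trans yp _; rewrite ltr_pdivrMr// ltr_pMr// ltr1n.
exists (lim U); split => //=.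
by apply: (closed_cvg (closure S)) cU; [exact: closed_closure|exact: US].
Qed.

Lemma totally_boundedD S T : totally_bounded S -> totally_bounded T ->
  totally_bounded [set z | exists x y, [/\ S x, T y & z = x + y]].
Proof.
move=> hS hT e e0; have e2 : 0 < e / 2 by rewrite divr_gt0.
have [s hs] := hS _ e2; have [t ht] := hT _ e2.
exists [seq p + q | p <- s, q <- t] => _ [x [y [/hs[p ps xp] /ht[q qt yq] ->]]].
exists (p + q); first exact: allpairs_f.
by rewrite opprD addrACA (le_trans (nrmD _ _))// (splitr e) lerD.
Qed.

Lemma totally_bounded_interval (M : R) b :
  totally_bounded [set t%:C *: b | t in [set t | `|t| <= M]].
Proof.
move=> e e0; have b0 := nrm_ge0 b.
pose d := e / (nrm b + 1).
have d0 : 0 < d by rewrite divr_gt0// ltr_wpDl.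
have [N NE] : exists N, N = (Num.truncn (2 * M / d)).+1 by eexists.
exists [seq (k%:R * d - M)%:C *: b | k <- iota 0 N].
move=> _ [t /= tM <-].
have [M1 M2] : - M <= t /\ t <= M by move: tM; rewrite ler_norml => /andP.
have a0 : 0 <= (t + M) / d by rewrite divr_ge0 ?(ltW d0)//; lra.
pose k := Num.truncn ((t + M) / d).
have /andP[k1 k2] := truncn_itv a0; rewrite -/k in k1 k2.
exists ((k%:R * d - M)%:C *: b).
  apply: (map_f (fun k : nat => (k%:R * d - M)%:C *: b)).
  rewrite mem_iota/= add0n NE ltnS; apply: le_truncn.
  by rewrite ler_pM2r ?invr_gt0//; lra.
rewrite -scalerBl -rmorphB/= nrmZ nrm_real.
move: k1 k2; rewrite ler_pdivlMr// ltr_pdivrMr// -natr1 mulrDl mul1r => k1 k2.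
have -> : `|t - (k%:R * d - M)| = t - (k%:R * d - M) by rewrite ger0_norm//; lra.
apply: (@le_trans _ _ (d * nrm b)); first by rewrite ler_wpM2r//; lra.
rewrite /d -mulrA ler_piMr ?(ltW e0)// mulrC ler_pdivrMr ?mul1r ?lerDl//.
by rewrite ltr_wpDl.
Qed.

Lemma totally_bounded_disc (M : R) b :
  totally_bounded [set c *: b | c in [set c : R[i] | nrm c <= M]].
Proof.
have h := totally_boundedD (@totally_bounded_interval M b)
  (@totally_bounded_interval M ('i%C *: b)).
move=> e /h[s hs]; exists s => _ [c /= cM <-]; apply: hs.
have nc : nrm c = Num.sqrt (complex.Re c ^+ 2 + complex.Im c ^+ 2) by rewrite /nrm normc_def.
exists ((complex.Re c)%:C *: b), ((complex.Im c)%:C *: ('i%C *: b)); split.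
- exists (complex.Re c) => //=; rewrite (le_trans _ cM)// nc -sqrtr_sqr.
  by rewrite ler_sqrt ?lerDl ?addr_ge0 ?sqr_ge0.
- exists (complex.Im c) => //=; rewrite (le_trans _ cM)// nc -sqrtr_sqr.
  by rewrite ler_sqrt ?lerDr ?addr_ge0 ?sqr_ge0.
- by rewrite scalerA -scalerDl [in LHS](complexE c) mulrC [X in _ + X]mulrC.
Qed.

Lemma totally_bounded_comb n (M : R) (b : 'I_n -> H) :
  totally_bounded [set z | exists2 c : 'I_n -> R[i],
    (forall i, nrm (c i) <= M) & z = \sum_i c i *: b i].
Proof.
elim: n => [|n IH] in b *.
  move=> e e0; exists [:: 0] => _ [c _ ->]; exists 0; rewrite ?mem_head//.
  by rewrite big_ord0 subr0 nrm0 ltW.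
have h := totally_boundedD (@totally_bounded_disc M (b ord0)) (IH (fun i => b (lift ord0 i))).
move=> e /h[s hs]; exists s => _ [c cM ->]; apply: hs.
exists (c ord0 *: b ord0), (\sum_i c (lift ord0 i) *: b (lift ord0 i)); split.
- by exists (c ord0) => //=.
- by exists (fun i => c (lift ord0 i)).
- by rewrite big_ord_recl.
Qed.

(** Needed because [am_closed] speaks of [compact_op]. Up to [e / 2], the image of the unit ball
    lies among combinations of finitely many vectors with bounded coefficients. *)
Lemma cpt_compact_op A : cpt A -> compact_op A.
Proof.
move=> cA; split; first exact: op_bounded.
apply: totally_bounded_precompact => e e0.
have e2 : 0 < e / 2 by rewrite divr_gt0.
have [k [a [b hab]]] := cpt_finite_rank cA e2.
pose M := \sum_i nrm (a i).
have [s hs] := @totally_bounded_comb k M b _ e2.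
exists s => _ [x /= x1 <-]; have {}x1 : nrm x <= 1.
  by move: x1; rewrite nrmE -[1]/(1%:C) lecR.
have [|p ps hp] := hs ((\sum_i rank1 (a i) (b i)) x).
  exists (fun i => inner x (a i)); last by rewrite sumE.
  move=> i; rewrite (le_trans (cauchy_schwarz _ _))//.
  apply: (@le_trans _ _ (nrm (a i))); first by rewrite ler_piMl ?nrm_ge0.
  by rewrite /M (bigD1 i)//= lerDl sumr_ge0// => j _; exact: nrm_ge0.
exists p => //; rewrite -(subrKA ((\sum_i rank1 (a i) (b i)) x)).
rewrite (le_trans (nrmD _ _))// (splitr e) lerD// -subE (le_trans (hab x))//.
by rewrite ler_piMr// ltW.
Qed.

End total_boundedness.

Section sylvester.
Variables (R : realType) (H : hilbertType R).
Implicit Types (A B C D K L X Y : operator H).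

(* The equation [2 X = D + Y X + X Y'] with contractions [Y] and [Y'] bounds
   every seminorm of [X] that is monotone under composition by a multiple of
   the seminorm of [D]. *)
Variables (X D Y Y' : operator H) (r : R).
Hypotheses (r0 : 0 < r) (r1 : r < 1) (hY : bnd Y r) (hY' : bnd Y' r).
Hypothesis XE : X = (2^-1)%:C *: (D + Y * X + X * Y').

(** If [X] is small off a finite-dimensional space with constant [d], the equation improves the
    constant to [e + r * d] for any [e > 0]; so the infimum of such constants is zero. *)
Lemma sylvester_cpt : cpt D -> cpt X.
Proof.
move=> cD; have [M M0 hM] := op_bound X.
have step (d e : R) : 0 < d -> 0 < e -> small_off X d -> small_off X (e + r * d).
  move=> d0 e0 hX.
  have h := small_offD (small_offD (cD _ (mulr_gt0 (ltr0n _ 2) e0))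
    (small_offMl (ltW r0) hY hX)) (small_offMr (ltW d0) hY' hX).
  have hb : bnd ((2^-1)%:C *: (1 : operator H)) 2^-1.
    by have := bndZ (2^-1)%:C (@bnd1 R H); rewrite nrm_real gtr0_norm ?invr_gt0// mulr1.
  have := small_offMl (ltac:(by []) : 0 <= 2^-1 :> R) hb h.
  rewrite opZl mul1r -XE.
  have -> : 2^-1 * (2%:R * e + r * d + d * r) = e + r * d by field.
  by [].
have sW (d e : R) : d <= e -> small_off X d -> small_off X e.
  by move=> de [s hs]; exists s => x /hs; move/le_trans; apply; rewrite ler_wpM2r ?nrm_ge0.
pose S := [set d | 0 < d /\ small_off X d].
have hS : has_inf S.
  split; last by exists 0 => d [/ltW].
  by exists M; split => //; exists [::] => x _.
have S0 : inf S <= 0.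
  rewrite leNgt; apply/negP => i0.
  (* Two such slacks make up [(1 - r) * inf S], just enough for the improved constant to fall below
     the infimum. *)
  have d0 : 0 < (1 - r) / 2 * inf S by rewrite mulr_gt0// divr_gt0// subr_gt0.
  have [d [dp dS] dlt] := inf_adherent d0 hS.
  have /(inf_lbound hS.2) : S ((1 - r) / 2 * inf S + r * d).
    by split; [rewrite addr_gt0// mulr_gt0|exact: step].
  have : r * d < r * (inf S + (1 - r) / 2 * inf S) by rewrite ltr_pM2l.
  have : r * ((1 - r) / 2 * inf S) < (1 - r) / 2 * inf S by rewrite gtr_pMl.
  lra.
move=> e e0; have [d [dp dS] de] := inf_adherent e0 hS.
by apply: sW dS; rewrite (le_trans (ltW de))// gerDr.
Qed.

Lemma sylvester_ky_fan n : ky_fan n X <= (2 * (1 - r))^-1 * ky_fan n D.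
Proof.
have h2 : 0 < 2^-1 :> R by [].
have := ky_fanZ n (D + Y * X + X * Y') h2; rewrite -XE => h.
have h3 := ky_fanD n (D + Y * X) (X * Y'); have h4 := ky_fanD n D (Y * X).
have h5 := ky_fanMl n X r0 hY; have h6 := ky_fanMr n X r0 hY'.
rewrite mulrC ler_pdivlMr; last by rewrite mulr_gt0// subr_gt0.
lra.
Qed.

End sylvester.

Section am_closed_sqrt.
Variables (R : realType) (H : hilbertType R) (e : nat -> H).
Hypothesis he : orthonormal_basis e.
Variable J : set (H -> H).
Hypothesis hJ : proper_operator_ideal J.
Hypothesis amJ : am_closed J.
Implicit Types (A B C D K L X Y : operator H).

Lemma pos_sqrt_inverse K C B : pos K -> K * K = C -> inverse C B ->
  exists L, inverse K L.
Proof.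
move=> pK KK [CB BC]; exists (K * B); split; first by rewrite mulrA KK.
have cKC : C * K = K * C by rewrite -KK mulrA.
by rewrite -(inverse_comm (conj CB BC) cKC) -mulrA KK.
Qed.

Let lower K L : pos K -> inverse K L ->
  exists2 c : R, 0 < c & forall x, c * nrm x ^+ 2 <= complex.Re (inner (K x) x).
Proof.
move=> pK iK; have [c c0 hc] := inverse_bounded_below iK.
have [M M0 hM] := op_bound K.
exists (c ^+ 2 / M); first by rewrite divr_gt0// exprn_gt0.
move=> x; have := pos_bound x M0 pK (fun y => bnd_inner y hM).
have : c ^+ 2 * nrm x ^+ 2 <= nrm (K x) ^+ 2.
  by rewrite -exprMn lerXn2r ?nnegrE ?mulr_ge0 ?nrm_ge0 ?(ltW c0)//; exact: hc.
move=> h1 h2; rewrite mulrAC ler_pdivrMr// mulrC.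
by rewrite mulrC [leRHS]mulrC (le_trans h1).
Qed.

(** [K^2 - K'^2 = K X + X K'] for [X = K - K']. Writing [K = M (1 - Y)] and [K' = M (1 - Y')] with a
    common bound [M] turns this into the Sylvester equation. *)
Lemma am_closed_sqrt K K' B B' : pos K -> pos K' ->
  inverse (K * K) B -> inverse (K' * K') B' -> J (K * K - K' * K') -> J (K - K').
Proof.
move=> pK pK' iK iK' JD.
have [L iL] := pos_sqrt_inverse pK erefl iK.
have [L' iL'] := pos_sqrt_inverse pK' erefl iK'.
have [c1 c10 h1] := lower pK iL; have [c2 c20 h2] := lower pK' iL'.
have [M1 M10 hM1] := op_bound K; have [M2 M20 hM2] := op_bound K'.
(* Adding [c] to the bounds ensures [c < M], hence [0 < r]. *)
pose c := Num.min c1 c2; pose M := M1 + M2 + c.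
have c0 : 0 < c by rewrite lt_min c10.
have M0 : 0 < M by rewrite !addr_gt0.
pose r := 1 - c / M.
have r0 : 0 < r by rewrite subr_gt0 ltr_pdivrMr// mul1r ltrDr addr_gt0.
have r1 : r < 1 by rewrite gtrBl divr_gt0.
have contr (Q : operator H) : pos Q -> (forall x, c * nrm x ^+ 2 <= complex.Re (inner (Q x) x)) ->
    bnd Q M -> bnd (1 - (M^-1)%:C *: Q) r.
  move=> pQ hc hM.
  have ReE x : complex.Re (inner ((1 - (M^-1)%:C *: Q) x) x) =
      nrm x ^+ 2 - M^-1 * complex.Re (inner (Q x) x).
    by rewrite subE innerBl scaleE innerZl ReB ReZ -nrm2E.
  apply: pos_bnd => //.
    apply: posP; first by rewrite adjB adj1 adjZ (pos_adj pQ).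
    move=> x; rewrite ReE subr_ge0 mulrC ler_pdivrMr// mulrC; exact: bnd_inner.
  move=> x; rewrite ReE /r mulrBl mul1r lerD2l lerN2 mulrAC mulrC.
  by rewrite ler_pM2l ?invr_gt0.
have c1c : c <= c1 by rewrite ge_min lexx.
have c2c : c <= c2 by rewrite ge_min lexx orbT.
have M1M : M1 <= M by rewrite /M; lra.
have M2M : M2 <= M by rewrite /M; lra.
have hY := contr K pK (fun x => le_trans (ler_wpM2r (sqr_ge0 _) c1c) (h1 x)) (bndW M1M hM1).
have hY' := contr K' pK' (fun x => le_trans (ler_wpM2r (sqr_ge0 _) c2c) (h2 x)) (bndW M2M hM2).
pose D : operator H := (M^-1)%:C *: (K * K - K' * K').
set X := K - K'; set Y := 1 - _ in hY; set Y' := 1 - _ in hY'.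
have XE : X = (2^-1)%:C *: (D + Y * X + X * Y').
  have -> : D + Y * X + X * Y' = X + X by rewrite /D /Y /Y' /X; op_ring.
  have half2 : 2^-1 + 2^-1 = 1 :> R by field.
  by rewrite scalerDr -scalerDl -rmorphD/= half2 scale1r.
have JD' : J D by exact: (idealZ hJ).
have k0 : 0 < (2 * (1 - r))^-1 by rewrite invr_gt0 mulr_gt0// subr_gt0.
have cD : cpt D := ideal_cpt he hJ JD'.
have cX : cpt X by exact: sylvester_cpt r0 r1 hY hY' XE cD.
(* The constant of the Ky Fan estimate is put into the operator: a multiple of [D] is still in [J],
   and it weakly submajorizes [X]. *)
have cD' : cpt (((2 * (1 - r))^-1)%:C *: D) by exact: cptZ.
apply: (amJ (cpt_compact_op cD') (cpt_compact_op cX)); first exact: (idealZ hJ).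
move=> n; rewrite -(ky_fan_singular_values n cX) -(ky_fan_singular_values n cD').
by rewrite ky_fanZ//; exact: (sylvester_ky_fan r0 r1 hY hY' XE).
Qed.

End am_closed_sqrt.

(** * Frames *)

Section bridging.
Variables (R : realType) (H : hilbertType R).
Implicit Types (A B C D E P Q K W f g : operator H) (S T : set H) (F G : nat -> H).

Lemma projector_orth P : projector P -> orth_projection P.
Proof.
move=> [sP PP]; split; first exact: op_bounded.
  by apply/funext => x /=; rewrite -mulE PP.
by rewrite -[LHS]/(opfun (P^⋆)) sP.
Qed.

Lemma orthoprojE S P : projector P -> range P = S -> orthoproj S = P.
Proof.
move=> hP rP.
have : [set Q | orth_projection Q /\ range Q = S] (orthoproj S).
  by apply: getPex; exists (opfun P); split => //; exact: projector_orth.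
case=> -[bQ QQ sQ] rQ; rewrite -[LHS]/(opfun (Operator bQ)); congr opfun.
set Q := Operator bQ; have {}QQ : Q * Q = Q by apply: op_inj; exact: QQ.
have {}sQ : Q^⋆ = Q by apply: op_inj; exact: sQ.
have absorb (X Y : operator H) : projector X -> range X = S -> range Y = S -> X * Y = Y.
  move=> [_ XX] rX rY; apply: op_eq => x; rewrite mulE.
  have : range X (Y x) by rewrite rX -rY; exists x.
  by move=> [z _ <-]; rewrite -mulE XX.
have QP := absorb Q P (conj sQ QQ) rQ rP.
have PQ := absorb P Q hP rP rQ.
by have := congr1 (@adj _ _) PQ; rewrite adjM sQ hP.1 QP.
Qed.

(** The Penrose equations determine the inverse: [A X = A B] and [X A = B A] because these are
    self-adjoint and absorb one another, whence [X = X A X = B A B]. *)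
Lemma pinvE A B : A * B * A = A -> B * A * B = B ->
  (A * B)^⋆ = A * B -> (B * A)^⋆ = B * A -> pinv A = B.
Proof.
move=> ABA BAB sAB sBA; have : [set X | is_pinv A X] (pinv A).
  apply: getPex; exists (opfun B); split; first exact: op_bounded.
  - by apply/funext => x /=; rewrite -[in RHS]ABA.
  - by apply/funext => x /=; rewrite -[in RHS]BAB.
  - by rewrite -[RHS]/(opfun (A * B)) -sAB.
  - by rewrite -[RHS]/(opfun (B * A)) -sBA.
case=> bX AXA XAX sAX sXA; rewrite -[LHS]/(opfun (Operator bX)); congr opfun.
set X := Operator bX.
have {}AXA : A * X * A = A by apply: op_inj; exact: AXA.
have {}XAX : X * A * X = X by apply: op_inj; exact: XAX.
have {}sAX : (A * X)^⋆ = A * X by apply: op_inj; exact: sAX.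
have {}sXA : (X * A)^⋆ = X * A by apply: op_inj; exact: sXA.
have AXAB : A * X = A * B.
  by rewrite -sAX -{1}ABA -mulrA adjM sAX sAB mulrA AXA.
have XABA : X * A = B * A.
  by rewrite -sXA -{1}ABA -[A * B * A]mulrA mulrA adjM sXA sBA -mulrA (mulrA A) AXA.
by rewrite -XAX XABA -mulrA AXAB mulrA BAB.
Qed.

(** [C] inverts [f^⋆ f] on the range of [E], so both products reduce to the projection onto the
    range of [f]. *)
Lemma pinv_closed_range f E C : closed_range f E C ->
  pinv (f * f^⋆ : operator H) = (f * C * C * f^⋆ : operator H).
Proof.
move=> h; have sC := cr_adjC h.
have e1 : f * f^⋆ * (f * C * C * f^⋆) = ranproj f C.
  have -> : f * f^⋆ * (f * C * C * f^⋆) = f * (f^⋆ * f * C) * C * f^⋆ by rewrite !mulrA.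
  by rewrite (cr_FFC h) (cr_FE h).
have e2 : f * C * C * f^⋆ * (f * f^⋆) = ranproj f C.
  have -> : f * C * C * f^⋆ * (f * f^⋆) = f * C * (C * (f^⋆ * f)) * f^⋆ by rewrite !mulrA.
  by rewrite (cr_CFF h) -(mulrA f C) (cr_CE h) mulrA (cr_FE h).
apply: pinvE.
- by rewrite e1 mulrA (ranprojF h).
- by rewrite e2 !mulrA (ranprojF h).
- by rewrite e1 (ranproj_projector h).1.
- by rewrite e2 (ranproj_projector h).1.
Qed.

Section polar.
Variables (f E C K : operator H).
Hypotheses (h : closed_range f E C) (pK : pos K) (KK : K * K = C).
Hypotheses (KE : K * E = E * K) (Kff : K * (f^⋆ * f) = f^⋆ * f * K).

Lemma polar_square : K * (f^⋆ * f) * K = E.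
Proof. by rewrite Kff -mulrA KK (cr_FFC h). Qed.

(** The square of the right-hand side is [f * E * f^⋆], by [polar_square]. *)
Lemma abs_op_closed_range : abs_op f^⋆ = (f * K * f^⋆ : operator H).
Proof.
apply: abs_opE.
  by have := pos_conj f^⋆ pK; rewrite adjK.
have -> : f * K * f^⋆ * (f * K * f^⋆) = f * (K * (f^⋆ * f) * K) * f^⋆ by rewrite !mulrA.
by rewrite polar_square (cr_FE h) adjK.
Qed.

Lemma pinv_abs_op : pinv (abs_op f^⋆) = (f * K * C * f^⋆ : operator H).
Proof.
rewrite abs_op_closed_range.
have KC : K * C = C * K by rewrite -KK mulrA.
have e1 : f * K * f^⋆ * (f * K * C * f^⋆) = ranproj f C.
  have -> : f * K * f^⋆ * (f * K * C * f^⋆) = f * (K * (f^⋆ * f) * K) * C * f^⋆.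
    by rewrite !mulrA.
  by rewrite polar_square (cr_FE h).
have e2 : f * K * C * f^⋆ * (f * K * f^⋆) = ranproj f C.
  have -> : f * K * C * f^⋆ * (f * K * f^⋆) = f * (K * C) * (f^⋆ * f) * K * f^⋆.
    by rewrite !mulrA.
  rewrite KC.
  have -> : f * (C * K) * (f^⋆ * f) * K * f^⋆ = f * C * (K * (f^⋆ * f) * K) * f^⋆.
    by rewrite !mulrA.
  by rewrite polar_square -mulrA (cr_EF h).
apply: pinvE.
- by rewrite e1 !mulrA (ranprojF h).
- by rewrite e2 !mulrA (ranprojF h).
- by rewrite e1 (ranproj_projector h).1.
- by rewrite e2 (ranproj_projector h).1.
Qed.

Lemma pinv_abs_op_mul : f * K * C * f^⋆ * f = f * K.
Proof. by rewrite -mulrA -mulrA (cr_CFF h) -mulrA KE mulrA (cr_FE h). Qed.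

End polar.

Lemma bounded_linear_on_op S A : bounded_linear_on S A.
Proof.
have [M _ hM] := op_bound A; split; last by exists M => x _.
by move=> a x y _ _; exact: opP.
Qed.

End bridging.

Section frames.
Variables (R : realType) (H : hilbertType R) (e : nat -> H).
Hypothesis he : orthonormal_basis e.
Variable J : set (H -> H).
Hypothesis hJ : proper_operator_ideal J.
Implicit Types (A B C D E P Q K W f g : operator H) (S T : set H) (F G : nat -> H).

Lemma frame_closed_range S F : closed_subspace S -> is_frame S F ->
  exists f E C, [/\ forall n, f (e n) = F n, closed_range f E C & range f = S].
Proof.
move=> hS /(frame_synthesis he hS)[f [fF Sf lf]].
by have [E [C [h rf]]] := closed_range_exists hS Sf lf; exists f, E, C.
Qed.

Lemma J_equivalentP F G f g :
  (forall n, f (e n) = F n) -> (forall n, g (e n) = G n) ->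
  J_equivalent J F G <->
  exists2 W, (exists B, inverse W B) /\ J (W - 1) & W * g = f.
Proof.
move=> fF gG; split.
  move=> [A [[bA [B [bB AK BK]]] JA] AG].
  exists (Operator bA); last by apply: (basis_ext he) => n; rewrite mulE gG /= AG fF.
  split; last exact: JA.
  by exists (Operator bB); split; apply: op_eq => x; rewrite mulE /= ?AK ?BK.
move=> [W [[B [WB BW]] JW] Wg]; exists (opfun W); last first.
  by move=> n; rewrite -gG -mulE Wg fF.
split; last exact: JW.
split; first exact: op_bounded.
exists (opfun B); split; first exact: op_bounded.
- by move=> x; rewrite -mulE BW.
- by move=> x; rewrite -mulE WB.
Qed.

(** [L] is meaningful on [S] only, but [L \o f] is bounded on the whole space and is determined by
    its values on the basis. *)
Lemma similar_factor S F f g (L : H -> H) : bounded_linear_on S L ->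
  (forall x, S (f x)) -> (forall n, L (f (e n)) = g (e n)) ->
  forall x, g x = L (f x).
Proof.
move=> [linL [M hM]] Sf Lfg x.
have [N N0 hN] := op_bound f.
have bLf : bounded_op (L \o f).
  (* The constant [M] may be negative when [S] is trivial, hence the maximum. *)
  apply: (@bounded_opP _ _ _ (Num.max M 0 * N)) => [a y z|y] /=.
    by rewrite opP linL.
  rewrite (le_trans (hM _ (Sf y)))// -mulrA.
  apply: (@le_trans _ _ (Num.max M 0 * nrm (f y))).
    by rewrite ler_wpM2r ?nrm_ge0// le_max lexx.
  by rewrite ler_wpM2l// le_max lexx orbT.
have -> : g = Operator bLf by apply: (basis_ext he) => n; rewrite -Lfg.
by [].
Qed.

Lemma linear_on_0 S (L : H -> H) : S 0 -> bounded_linear_on S L -> L 0 = 0.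
Proof.
move=> S0 [linL _]; have := linL (-1) 0 0 S0 S0.
by rewrite scaler0 addr0 scaleN1r addNr.
Qed.

Section pair.
Variables (S T : set H) (F G : nat -> H) (f g E E' C D : operator H).
Hypotheses (hS : closed_subspace S) (hT : closed_subspace T).
Hypotheses (fF : forall n, f (e n) = F n) (gG : forall n, g (e n) = G n).
Hypotheses (hf : closed_range f E C) (hg : closed_range g E' D).
Hypotheses (rf : range f = S) (rg : range g = T).

(** The condition to which each item of the theorem is shown to be equivalent. *)
Let good := J (f - g) /\ E = E'.

Lemma J_equivalent_good : J_equivalent J F G <-> good.
Proof. by rewrite (J_equivalentP fF gG); exact: (core he hJ hf hg). Qed.

Let synthesisB : synthesis e (F \- G) = (f - g : operator H).
Proof. by apply: (synthesisE he) => n; rewrite subE fF gG. Qed.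

Lemma nullspace_good :
  J (synthesis e (F \- G)) /\ nullspace (synthesis e F) = nullspace (synthesis e G) <-> good.
Proof.
rewrite synthesisB (synthesisE he fF) (synthesisE he gG).
split=> -[JB h]; split => //.
  apply: closed_range_ker_unique hf hg _ => x.
  by move: (congr1 (fun A : set H => A x) h); rewrite /nullspace/= => ->.
apply/seteqP; rewrite /nullspace; split => x /=.
  by rewrite (cr_nullspace hf) (cr_nullspace hg) h.
by rewrite (cr_nullspace hf) (cr_nullspace hg) h.
Qed.

Lemma weakly_similar_good :
  weakly_similar S T F G /\ J (synthesis e (F \- G)) <-> good.
Proof.
rewrite synthesisB; split.
  move=> [[L [K [[bL bK] [LST KTS] [LK KL] LFG]]] JB]; split => //.
  have Sf x : S (f x) by rewrite -rf; exists x.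
  have Tg x : T (g x) by rewrite -rg; exists x.
  have gLf := similar_factor (g := g) F bL Sf (fun n => ltac:(by rewrite fF gG LFG)).
  have fKg := similar_factor (g := f) F bK Tg
    (fun n => ltac:(by rewrite fF gG -LFG LK// inE -fF)).
  apply: closed_range_ker_unique hf hg _ => x; split=> h0.
    by rewrite gLf h0 (linear_on_0 (csub0 hS) bL).
  by rewrite fKg h0 (linear_on_0 (csub0 hT) bK).
move=> [JB EE']; split => //; have hg' := hg; rewrite -EE' in hg'.
have fg : f * D * g^⋆ * (g * C * f^⋆) = ranproj f C.
  have -> : f * D * g^⋆ * (g * C * f^⋆) = f * (D * (g^⋆ * g)) * C * f^⋆ by rewrite !mulrA.
  by rewrite (cr_CFF hg') (cr_FE hf).
have gf : g * C * f^⋆ * (f * D * g^⋆) = ranproj g D.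
  have -> : g * C * f^⋆ * (f * D * g^⋆) = g * (C * (f^⋆ * f)) * D * g^⋆ by rewrite !mulrA.
  by rewrite (cr_CFF hf) (cr_FE hg').
(* [g] after the Moore-Penrose inverse of [f], and the reverse; their composites are the projections
   onto [S] and [T]. *)
exists (opfun (g * C * f^⋆)), (opfun (f * D * g^⋆)); split.
- by split; exact: bounded_linear_on_op.
- by split=> x _; rewrite -?rf -?rg; eexists.
- split=> x; rewrite inE => Sx; rewrite -mulE.
    by rewrite fg; apply/(ranproj_range hf); rewrite rf.
  by rewrite gf; apply/(ranproj_range hg); rewrite rg.
- by move=> n; rewrite -fF -gG -mulE -!mulrA (cr_CFF hf) (cr_FE hg').
Qed.

Lemma canonical_dualE f0 E0 C0 F0 : (forall n, f0 (e n) = F0 n) ->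
  closed_range f0 E0 C0 -> forall n, (f0 * C0) (e n) = canonical_dual e F0 n.
Proof.
move=> f0F h n; rewrite /canonical_dual /frame_op (synthesisE he f0F).
rewrite -[_ \o _]/(opfun (f0 * f0^⋆)) (pinv_closed_range h) -f0F -mulE.
by rewrite -!mulrA (cr_CFF h) (cr_CE h) (mulrA f0) (cr_FE h).
Qed.

(** One direction is [ideal_dualB] for the frames, the other is the same lemma for their duals,
    since dualizing twice is the identity. *)
Lemma dual_good :
  J_equivalent J (canonical_dual e F) (canonical_dual e G) <-> good.
Proof.
have dF := closed_range_dual hf; have dG := closed_range_dual hg.
rewrite (J_equivalentP (canonical_dualE fF hf) (canonical_dualE gG hg)) (core he hJ dF dG).
split=> -[JB EE']; split => //; have hg' := hg; have dG' := dG; rewrite -EE' in hg' dG'.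
  have := ideal_dualB hJ dF dG' JB.
  by rewrite -!mulrA (cr_inv hf).2 EE' (cr_inv hg).2 !mulr1.
exact: (ideal_dualB hJ hf hg').
Qed.

Lemma good_projections : good ->
  [/\ J (orthoproj S \- orthoproj T), fredholm_pair (orthoproj S) (orthoproj T) &
      pair_index (orthoproj S) (orthoproj T) = 0].
Proof.
move=> [JB EE']; have hg' := hg; rewrite -EE' in hg'.
have PS : orthoproj S = ranproj f C.
  apply: orthoprojE; first exact: ranproj_projector hf.
  rewrite -rf; apply/seteqP; split => [_ [x _ <-]|x].
    by exists (C (f^⋆ x)).
  by move=> /(ranproj_range hf) <-; exists x.
have PT : orthoproj T = ranproj g D.
  apply: orthoprojE; first exact: ranproj_projector hg.
  rewrite -rg; apply/seteqP; split => [_ [x _ <-]|x].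
    by exists (D (g^⋆ x)).
  by move=> /(ranproj_range hg) <-; exists x.
rewrite PS PT; split.
- exact: (ideal_ranprojB hJ hf hg' JB).
- exact: (core_fredholm_pair he hJ hf hg' JB).
- have [_ [_ _ _ [n [h1 h2]]]] := core_extension he hJ hf hg' JB.
  by rewrite /pair_index (dimE h1) (dimE h2) subrr.
Qed.

(** Both directions go through [C - D] in [J] and the square-root lemma. In the converse [C - D] has
    to be recovered from the Parseval frames and the frame operators. *)
Lemma parseval_good : am_closed J ->
  good <-> J_equivalent J (parseval_frame e F) (parseval_frame e G) /\
           J (frame_op e F \- frame_op e G).
Proof.
move=> amJ.
have root f0 E0 C0 F0 : (forall n, f0 (e n) = F0 n) -> closed_range f0 E0 C0 ->
    exists K, [/\ pos K, K * K = C0, K * (f0^⋆ * f0) = f0^⋆ * f0 * K,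
      closed_range (f0 * K) E0 1 & forall n, (f0 * K) (e n) = parseval_frame e F0 n].
  move=> f0F h; have [K [pK KK cK]] := sqrt_exists (cr_posC h).
  have KE : K * E0 = E0 * K by apply/esym/cK; rewrite (cr_CE h).
  have Kff : K * (f0^⋆ * f0) = f0^⋆ * f0 * K.
    by apply/esym/cK; rewrite (cr_CFF h) (cr_FFC h).
  exists K; split => //; first exact: (closed_range_parseval h pK KK KE Kff).
  move=> n; rewrite /parseval_frame (synthesisE he f0F) -[adjoint f0]/(opfun f0^⋆).
  by rewrite (pinv_abs_op h pK KK Kff) -f0F -mulE (pinv_abs_op_mul h KE).
have [K [pK KK Kff dF tF]] := root _ _ _ _ fF hf.
have [K' [pK' KK' Kgg dG tG]] := root _ _ _ _ gG hg.
have -> : frame_op e F \- frame_op e G = (f * f^⋆ - g * g^⋆ : operator H).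
  by rewrite /frame_op (synthesisE he fF) (synthesisE he gG).
rewrite (J_equivalentP tF tG) (core he hJ dF dG).
have iK := inverse_sym (cr_inv hf); have iK' := inverse_sym (cr_inv hg).
rewrite -KK in iK; rewrite -KK' in iK'.
have root_ideal : J (C - D) -> J (K - K').
  by rewrite -KK -KK'; exact: (am_closed_sqrt he hJ amJ pK pK' iK iK').
split=> [[JB EE']|[[Jt EE'] JS]].
  have hg' := hg; rewrite -EE' in hg'.
  split; last exact: (ideal_gramrB hJ JB).
  split => //; have -> : f * K - g * K' = (f - g) * K + g * (K - K').
    by rewrite mulrBr mulrBl addrA subrK.
  apply: (idealD hJ); first exact: (idealMr hJ).
  by apply: (idealMl hJ); apply: root_ideal; exact: (ideal_crB hJ hf hg' JB).
split => //.
(* With [t = f * K] the Parseval synthesis, [t^⋆ (f f^⋆) t = f^⋆ f]: the two assumptions in [J] thus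
   combine to the difference of the Gram operators. *)
have gramE f0 E0 C0 K0 : closed_range f0 E0 C0 -> pos K0 -> K0 * K0 = C0 ->
    K0 * (f0^⋆ * f0) = f0^⋆ * f0 * K0 ->
    (f0 * K0)^⋆ * (f0 * f0^⋆) * (f0 * K0) = f0^⋆ * f0.
  move=> h pK0 KK0 Kff0; rewrite adjM (pos_adj pK0).
  have -> : K0 * f0^⋆ * (f0 * f0^⋆) * (f0 * K0) = K0 * (f0^⋆ * f0) * (f0^⋆ * f0 * K0).
    by rewrite !mulrA.
  rewrite -Kff0 {1}Kff0 -mulrA (mulrA K0 K0) KK0 (cr_CFF h).
  by rewrite -mulrA (cr_FE h).
have JCD : J (C - D).
  apply: (ideal_inverseB hJ (cr_inv hf) (cr_inv hg)).
  rewrite EE' opprD addrACA subrr addr0.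
  rewrite -(gramE _ _ _ _ hf pK KK Kff) -(gramE _ _ _ _ hg pK' KK' Kgg).
  set t := f * K in Jt *; set t' := g * K' in Jt *.
  have -> : t^⋆ * (f * f^⋆) * t - t'^⋆ * (g * g^⋆) * t' =
      (t - t')^⋆ * ((f * f^⋆) * t) + t'^⋆ * (f * f^⋆ - g * g^⋆) * t
      + t'^⋆ * (g * g^⋆) * (t - t').
    by rewrite adjB; op_ring.
  apply: (idealD hJ); last exact: (idealMl hJ).
  apply: (idealD hJ); first by apply: (idealMr hJ); exact: (ideal_adj hJ).
  by apply: (idealMr hJ); exact: (idealMl hJ).
have [L iL] := pos_sqrt_inverse pK KK (inverse_sym (cr_inv hf)).
have [L' iL'] := pos_sqrt_inverse pK' KK' (inverse_sym (cr_inv hg)).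
(* The normalization is undone by the inverses [L], [L'] of the roots. *)
have -> : f - g = (f * K - g * K') * L + g * K' * (L - L').
  rewrite mulrBr mulrBl addrA subrK -!mulrA iL.1 iL'.1.
  by rewrite !mulr1.
apply: (idealD hJ); first exact: (idealMr hJ).
by apply: (idealMl hJ); apply: (ideal_inverseB hJ iL iL'); exact: root_ideal.
Qed.

End pair.
End frames.

Theorem theorem5p11 (R : realType) (H : hilbertType R) (e : nat -> H)
    (he : orthonormal_basis e)
    (S T : set H) (hS : closed_subspace S) (hT : closed_subspace T)
    (F G : nat -> H) (hF : is_frame S F) (hG : is_frame T G)
    (J : set (H -> H)) (hJ : proper_operator_ideal J) :
  [/\ [<-> J_equivalent J F G;
           J (synthesis e (F \- G)) /\
             nullspace (synthesis e F) = nullspace (synthesis e G);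
           weakly_similar S T F G /\ J (synthesis e (F \- G));
           J_equivalent J (canonical_dual e F) (canonical_dual e G)],
      J_equivalent J F G ->
        [/\ J (orthoproj S \- orthoproj T), fredholm_pair (orthoproj S) (orthoproj T) &
            pair_index (orthoproj S) (orthoproj T) = 0] &
      am_closed J ->
        (J_equivalent J F G <->
         J_equivalent J (parseval_frame e F) (parseval_frame e G) /\
         J (frame_op e F \- frame_op e G))].
Proof.
have [f [E [C [fF hf rf]]]] := frame_closed_range he hS hF.
have [g [E' [D [gG hg rg]]]] := frame_closed_range he hT hG.
have i_good := J_equivalent_good he hJ fF gG hf hg.
have ii_good := nullspace_good he J fF gG hf hg.
have iii_good := weakly_similar_good he J hS hT fF gG hf hg rf rg.
have iv_good := dual_good he hJ fF gG hf hg.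
split.
- tfae=> [/i_good/ii_good|/ii_good/iii_good|/iii_good/iv_good|/iv_good/i_good] //.
- by move=> /i_good h; apply: (good_projections he hJ hf hg rf rg h).
- by move=> amJ; rewrite i_good; exact: (parseval_good he hJ fF gG hf hg amJ).
Qed.
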